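(* Let $\lambda>-1$. The set of all operators $\varphi(\mathbf{N})$, defined by (the equivalence classes of) $E$-measurable functions $\varphi$ with $\{\varphi(k)\}_{k\in\mathbb{Z}_+}\in\ell_\infty$, constitutes the class of bounded mutually commuting radial operators in $\mathcal{A}^2_\lambda(\mathbb{D})$, and thus coincides with the von Neumann algebra of bounded radial operators in $\mathcal{A}^2_\lambda(\mathbb{D})$.
   Context: $\mathbb{Z}_+=\{0,1,2,\dots\}$; $\ell_\infty$ is the space of bounded sequences indexed by $\mathbb{Z}_+$. For $\lambda>-1$, $\mathcal{A}^2_\lambda(\mathbb{D})$ is the weighted Bergman space: the closed subspace of analytic functions in $L_2(\mathbb{D},d\mu_\lambda)$, where $\mathbb{D}\subset\mathbb{C}$ is the unit disk, $d\mu_\lambda(z)=\frac{\lambda+1}{\pi}(1-|z|^2)^\lambda dA(z)$ and $dA$ is Lebesgue measure. Its standard orthonormal basis is $\mathbf{e}_k(z)=\sqrt{\frac{\Gamma(k+\lambda+2)}{k!\,\Gamma(\lambda+2)}}\,z^k$, $k\in\mathbb{Z}_+$. An operator in $\mathcal{A}^2_\lambda(\mathbb{D})$ is called radial if it commutes with all rotation operators $(\varpi(t)f)(z)=f(t^{-1}z)$, $t\in\mathbb{T}=\{t\in\mathbb{C}:|t|=1\}$. The operator $\mathbf{N}$ is the self-adjoint operator in $\mathcal{A}^2_\lambda(\mathbb{D})$ acting by $\mathbf{N}\big(\sum_k f_k\mathbf{e}_k\big)=\sum_k k f_k\mathbf{e}_k$ on the domain $\{\sum_k f_k\mathbf{e}_k\in\mathcal{A}^2_\lambda(\mathbb{D}):\sum_k|kf_k|^2<\infty\}$;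 equivalently $(\mathbf{N}f)(z)=z f'(z)$. $\mathrm{P}_k f=\langle f,\mathbf{e}_k\rangle\mathbf{e}_k$. The spectral measure of $\mathbf{N}$ is $E(S)=\sum_{k\in S\cap\mathbb{Z}_+}\mathrm{P}_k$ for Borel $S\subset\mathbb{R}$; let $\mathbf{E}(\eta)=E((-\infty,\eta))$. A function $\varphi:\mathbb{R}\to\mathbb{C}$ is $E$-measurable if it is measurable with respect to the Stieltjes measure of $\rho_f(\eta)=\langle f,\mathbf{E}(\eta)f\rangle$ for all $f\in\mathcal{A}^2_\lambda(\mathbb{D})$; functions differing on a set of zero $E$-measure are identified. The operator $\varphi(\mathbf{N})$ is $\int_{\mathbb{R}}\varphi(\eta)\,d\mathbf{E}(\eta)=\sum_{k\in\mathbb{Z}_+}\varphi(k)\mathrm{P}_k$ (strong convergence). *)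

(* Defs.v *)
From HB Require Import structures.
From mathcomp Require Import all_boot all_order all_algebra.
From mathcomp Require Import all_classical all_reals all_analysis.
From mathcomp Require Import measurable_realfun complex ring lra.

Set Implicit Arguments.
Unset Strict Implicit.
Unset Printing Implicit Defensive.
Import Order.TTheory GRing.Theory Num.Theory.
Import numFieldNormedType.Exports.
Import ComplexField.Normc.
Local Open Scope classical_set_scope.
Local Open Scope ring_scope.

(* [R[i]] carries no topology by itself; typed as a [numFieldType] it gets the
   metric topology of its norm. *)
Definition C (R : realType) : numFieldType := R[i].

Definition unit_disk (R : realType) : set R[i] := [set z | `|z| < 1].

Definition toC (R : realType) (p : R * R) : R[i] := Complex p.1 p.2.

Definition analytic_on (R : realType) (D : set R[i]) (f : R[i] -> R[i]) : Prop :=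
  forall z0, D z0 -> exists (a : nat -> R[i]) (r : R), 0 < r /\
    forall z, `|z - z0| < r%:C%C ->
      series (fun n => a n * (z - z0) ^+ n : C R) @ \oo --> (f z : C R).

Section weighted_measure.
Context {R : realType}.
Implicit Types (lambda : R) (f g : R[i] -> R[i]).

Definition weight lambda (z : R[i]) : R :=
  (lambda + 1) / pi * (1 - normc z ^+ 2) `^ lambda.

Definition dmu_integral lambda (F : R[i] -> R) : \bar R :=
  (\int[lebesgue_measure \x lebesgue_measure]_(p in @toC R @^-1` @unit_disk R)
     (F (toC p) * weight lambda (toC p))%:E)%E.

Definition in_L2 lambda f : Prop :=
  [/\ measurable_fun (@toC R @^-1` @unit_disk R) (fun p => complex.Re (f (toC p))),
      measurable_fun (@toC R @^-1` @unit_disk R) (fun p => complex.Im (f (toC p)))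
    & (dmu_integral lambda (fun z => (normc (f z) ^+ 2)%R) < +oo)%E].

(* A function on the disk is represented by its extension by zero. *)
Definition bergman_pred lambda : {pred R[i] -> R[i]} :=
  mem [set f | [/\ analytic_on (@unit_disk R) f, in_L2 lambda f
                 & forall z, ~ unit_disk z -> f z = 0]].

Lemma analytic_onZD D (c : R[i]) f g :
  analytic_on D f -> analytic_on D g -> analytic_on D (c *: f + g).
Proof.
move=> hf hg z0 Dz0.
have [a [r [r0 ha]]] := hf z0 Dz0; have [b [s [s0 hb]]] := hg z0 Dz0.
exists (fun n => c * a n + b n), (Num.min r s); split.
  by rewrite lt_min r0.
move=> z hz.
have zr : `|z - z0| < r%:C%C.
  by rewrite (lt_le_trans hz)// lecR ge_min lexx.
have zs : `|z - z0| < s%:C%C.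
  by rewrite (lt_le_trans hz)// lecR ge_min lexx orbT.
have -> : series (fun n => (c * a n + b n) * (z - z0) ^+ n : C R) =
  (c : C R) *: series (fun n => a n * (z - z0) ^+ n : C R) +
  series (fun n => b n * (z - z0) ^+ n : C R).
  apply/funext => n; rewrite /series/= !fctE /= scaler_sumr -big_split/=.
  by apply: eq_bigr => i _; rewrite mulrDl -mulrA.
apply: cvgD; last exact: hb.
by apply: cvgZr; exact: ha.
Qed.

Lemma normcsqr (z : R[i]) : normc z ^+ 2 = complex.Re z ^+ 2 + complex.Im z ^+ 2.
Proof. by case: z => a b /=; rewrite sqr_sqrtr// addr_ge0// sqr_ge0. Qed.

Let D2 := @toC R @^-1` @unit_disk R.

Lemma D2E : D2 = [set p | (p.1 ^+ 2 + p.2 ^+ 2 < 1)].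
Proof.
apply/seteqP; split => -[x y] /=; rewrite /D2 /unit_disk /toC /= normc_def /=.
  rewrite (_ : 1 = 1%:C%C)// ltcR => h.
  by rewrite -[X in _ < X](expr1n _ 2) -[X in X < _]sqr_sqrtr ?ltrXn2r// addr_ge0// sqr_ge0.
move=> h; rewrite (_ : 1 = 1%:C%C)// ltcR -[X in _ < X]sqrtr1 ltr_sqrt//.
Qed.

Lemma measurable_sqsum (A : set (R * R)) :
  measurable_fun A (fun p : R * R => p.1 ^+ 2 + p.2 ^+ 2).
Proof.
apply: measurable_funD; apply: measurable_funX.
  exact: measurable_funTS measurable_fst.
exact: measurable_funTS measurable_snd.
Qed.

Lemma measurable_D2 : measurable D2.
Proof.
rewrite D2E -[X in measurable X]setTI.
have -> : [set p : R * R | p.1 ^+ 2 + p.2 ^+ 2 < 1] =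
   (fun p : R * R => p.1 ^+ 2 + p.2 ^+ 2) @^-1` `]-oo, 1[%classic.
  by apply/seteqP; split => p /=; rewrite in_itv.
by apply: measurable_sqsum => //; exact: measurable_itv.
Qed.

Lemma measurable_weight lambda (A : set (R * R)) :
  measurable_fun A (fun p => weight lambda (toC p)).
Proof.
apply: measurable_funM; first exact: measurable_cst.
apply: (measurableT_comp (measurable_powR _)).
apply: measurable_funB; first exact: measurable_cst.
rewrite (_ : (fun _ => _) = (fun p : R * R => p.1 ^+ 2 + p.2 ^+ 2)).
  exact: measurable_sqsum.
by apply/funext => p; rewrite normcsqr.
Qed.

Lemma weight_ge0 lambda z : 0 <= lambda + 1 -> 0 <= weight lambda z.
Proof. by move=> l1; rewrite mulr_ge0 ?powR_ge0// divr_ge0// pi_ge0. Qed.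

Lemma weight_le0 lambda z : lambda + 1 <= 0 -> weight lambda z <= 0.
Proof.
by move=> l1; rewrite mulr_le0_ge0 ?powR_ge0// mulr_le0_ge0// invr_ge0 pi_ge0.
Qed.

Lemma in_L2ZD lambda (c : R[i]) f g :
  in_L2 lambda f -> in_L2 lambda g -> in_L2 lambda (c *: f + g).
Proof.
move=> [fR fI f2] [gR gI g2].
have mn (h : R[i] -> R[i]) : measurable_fun D2 (fun p => complex.Re (h (toC p))) ->
    measurable_fun D2 (fun p => complex.Im (h (toC p))) ->
    measurable_fun D2 (fun p => (normc (h (toC p)) ^+ 2 * weight lambda (toC p))%:E).
  move=> hR hI; apply/measurable_EFinP; apply: measurable_funM; last exact: measurable_weight.
  under eq_fun do rewrite normcsqr.
  by apply: measurable_funD; exact: measurable_funX.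
have mR : measurable_fun D2 (fun p => complex.Re ((c *: f + g) (toC p))).
  have -> : (fun p => complex.Re ((c *: f + g) (toC p))) = (fun p =>
    complex.Re c * complex.Re (f (toC p)) - complex.Im c * complex.Im (f (toC p))
    + complex.Re (g (toC p))).
    apply/funext => p; rewrite !fctE.
    by case: (f (toC p)) (g (toC p)) => [? ?] [? ?]; case: (c) => [? ?].
  by apply: measurable_funD => //; apply: measurable_funB; apply: measurable_funM.
have mI : measurable_fun D2 (fun p => complex.Im ((c *: f + g) (toC p))).
  have -> : (fun p => complex.Im ((c *: f + g) (toC p))) = (fun p =>
    complex.Re c * complex.Im (f (toC p)) + complex.Im c * complex.Re (f (toC p))
    + complex.Im (g (toC p))).
    apply/funext => p; rewrite !fctE.
    by case: (f (toC p)) (g (toC p)) => [? ?] [? ?]; case: (c) => [? ?].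
  by apply: measurable_funD => //; apply: measurable_funD; apply: measurable_funM.
split => //.
have [l1|l1] := leP 0 (lambda + 1); last first.
  apply: (@le_lt_trans _ _ 0%E); last exact: ltry.
  have h0 p : 0 <= - (normc ((c *: f + g) (toC p)) ^+ 2 * weight lambda (toC p)).
    by rewrite oppr_ge0 mulr_ge0_le0 ?sqr_ge0// weight_le0// ltW.
  rewrite /dmu_integral; under eq_integral do rewrite -[X in X%:E]opprK EFinN.
  rewrite integral_ge0N ?oppe_le0; last by move=> p _; rewrite lee_fin.
  by apply: integral_ge0 => p _; rewrite lee_fin.
pose F (h : R[i] -> R[i]) (p : R * R) := (normc (h (toC p)) ^+ 2 * weight lambda (toC p))%:E.
have F0 h p : (0 <= F h p)%E by rewrite lee_fin mulr_ge0 ?sqr_ge0 ?weight_ge0.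
have mF h := mn h.
pose k := 2 * normc c ^+ 2.
have k0 : 0 <= k by rewrite mulr_ge0// sqr_ge0.
apply: (@le_lt_trans _ _
  (k%:E * dmu_integral lambda (fun z => (normc (f z) ^+ 2)%R) +
   2%:E * dmu_integral lambda (fun z => (normc (g z) ^+ 2)%R))%E); last first.
  by rewrite lte_add_pinfty// lte_mul_pinfty.
rewrite /dmu_integral -!ge0_integralZl//; [|exact: measurable_D2|exact: mF
  |by move=> p _; exact: F0|exact: measurable_D2|exact: mF|by move=> p _; exact: F0].
rewrite -ge0_integralD//=; [|exact: measurable_D2
  |by move=> p _; rewrite mule_ge0// ; exact: F0|by apply: measurable_funeM; exact: mF
  |by move=> p _; rewrite mule_ge0//; exact: F0|by apply: measurable_funeM; exact: mF].
apply: ge0_le_integral => //.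
- exact: measurable_D2.
- by move=> p _; exact: F0.
- exact: mF.
- by apply: emeasurable_funD; apply: measurable_funeM; exact: mF.
move=> p _; rewrite -!EFinM -EFinD lee_fin.
have w0 : 0 <= weight lambda (toC p) by exact: weight_ge0.
move: (weight _ _) w0 => w w0; rewrite (mulrA k (_ ^+ 2)) (mulrA 2 (_ ^+ 2)) -mulrDl ler_wpM2r//.
have -> : (c *: f + g) (toC p) = c * f (toC p) + g (toC p) by [].
rewrite /k !normcsqr; case: (c) (f (toC p)) (g (toC p)) => [a b] [u v] [x y] /=.
rewrite -subr_ge0 [X in 0 <= X](_ : _ =
  (a * u - b * v - x) ^+ 2 + (a * v + b * u - y) ^+ 2).
  by rewrite addr_ge0// sqr_ge0.
ring. 
Qed.

Lemma bergman_submod lambda : submod_closed (bergman_pred lambda).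
Proof.
split; last first.
  move=> c f g; rewrite !inE => -[fa f2 f0] [ga g2 g0]; split.
  - exact: analytic_onZD.
  - exact: in_L2ZD.
  - by move=> z Dz; rewrite !fctE f0// g0// scaler0 addr0.
rewrite inE; split => //.
- move=> z0 _; exists (fun=> 0), 1; split => // z _.
  have -> : series (fun n => 0 * (z - z0) ^+ n : C R) = fun=> (0 : C R).
    by apply/funext => n; rewrite /series/= big1// => i _; rewrite mul0r.
  exact: cvg_cst.
- split; try exact: measurable_cst.
  rewrite /dmu_integral integral0_eq ?ltry// => p _.
  by rewrite normc0 expr0n mul0r.
Qed.

End weighted_measure.

Record bergman (R : realType) (lambda : R) :=
  Bergman { bergman_fun :> R[i] -> R[i] ; _ : bergman_fun \in bergman_pred lambda }.

Section bergman_lmod.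
Context {R : realType} (lambda : R).

HB.instance Definition _ := [isSub for @bergman_fun R lambda].
HB.instance Definition _ := [Choice of bergman lambda by <:].
HB.instance Definition _ := GRing.SubChoice_isSubLmodule.Build _ _ _ (bergman lambda)
  (bergman_submod lambda).
End bergman_lmod.

Section radial_operators.
Context {R : realType} (lambda : R).
Local Notation H := (bergman lambda).
Implicit Types (f g : H) (T : H -> H) (phi psi : R -> R[i]).

Definition dot f g : R[i] :=
  Complex (fine (dmu_integral lambda (fun z => complex.Re (f z * conjc (g z)))))
          (fine (dmu_integral lambda (fun z => complex.Im (f z * conjc (g z))))).

Definition bnorm f : R := Num.sqrt (complex.Re (dot f f)).

Definition bounded_operator T : Prop :=
  linear T /\ exists M : R, forall f, bnorm (T f) <= M * bnorm f.

(* For [`|t| = 1] the rotated function lies in the space, so that the default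
   value 0 of [insubd] plays no role; likewise in [basis] for [-1 < lambda]. *)
Definition rotation (t : R[i]) f : H := insubd (0 : H) (fun z => f (t^-1 * z)).

Definition radial T : Prop :=
  forall t : R[i], `|t| = 1 -> T \o rotation t = rotation t \o T.

Definition Gamma (s : R) : R :=
  fine (\int[lebesgue_measure]_(t in `]0%R, +oo[) (t `^ (s - 1) * expR (- t))%:E)%E.

Definition basis (k : nat) : H :=
  insubd (0 : H) (fun z => if z \in @unit_disk R then
    (Num.sqrt (Gamma (k%:R + lambda + 2) / (k`!%:R * Gamma (lambda + 2))))%:C%C * z ^+ k
  else 0).

Definition eproj (k : nat) f : H := dot f (basis k) *: basis k.

Definition strongly_sums_to (A : nat -> H -> H) T : Prop :=
  forall f, bnorm (\sum_(k < n) A k f - T f) @[n --> \oo] --> (0 : R).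

(* The value at [f] is 0 when the series [\sum_k A k f] diverges. *)
Definition strong_sum (A : nat -> H -> H) : H -> H := fun f =>
  xget 0 [set g | bnorm (\sum_(k < n) A k f - g) @[n --> \oo] --> (0 : R)].

Definition number_op_domain : set H :=
  [set f | cvgn (series (fun k => normc (k%:R * dot f (basis k)) ^+ 2))].

(* The number operator N, meaningful on [number_op_domain]. *)
Definition number_op : H -> H := strong_sum (fun k f => k%:R *: eproj k f).

Definition spectral_measure (S : set R) : H -> H :=
  strong_sum (fun k f => if k%:R \in S then eproj k f else 0).

Definition resolution (eta : R) : H -> H := spectral_measure `]-oo, eta[.

Definition rho f (eta : R) : R := complex.Re (dot f (resolution eta f)).

(* The outer measure generated by a nondecreasing left-continuous [F] through
   [[a, b[ |-> F b - F a]; the intervals of [lebesgue_stieltjes_measure] are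
   closed on the other side, for right-continuous [F]. *)
Definition stieltjes_outer (F : R -> R) (A : set R) : \bar R :=
  ereal_inf [set x | exists a b : nat -> R,
    [/\ forall n, a n <= b n, A `<=` \bigcup_n [set` `[a n, b n[]
      & x = (\sum_(0 <= n <oo) (F (b n) - F (a n))%:E)%E]].

Definition E_measurable phi : Prop :=
  forall f (B : set R), measurable B ->
    caratheodory_measurable (stieltjes_outer (rho f)) [set x | B (complex.Re (phi x))] /\
    caratheodory_measurable (stieltjes_outer (rho f)) [set x | B (complex.Im (phi x))].

Definition E_negligible (S : set R) : Prop :=
  exists B : set R, [/\ measurable B, S `<=` B & forall f, spectral_measure B f = 0].

Definition E_equivalent phi psi : Prop := E_negligible [set x | phi x <> psi x].

Definition ell_infty phi : Prop := exists M : R, forall k : nat, normc (phi k%:R) <= M.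

Definition phi_of_N phi : H -> H := strong_sum (fun k f => phi k%:R *: eproj k f).

Lemma phi_of_N_id : phi_of_N (fun x => x%:C%C) = number_op.
Proof. by congr strong_sum; apply/funext => k; apply/funext => f; rewrite rmorph_nat. Qed.

Definition bounded_functions_of_N : set (H -> H) :=
  phi_of_N @` [set phi | E_measurable phi /\ ell_infty phi].

Definition bounded_radial_operators : set (H -> H) :=
  [set T | bounded_operator T /\ radial T].

(* A unital *-subalgebra of the bounded operators closed in the weak operator
   topology. *)
Definition von_neumann_algebra (A : set (H -> H)) : Prop :=
  [/\ A `<=` [set T | bounded_operator T],
      A id,
      (forall (c : R[i]) T U, A T -> A U -> A (c *: T + U) /\ A (T \o U)),
      (forall T, A T -> exists2 U, A U & forall f g, dot (T f) g = dot f (U g))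
    & forall T, bounded_operator T ->
        (forall (s : seq (H * H)) (e : R), 0 < e -> exists2 U, A U &
           forall p, p \in s -> normc (dot (T p.1 - U p.1) p.2) < e) ->
        A T].

End radial_operators.

Arguments phi_of_N {R} lambda phi _.
Arguments bounded_functions_of_N {R} lambda _.
Arguments bounded_radial_operators {R} lambda _.

(* Main.v *)
(* A function of the Bergman space has a power series [\sum_k b_k z^k] on the
   whole disk, and its squared norm is [\sum_k |b_k|^2 m_k], where [m_k] is the
   integral of [|z|^(2k)]. So [b_k * sqrt m_k] are coordinates identifying the
   space with l^2: the basis becomes the standard one, and the rotation by [t]
   multiplies the k-th coordinate by [t^-k]. As these factors separate the
   indices, a bounded operator commutes with all rotations if and only if it is
   diagonal with bounded entries, that is, of the form phi(N); every phi is
   E-measurable because [rho_f] is a sum of point masses at the natural numbers.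
   Being diagonal is a condition on the matrix entries [<T e_k, e_j>], hence
   weakly closed.

   Complex integration is avoided: on each circle, the mean of [|f|^2] over the
   [N]-th roots of unity replaces Cauchy's formula. It yields the Cauchy
   estimates, from which the power series at 0 is extended to the disk, and,
   with the rotation invariance of the Lebesgue measure of the plane, the norm
   formula. *)

Require Import Defs.
From mathcomp Require Import all_boot all_order all_algebra.
From mathcomp Require Import all_classical all_reals all_analysis.
From mathcomp Require Import measurable_realfun complex ring lra.
Set Implicit Arguments.
Unset Strict Implicit.
Unset Printing Implicit Defensive.
Import Order.TTheory GRing.Theory Num.Theory.
Import numFieldNormedType.Exports.
Import ComplexField.Normc.
Local Open Scope classical_set_scope.
Local Open Scope ring_scope.

(** * Power series over the complex numbers *)

(** A mean over the [N]-th roots of unity kills the cross terms of indices [k] and [l] unless [k]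
    and [l] agree modulo [N], so it is exact only for polynomials of degree below [N]. Every use
    therefore truncates a series at [N] and pays with a tail that absolute convergence on the circle
    makes small. Analyticity is given locally, and the local radii might a priori shrink towards the
    circle of convergence of the series at 0. Compactness yields one radius and one coefficient
    bound for all centres [w]. The recentred coefficients are power series in [w], and the Cauchy
    estimates applied to them give absolute convergence beyond that circle. The norm formula is a
    pair of inequalities, both from Fatou's lemma: the upper one along the partial sums, the lower
    one along the means capped by the sum to be reached. Polar coordinates are replaced by the image
    of the plane measure under [|z|^2], which the areas of disks determine. Polarisation carries the
    formula to the inner product; the construction of a function from square-summable coordinates
    plays the part of completeness. *)

Section complex_modulus.
Context {R : realType}.
Implicit Types (x y z : R[i]) (u v : nat -> R[i]).

Lemma norm_normc x : `|x| = (normc x)%:C%C.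
Proof. by []. Qed.

Lemma normc_ge0 x : 0 <= normc x.
Proof. by case: x => a b; exact: sqrtr_ge0. Qed.

Lemma normcD x y : normc (x + y) <= normc x + normc y.
Proof. exact: le_normcD. Qed.

Lemma normcX x n : normc (x ^+ n) = normc x ^+ n.
Proof. by elim: n => [|n IH]; rewrite ?normc1// !exprS normcM IH. Qed.

Lemma normcB x y : normc (x - y) = normc (y - x).
Proof. by rewrite -opprB normcN. Qed.

Lemma normc_real (r : R) : normc r%:C%C = `|r|.
Proof. by rewrite /= expr0n addr0 sqrtr_sqr. Qed.

Lemma normc_nat n : normc (n%:R : R[i]) = n%:R.
Proof. by rewrite -(rmorph_nat (real_complex R)) normc_real ger0_norm. Qed.

Lemma normc_sum (I : Type) (r : seq I) (P : pred I) (F : I -> R[i]) :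
  normc (\sum_(i <- r | P i) F i) <= \sum_(i <- r | P i) normc (F i).
Proof.
elim/big_ind2 : _ => [|a a' b b' ha hb|//]; first by rewrite normc0.
by rewrite (le_trans (normcD _ _))// lerD.
Qed.

Lemma Re_le_normc x : `|complex.Re x| <= normc x.
Proof.
case: x => a b /=; rewrite -(sqrtr_sqr a) ler_wsqrtr// lerDl.
exact: sqr_ge0.
Qed.

Lemma Im_le_normc x : `|complex.Im x| <= normc x.
Proof.
case: x => a b /=; rewrite -(sqrtr_sqr b) ler_wsqrtr// lerDr.
exact: sqr_ge0.
Qed.

Lemma normc_le_ReIm x : normc x <= `|complex.Re x| + `|complex.Im x|.
Proof.
case: x => a b /=; rewrite -(@ler_pXn2r _ 2) ?nnegrE ?sqrtr_ge0 ?addr_ge0//.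
rewrite sqr_sqrtr ?addr_ge0 ?sqr_ge0// sqrrD !real_normK ?num_real//.
by rewrite -addrA lerD2l lerDr mulrn_wge0// mulr_ge0.
Qed.

Lemma normc_gt0 x : (0 < normc x) = (x != 0).
Proof.
rewrite lt_def normc_ge0 andbT; apply/idP/idP; apply: contraNN => /eqP.
  by move->; rewrite normc0.
by move/eq0_normc/eqP.
Qed.

Lemma cvgC_normc u l : (u n : C R) @[n --> \oo] --> (l : C R) <->
  normc (u n - l) @[n --> \oo] --> (0 : R).
Proof.
split => [/cvgrPdist_lt h|/cvgrPdist_lt h]; apply/cvgrPdist_lt => e e0.
  have /h : 0 < e%:C%C :> C R by rewrite ltcR.
  apply: filterS => n; rewrite norm_normc ltcR => hn.
  by rewrite sub0r normrN ger0_norm ?normc_ge0// normcB.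
(* In the order of [R[i]] a positive element is real, so a complex radius is a real one. *)
have /complex_realP[r rE] := gtr0_real e0.
move: e0; rewrite rE ltcR => /h; apply: filterS => n hn.
rewrite norm_normc ltcR normcB.
by move: hn; rewrite sub0r normrN ger0_norm ?normc_ge0.
Qed.

End complex_modulus.

Section complex_series.
Context {R : realType}.
Implicit Types (x y z h l : R[i]) (u v a : nat -> R[i]).

Lemma ler_dist_normc x y : `|normc x - normc y| <= normc (x - y).
Proof.
rewrite ler_norml; apply/andP; split.
  rewrite lerNl opprB lerBlDr normcB.
  by rewrite -{1}(subrK x y) normcD.
rewrite lerBlDr.
by rewrite -{1}(subrK y x) normcD.
Qed.

Lemma cvg_normc u l : (u n : C R) @[n --> \oo] --> (l : C R) ->
  normc (u n) @[n --> \oo] --> normc l.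
Proof.
move=> /cvgC_normc h; apply/cvgrPdist_le => e e0.
move/cvgrPdist_le : h => /(_ e e0); apply: filterS => n.
rewrite sub0r normrN ger0_norm ?normc_ge0//; apply: le_trans.
by rewrite distrC; exact: ler_dist_normc.
Qed.

Lemma normc_lim_le u l (B : R) : (u n : C R) @[n --> \oo] --> (l : C R) ->
  (\forall n \near \oo, normc (u n) <= B) -> normc l <= B.
Proof.
move=> /cvg_normc ul uB; rewrite -(cvg_lim _ ul)//.
by apply: limr_le => //; apply/cvg_ex; exists (normc l).
Qed.

Lemma Re_sum (I : Type) (r : seq I) (P : pred I) (F : I -> R[i]) :
  complex.Re (\sum_(i <- r | P i) F i) = \sum_(i <- r | P i) complex.Re (F i).
Proof. by elim/big_rec2 : _ => // i a [b c] _ <-; case: (F i). Qed.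

Lemma Im_sum (I : Type) (r : seq I) (P : pred I) (F : I -> R[i]) :
  complex.Im (\sum_(i <- r | P i) F i) = \sum_(i <- r | P i) complex.Im (F i).
Proof. by elim/big_rec2 : _ => // i a [b c] _ <-; case: (F i). Qed.

Lemma cvgC_ReIm u l : complex.Re (u n) @[n --> \oo] --> complex.Re l ->
  complex.Im (u n) @[n --> \oo] --> complex.Im l -> (u n : C R) @[n --> \oo] --> (l : C R).
Proof.
move=> hR hI; apply/cvgC_normc.
have dist0 (x : nat -> R) (y : R) : x n @[n --> \oo] --> y -> `|x n - y| @[n --> \oo] --> (0 : R).
  move=> xy; rewrite -(normr0 R^o) -(subrr y); apply: cvg_norm.
  by apply: cvgB; [exact: xy|exact: cvg_cst].
apply: (@squeeze_cvgr _ _ _ _ (fun=> 0) (fun n => `|complex.Re (u n) - complex.Re l| +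
  `|complex.Im (u n) - complex.Im l|)).
- near=> n; rewrite normc_ge0/=; apply: le_trans (normc_le_ReIm _) _.
  by case: (u n) (l) => [? ?] [? ?].
- exact: cvg_cst.
- by rewrite -[X in _ --> X]addr0; apply: cvgD; exact: dist0.
Unshelve. all: by end_near. Qed.

(** The real and imaginary parts are dominated by the modulus, so completeness of [R] gives the two
    limits separately. *)
Lemma normc_series_cvg u : cvgn (series (fun n => normc (u n))) ->
  exists l : R[i], series (u : nat -> C R) n @[n --> \oo] --> (l : C R).
Proof.
move=> cu.
have cF (F : R[i] -> R) : (forall x, `|F x| <= normc x) ->
    cvgn (series (fun n => F (u n))).
  move=> hF; apply: (@normed_cvg R R^o).
  by apply: series_le_cvg cu => n /=; rewrite ?normc_ge0 ?hF.
have /cvg_ex[p hp] := cF _ Re_le_normc.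
have /cvg_ex[q hq] := cF _ Im_le_normc.
exists (Complex p q); apply: (@cvgC_ReIm (fun n => \sum_(0 <= k < n) u k)).
- by under eq_fun do rewrite Re_sum; exact: hp.
- by under eq_fun do rewrite Im_sum; exact: hq.
Qed.

Lemma series_tail_le u l (S : R) (N : nat) :
  series (u : nat -> C R) n @[n --> \oo] --> (l : C R) ->
  (forall M, (N <= M)%N -> \sum_(N <= m < M) normc (u m) <= S) ->
  normc (l - series u N) <= S.
Proof.
move=> ul uS.
have {}ul : series (u : nat -> C R) n - series (u : nat -> C R) N @[n --> \oo] -->
    (l : C R) - series (u : nat -> C R) N by apply: (cvgB ul); exact: cvg_cst.
apply: normc_lim_le ul _; near=> M.
have NM : (N <= M)%N by near: M; exact: nbhs_infty_ge.
rewrite sub_series_geq//.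
by apply: le_trans (uS _ NM); exact: (@normc_sum R _ _ _ u).
Unshelve. all: by end_near. Qed.

Lemma le_lim_series (w : nat -> R) N : (forall n, 0 <= w n) -> cvgn (series w) ->
  series w N <= limn (series w).
Proof.
move=> w0 cw; apply: nondecreasing_cvgn_le => //.
by apply/nondecreasing_seqP => n; rewrite seriesSr lerDl.
Qed.

Lemma series_normc_le u l : series (u : nat -> C R) n @[n --> \oo] --> (l : C R) ->
  cvgn (series (fun n => normc (u n))) ->
  normc l <= limn (series (fun n => normc (u n))).
Proof.
move=> ul cu.
have := @series_tail_le u l (limn (series (fun n => normc (u n)))) 0 ul.
have -> : series (u : nat -> C R) 0 = 0 by rewrite /series/= big_geq.
rewrite subr0; apply => M _.
by apply: (@le_lim_series (fun n => normc (u n))) => // n; exact: normc_ge0.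
Qed.

Lemma series_term_bounded u l : series (u : nat -> C R) n @[n --> \oo] --> (l : C R) ->
  exists B : R, forall n, normc (u n) <= B.
Proof.
move=> ul.
have u0 : (u n : C R) @[n --> \oo] --> (0 : C R).
  have -> : u = fun n => series u n.+1 - series u n.
    by apply/funext => n; rewrite seriesSB.
  rewrite -(subrr (l : C R)); apply: cvgB => //.
  by rewrite (@cvg_shiftS _ (series u : nat -> C R)).
have /cvg_normc/cvgP/(@cvg_seq_bounded R R^o) := u0.
move=> [M [Mr hM]]; exists (M + 1) => n.
apply: le_trans (hM (M + 1) _ n I); last by rewrite ltrDl.
by rewrite ler_norm.
Qed.

(** Abel's lemma: bounded terms at radius [s] leave a geometric series of ratio [r / s] as a
    majorant at radius [r]. *)
Lemma geometric_bound_cvg (w : nat -> R) (B r s : R) : 0 <= r < s ->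
  (forall n, 0 <= w n) -> (forall n, w n * s ^+ n <= B) ->
  cvgn (series (fun n => w n * r ^+ n)).
Proof.
move=> /andP[r0 rs] w0 wB; have s0 : 0 < s by exact: le_lt_trans rs.
have B0 : 0 <= B by rewrite (le_trans _ (wB 0%N))// expr0 mulr1.
apply: (@series_le_cvg _ _ (geometric B (r / s))).
- by move=> n; rewrite mulr_ge0// exprn_ge0.
- by move=> n; rewrite mulr_ge0 ?exprn_ge0 ?divr_ge0 ?(ltW s0).
- move=> n /=; rewrite expr_div_n mulrA ler_pdivlMr ?exprn_gt0// mulrAC.
  by rewrite ler_wpM2r// exprn_ge0.
- apply: is_cvg_geometric_series; rewrite ger0_norm ?divr_ge0 ?(ltW s0)//.
  by rewrite ltr_pdivrMr// mul1r.
Qed.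

End complex_series.

(** A relation, so that convergence and the value of the sum are asserted together. *)
Definition psum {R : realType} (a : nat -> R[i]) (h l : R[i]) : Prop :=
  series (fun n => a n * h ^+ n : C R) n @[n --> \oo] --> (l : C R).

Definition asum {R : realType} (a : nat -> R[i]) (s : R) : Prop :=
  cvgn (series (fun n => normc (a n) * s ^+ n)).

(** * Recentring a power series *)

Section recentering.
Context {R : realType}.
Implicit Types (k h l : R[i]) (a : nat -> R[i]).

Lemma bin_term_le (x y s : R) m n : 0 <= x -> 0 <= y -> x + y <= s ->
  'C(m, n)%:R * x ^+ (m - n) * y ^+ n <= s ^+ m.
Proof.
move=> x0 y0 xys; have [nm|mn] := leqP n m; last first.
  by rewrite bin_small// !mul0r exprn_ge0// (le_trans _ xys)// addr_ge0.
apply: (@le_trans _ _ ((x + y) ^+ m)); last by rewrite lerXn2r ?nnegrE ?addr_ge0// (le_trans _ xys)// addr_ge0.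
rewrite exprDn (bigD1 (Ordinal (nm : (n < m.+1)%N)))//=.
rewrite -[X in _ <= X + _]mulr_natl mulrA lerDl.
by apply: sumr_ge0 => i _; rewrite mulrn_wge0// mulr_ge0// exprn_ge0.
Qed.

(** The Taylor polynomial of order [N] in [h] is exact on a monomial of degree [m < N]; otherwise
    the remainder consists of terms of the binomial expansion of [(normc k + d) ^+ m], up to
    modulus. *)
Lemma exprDn_remainder_le k h (s d : R) m N : normc h <= d -> normc k + d <= s ->
  normc ((k + h) ^+ m - \sum_(0 <= n < N) 'C(m, n)%:R * k ^+ (m - n) * h ^+ n) <=
  if (m < N)%N then 0 else s ^+ m.
Proof.
move=> hd ks; have d0 : 0 <= d by rewrite (le_trans _ hd)// normc_ge0.
have kd0 : 0 <= normc k + d by rewrite addr_ge0 ?normc_ge0.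
have -> : (k + h) ^+ m = \sum_(0 <= n < m.+1) 'C(m, n)%:R * k ^+ (m - n) * h ^+ n.
  by rewrite exprDn big_mkord; apply: eq_bigr => i _; rewrite -mulr_natl mulrA.
case: ifPn => [mN|]; last rewrite -leqNgt => Nm.
  rewrite [X in _ - X](big_cat_nat (n := m.+1))//= [\sum_(m.+1 <= i < N) _]big_nat_cond [\sum_(m.+1 <= i < N | _) _]big1 ?addr0 ?subrr ?normc0//.
  by move=> i /andP[/andP[mi _] _]; rewrite bin_small// !mul0r.
rewrite (big_cat_nat (n := N))//=; last exact: leqW.
rewrite addrAC subrr add0r (le_trans (normc_sum _ _ _))//.
apply: (@le_trans _ _ ((normc k + d) ^+ m)); last by rewrite lerXn2r ?nnegrE// (le_trans kd0).
rewrite exprDn -(big_mkord xpredT (fun i => normc k ^+ (m - i) * d ^+ i *+ 'C(m, i))).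
rewrite [X in _ <= X](big_cat_nat (n := N))//=; last exact: leqW.
apply: (@le_trans _ _ (\sum_(N <= i < m.+1) normc k ^+ (m - i) * d ^+ i *+ 'C(m, i))).
  apply: ler_sum => i _; rewrite !normcM !normcX normc_nat -mulrA mulr_natl lerMn2r.
  apply/orP; right; rewrite ler_wpM2l ?exprn_ge0 ?normc_ge0//.
  by rewrite lerXn2r ?nnegrE ?normc_ge0.
rewrite lerDr; apply: sumr_ge0 => i _.
by rewrite mulrn_wge0// mulr_ge0 ?exprn_ge0 ?normc_ge0.
Qed.

(** Each binomial term satisfies ['C(m, n) * |k|^(m-n) * d^n <= s^m], which makes the new
    coefficients converge and bounds them. A double series is never rearranged: only finite sums are
    interchanged, and the remainder after [N] new terms is compared with a tail of the absolute
    series at [s]. *)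
Lemma recenter a k (d s : R) : 0 < d -> normc k + d <= s -> asum a s ->
  exists a' : nat -> R[i],
  [/\ forall n, series (fun m => 'C(m, n)%:R * k ^+ (m - n) * a m : C R) m
        @[m --> \oo] --> (a' n : C R),
      forall n, normc (a' n) * d ^+ n <= limn (series (fun n => normc (a n) * s ^+ n))
    & forall h l, normc h <= d -> psum a (k + h) l -> psum a' h l].
Proof.
move=> d0 ks aS; set S := limn _.
have s0 : 0 <= s by rewrite (le_trans _ ks)// addr_ge0 ?normc_ge0// ltW.
have w0 n : 0 <= normc (a n) * s ^+ n by rewrite mulr_ge0 ?exprn_ge0 ?normc_ge0.
pose u n m := 'C(m, n)%:R * k ^+ (m - n) * a m.
have uE n m : normc (u n m) <= d ^- n * (normc (a m) * s ^+ m).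
  rewrite ler_pdivlMl ?exprn_gt0// !normcM normcX normc_nat mulrC mulrAC mulrC.
  by rewrite ler_wpM2l ?normc_ge0// bin_term_le ?normc_ge0// ltW.
have cu n : cvgn (series (fun m => normc (u n m))).
  apply: (@series_le_cvg _ _ (fun m => d ^- n * (normc (a m) * s ^+ m))) => //.
  - by move=> m; exact: normc_ge0.
  - by move=> m; rewrite mulr_ge0// invr_ge0 exprn_ge0// ltW.
  - exact: (@is_cvg_seriesZ R (fun m => normc (a m) * s ^+ m) (d ^- n) aS).
have /all_sig[a' ha'] := fun n => cid (normc_series_cvg (cu n)).
exists a'; split => //.
  move=> n; rewrite -ler_pdivlMr ?exprn_gt0// mulrC.
  apply: le_trans (series_normc_le (ha' n) (cu n)) _.
  have -> : d ^- n * S = limn (series (fun m => d ^- n * (normc (a m) * s ^+ m))).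
    by rewrite (@lim_seriesZ R (fun m => normc (a m) * s ^+ m) (d ^- n) aS).
  apply: ler_lim => //; first exact: (@is_cvg_seriesZ R (fun m => normc (a m) * s ^+ m) (d ^- n) aS).
  by near=> M; apply: ler_sum.
move=> h l hd al.
(* The first [N] new terms reproduce all monomials of degree below [N]; a monomial of degree
   [m >= N] costs at most [normc (a m) * s ^+ m]. The estimate is proved for the sums over [m < M],
   then [M] tends to infinity. *)
have key N : normc (l - \sum_(0 <= n < N) a' n * h ^+ n) <=
    S - series (fun n => normc (a n) * s ^+ n) N.
  have cE : (\sum_(0 <= m < M) a m * (k + h) ^+ m -
       \sum_(0 <= n < N) (\sum_(0 <= m < M) u n m) * h ^+ n : C R) @[M --> \oo] -->
     (l - \sum_(0 <= n < N) a' n * h ^+ n : C R).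
    apply: (cvgB al); apply: cvg_big => [|i _]; first exact: add_continuous.
    by apply: cvgMl; exact: ha'.
  apply: normc_lim_le cE _; near=> M.
  have NM : (N <= M)%N by near: M; exact: nbhs_infty_ge.
  have -> : \sum_(0 <= m < M) a m * (k + h) ^+ m -
       \sum_(0 <= n < N) (\sum_(0 <= m < M) u n m) * h ^+ n =
      \sum_(0 <= m < M) a m * ((k + h) ^+ m -
        \sum_(0 <= n < N) 'C(m, n)%:R * k ^+ (m - n) * h ^+ n).
    have -> : \sum_(0 <= n < N) (\sum_(0 <= m < M) u n m) * h ^+ n =
        \sum_(0 <= m < M) \sum_(0 <= n < N) u n m * h ^+ n.
      by rewrite [RHS]exchange_big/=; apply: eq_bigr => n _; rewrite mulr_suml.
    rewrite -sumrB; apply: eq_bigr => m _.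
    rewrite mulrBr mulr_sumr; congr (_ - _); apply: eq_bigr => n _.
    by rewrite /u; ring.
  apply: le_trans (normc_sum _ _ _) _.
  apply: (@le_trans _ _ (\sum_(0 <= m < M) normc (a m) * (if (m < N)%N then 0 else s ^+ m))).
    by apply: ler_sum => m _; rewrite normcM ler_wpM2l ?normc_ge0// (exprDn_remainder_le _ _ hd).
  rewrite (big_cat_nat (n := N))//= [X in X + _]big_nat_cond big1 ?add0r; last first.
    by move=> i /andP[/andP[_ ->] _]; rewrite mulr0.
  rewrite lerBrDl; apply: le_trans (le_lim_series M w0 aS).
  rewrite /series/= [X in _ <= X](big_cat_nat (n := N))//= lerD2l.
  rewrite big_nat_cond [X in _ <= X]big_nat_cond; apply: ler_sum => m /andP[/andP[Nm _] _].
  by rewrite ltnNge Nm.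
apply/cvgC_normc.
apply: (@squeeze_cvgr _ _ _ _ (fun=> 0)
   (fun N => S - series (fun n => normc (a n) * s ^+ n) N)).
- near=> N; rewrite normc_ge0/= normcB; exact: key.
- exact: cvg_cst.
- rewrite -(subrr S); apply: cvgB; first exact: cvg_cst.
  exact: aS.
Unshelve. all: by end_near. Qed.

End recentering.

(** * Parseval's identity on roots of unity *)

Section parseval.
Context {R : realType}.
Implicit Types (h l w z : R[i]) (a b c : nat -> R[i]).

Lemma sqr_normc z : (normc z ^+ 2)%:C%C = z * conjc z.
Proof.
rewrite normcsqr; case: z => x y; apply/eqP; rewrite eq_complex /=.
by apply/andP; split; apply/eqP; ring.
Qed.

Lemma normc_conjc z : normc (conjc z) = normc z.
Proof. by case: z => x y /=; rewrite sqrrN. Qed.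

(** Take a [2 ^ p]-th root of -1. Its order divides [2 ^ p.+1], hence is a power of 2; a smaller one
    would divide [2 ^ p] and make -1 equal to 1. Orders of this form are enough, since only
    arbitrarily large orders are used. *)
Lemma primitive_root_pow2 p : exists w : R[i],
  normc w = 1 /\ (2 ^ p.+1).-primitive_root w.
Proof.
pose w : R[i] := (2 ^ p).-root (- 1).
have wp : w ^+ (2 ^ p) = - 1 by rewrite rootCK// expn_gt0.
have wN : w ^+ (2 ^ p.+1) = 1 by rewrite expnS mulnC exprM wp sqrrN expr1n.
exists w; split.
  apply/eqP; rewrite -(@pexpr_eq1 _ _ (2 ^ p.+1)) ?expn_gt0 ?normc_ge0//.
  by rewrite -normcX wN normc1.
have [m mw mdvd] := prim_order_exists (expn_gt0 2 p.+1) wN.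
have /(dvdn_pfactor _ _ (isT : prime 2))[j jp mE] := mdvd.
move: jp; rewrite leq_eqVlt ltnS => /orP[/eqP <-|jp]; first by rewrite -mE.
have : w ^+ (2 ^ p) = 1.
  by apply/eqP; rewrite -(prim_order_dvd mw) mE dvdn_exp2l.
rewrite wp => /eqP; rewrite eq_sym -subr_eq0 opprK.
by rewrite -(natrD _ 1 1) pnatr_eq0.
Qed.

Lemma discrete_parseval N w c : normc w = 1 -> N.-primitive_root w ->
  \sum_(i < N) normc (\sum_(k < N) c k * (w ^+ i) ^+ k) ^+ 2 =
  N%:R * \sum_(k < N) normc (c k) ^+ 2.
Proof.
move=> w1 wN.
have w0 : w != 0 by rewrite -normc_gt0 w1.
have wJ : conjc w = w^-1.
  apply: (mulfI w0); rewrite -sqr_normc w1 expr1n mulfV//.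
have rI : injective (real_complex R) by move=> x y [].
apply: rI; rewrite rmorphM rmorph_nat !rmorph_sum/=.
under eq_bigr => i _.
  rewrite sqr_normc rmorph_sum mulr_suml.
  under eq_bigr do rewrite mulr_sumr.
  over.
rewrite exchange_big/= mulr_sumr; apply: eq_bigr => k _.
rewrite exchange_big/= (bigD1 k)//= [X in _ + X]big1 ?addr0.
  under eq_bigr => i _.
    rewrite rmorphM/= mulrACA -sqr_normc -sqr_normc !normcX w1 !expr1n mulr1.
    over.
  by rewrite sumr_const card_ord mulr_natl.
move=> l lk.
(* The cross term of [k] and [l] is a multiple of the sum of the powers of [x], an [N]-th root of
   unity different from 1 because [k] and [l] are distinct and below [N]; its geometric sum
   vanishes. *)
pose x := w ^+ k * (w ^+ l)^-1.
have x1 : x - 1 != 0.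
  rewrite subr_eq0 -(inj_eq (mulIf (expf_neq0 l w0))) mul1r mulfVK ?expf_neq0//.
  by rewrite (eq_prim_root_expr wN) !modn_small// eq_sym.
under eq_bigr => i _.
  rewrite rmorphM/= mulrACA !rmorphXn/= wJ.
  have -> : (w ^+ i) ^+ k * (w^-1 ^+ i) ^+ l = x ^+ i.
    by rewrite /x exprMn -[in RHS]exprVn (exprAC w) (exprAC w^-1).
  over.
rewrite -mulr_sumr; apply/eqP; rewrite mulf_eq0; apply/orP; right.
rewrite -(inj_eq (mulfI x1)) mulr0 -subrX1 subr_eq0 /x exprMn exprVn -!exprM.
by rewrite ![(_ * N)%N]mulnC !exprM (prim_expr_order wN) !expr1n invr1 mulr1.
Qed.

End parseval.

(** * Cauchy estimates and uniqueness of coefficients *)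

Section power_series.
Context {R : realType}.
Implicit Types (h l w z : R[i]) (a b c : nat -> R[i]).

Lemma psum_asum a h l (s : R) : psum a h l -> 0 <= s < normc h -> asum a s.
Proof.
move=> al sh; have [B aB] := series_term_bounded al.
apply: (geometric_bound_cvg sh (B := B)) => n; first exact: normc_ge0.
by rewrite -normcX -normcM.
Qed.

Lemma asum_le a (s t : R) : 0 <= s <= t -> asum a t -> asum a s.
Proof.
move=> /andP[s0 st] at_; have t0 := le_trans s0 st.
apply: series_le_cvg at_ => n; rewrite ?mulr_ge0 ?exprn_ge0 ?normc_ge0//.
by rewrite ler_wpM2l ?normc_ge0// lerXn2r.
Qed.

Lemma asum_psum a h (s : R) : normc h <= s -> asum a s -> exists l, psum a h l.
Proof.
move=> hs /(asum_le (s := normc h)) a_s; apply: normc_series_cvg.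
have -> : (fun n => normc (a n * h ^+ n)) = (fun n => normc (a n) * normc h ^+ n).
  by apply/funext => n; rewrite normcM normcX.
by apply: a_s; rewrite normc_ge0.
Qed.

Lemma psum_unique a h l l' : psum a h l -> psum a h l' -> l = l'.
Proof. by move=> al al'; rewrite -(cvg_lim _ al)// -(cvg_lim _ al'). Qed.

Lemma psum_tail a h l (s : R) N : normc h <= s -> asum a s -> psum a h l ->
  normc (l - \sum_(0 <= n < N) a n * h ^+ n) <=
  limn (series (fun n => normc (a n) * s ^+ n)) -
  series (fun n => normc (a n) * s ^+ n) N.
Proof.
move=> hs aS al; have s0 := le_trans (normc_ge0 h) hs.
apply: (@series_tail_le _ _ _ _ N al) => M NM.
rewrite lerBrDl; apply: le_trans (le_lim_series M _ aS); last first.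
  by move=> n; rewrite mulr_ge0 ?exprn_ge0 ?normc_ge0.
rewrite /series/= [X in _ <= X](big_cat_nat (n := N))//= lerD2l.
apply: ler_sum => n _; rewrite normcM normcX ler_wpM2l ?normc_ge0//.
by rewrite lerXn2r ?nnegrE ?normc_ge0.
Qed.

Lemma asum_tail_cvg a (s : R) : asum a s ->
  limn (series (fun n => normc (a n) * s ^+ n)) -
  series (fun n => normc (a n) * s ^+ n) N @[N --> \oo] --> (0 : R).
Proof.
move=> aS; rewrite -(subrr (limn (series (fun n => normc (a n) * s ^+ n)))).
by apply: cvgB; [exact: cvg_cst|exact: aS].
Qed.

(** The polynomial truncated at [N] is at most [M + e] at the points [s * w ^ i], and by
    [discrete_parseval] the mean of its squared moduli there dominates the square of each single
    [normc (a n) * s ^+ n]. *)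
Lemma cauchy_estimate a (s M : R) : 0 <= s -> asum a s ->
  (forall h l, normc h = s -> psum a h l -> normc l <= M) ->
  forall n, normc (a n) * s ^+ n <= M.
Proof.
move=> s0 aS aM n; apply/ler_addgt0Pr => e e0.
have /cvgrPdist_le/(_ _ e0)[N0 _ hN0] := asum_tail_cvg aS.
(* [N >= N0] makes the tail at most [e], and [n < N] keeps the coefficient [a n] in the
   truncation. *)
pose p := maxn N0 n; pose N := (2 ^ p.+1)%N.
have pN : (p < N)%N by rewrite (leq_trans (ltnSn p))// ltnW// ltn_expl.
have [w [w1 wN]] := @primitive_root_pow2 R p.
have N_gt0 : (0 < N)%N by rewrite expn_gt0.
have nN : (n < N)%N by rewrite (leq_ltn_trans _ pN)// leq_maxr.
have tail i : normc (\sum_(k < N) (a k * s%:C%C ^+ k) * (w ^+ i) ^+ k) <= M + e.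
  have hi : normc (s%:C%C * w ^+ i) = s.
    by rewrite normcM normcX w1 expr1n mulr1 normc_real ger0_norm.
  have [|l al] := @asum_psum a (s%:C%C * w ^+ i) s _ aS; first by rewrite hi.
  have -> : \sum_(k < N) (a k * s%:C%C ^+ k) * (w ^+ i) ^+ k =
      l - (l - \sum_(0 <= k < N) a k * (s%:C%C * w ^+ i) ^+ k).
    rewrite opprB addrC subrK big_mkord; apply: eq_bigr => k _.
    by rewrite exprMn mulrA.
  apply: le_trans (normcD _ _) _; rewrite normcN lerD//; first exact: aM al.
  apply: le_trans (psum_tail _ _ aS al) _; first by rewrite hi.
  have : (N0 <= N)%N by rewrite (leq_trans _ (ltnW pN))// leq_maxl.
  move=> /hN0/=; rewrite sub0r normrN; apply: le_trans; exact: ler_norm.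
have Me0 : 0 <= M + e by apply: le_trans (tail 0%N); exact: normc_ge0.
rewrite -(@ler_pXn2r _ 2)// ?nnegrE ?mulr_ge0 ?exprn_ge0 ?normc_ge0//.
rewrite -(@ler_pM2l _ N%:R) ?ltr0n//.
apply: (@le_trans _ _ (N%:R * \sum_(k < N) normc (a k * s%:C%C ^+ k) ^+ 2)).
  rewrite ler_wpM2l// (bigD1 (Ordinal nN))//= normcM normcX normc_real ger0_norm//.
  by rewrite lerDl sumr_ge0// => k _; rewrite sqr_ge0.
rewrite -(discrete_parseval (fun k => a k * s%:C%C ^+ k) w1 wN).
apply: (@le_trans _ _ (\sum_(i < N) (M + e) ^+ 2)).
  by apply: ler_sum => i _; rewrite lerXn2r ?nnegrE ?normc_ge0//.
by rewrite sumr_const card_ord mulr_natl.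
Qed.

(** The difference series sums to 0 near the origin, so the Cauchy estimate applies with bound 0.
    Convergence at [r / 2] provides the absolute convergence at the smaller radius [r / 4]. *)
Lemma psum_inj a b (f : R[i] -> R[i]) (r : R) : 0 < r ->
  (forall h, normc h < r -> psum a h (f h)) ->
  (forall h, normc h < r -> psum b h (f h)) -> a = b.
Proof.
move=> r0 af bf.
have cf h : normc h < r -> psum (fun n => a n - b n) h 0.
  move=> hr; rewrite -(subrr (f h)).
  rewrite /psum; have -> : (fun n => (a n - b n) * h ^+ n : C R) =
     (fun n => a n * h ^+ n : C R) - (fun n => b n * h ^+ n : C R).
    by apply/funext => n; rewrite mulrBl.
  have -> : series ((fun n => a n * h ^+ n : C R) - (fun n => b n * h ^+ n : C R)) =
     fun N => series (fun n => a n * h ^+ n : C R) N - series (fun n => b n * h ^+ n : C R) N.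
    by apply/funext => N; rewrite /series/= -sumrB.
  by apply: cvgB; [exact: af|exact: bf].
have h2 : normc (r / 2)%:C%C < r.
  by rewrite normc_real ger0_norm ?divr_ge0 ?ltW// ltr_pdivrMr// ltr_pMr// ltr1n.
have r4 : 0 <= r / 4 < normc (r / 2)%:C%C.
  by rewrite normc_real ger0_norm ?divr_ge0 ?ltW//; lra.
have cs := psum_asum (cf _ h2) r4.
apply/funext => n; apply/eqP; rewrite -subr_eq0; apply/eqP/eq0_normc.
have r40 : 0 <= r / 4 by case/andP: r4.
have : normc (a n - b n) * (r / 4) ^+ n <= 0.
  apply: (cauchy_estimate r40 cs) => h l hr hl.
  have h0 : psum (fun n => a n - b n) h 0 by apply: cf; rewrite hr; lra.
  by rewrite (psum_unique hl h0) normc0.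
rewrite pmulr_lle0 ?exprn_gt0//; last by lra.
by move=> h; apply/eqP; rewrite eq_le h normc_ge0.
Qed.

End power_series.

(** * Analytic functions on the disk *)

Section analytic_disk.
Context {R : realType}.
Implicit Types (h l w z k : R[i]) (a b c : nat -> R[i]) (f : R[i] -> R[i]).

Lemma unit_diskE z : unit_disk z = (normc z < 1) :> Prop.
Proof. by rewrite /unit_disk/= norm_normc (_ : 1 = 1%:C%C)// ltcR. Qed.

Lemma analytic_psum b f : (forall z, normc z < 1 -> psum b z (f z)) ->
  analytic_on (@unit_disk R) f.
Proof.
move=> bf z0; rewrite unit_diskE => z01.
have z00 := normc_ge0 z0.
pose d := (1 - normc z0) / 2; have d0 : 0 < d by rewrite /d; lra.
(* The midpoint between [normc z0 + d] and 1: convergence at [t] gives absolute convergence at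
   [normc z0 + d]. *)
pose t := (3 + normc z0) / 4.
have bs : asum b (normc z0 + d).
  have ht : normc t%:C%C = t by rewrite normc_real ger0_norm// /t; lra.
  apply: (@psum_asum _ _ t%:C%C (f t%:C%C)); first by apply: bf; rewrite ht /t; lra.
  by rewrite ht /d /t; apply/andP; split; lra.
have [a [_ _ af]] := recenter d0 (lexx _) bs.
exists a, d; split => // z; rewrite norm_normc ltcR => zd.
apply: af; first exact: ltW.
rewrite addrC subrK; apply: bf.
have := normcD (z - z0) z0; rewrite subrK => /le_lt_trans; apply.
by move: zd; rewrite /d; lra.
Qed.

(** The radius and the bound are parameters because they have to be shared by all centres of a
    compact set, while the coefficients depend on the centre. *)
Definition expands f w (d M : R) := exists a,
  (forall h, normc h < d -> psum a h (f (w + h))) /\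
  forall n, normc (a n) * d ^+ n <= M.

Lemma expands_le f w (d d' M M' : R) : 0 < d' <= d -> M <= M' ->
  expands f w d M -> expands f w d' M'.
Proof.
move=> /andP[d'0 dd'] MM' [a [af aM]]; exists a; split.
  by move=> h hd; apply: af; exact: lt_le_trans dd'.
move=> n; rewrite (le_trans _ MM')// (le_trans _ (aM n))// ler_wpM2l ?normc_ge0//.
by rewrite lerXn2r ?nnegrE ?(ltW d'0)// (le_trans (ltW d'0)).
Qed.

(** The series at [z0] is absolutely summable at [r / 2]; moving the centre by at most [r / 4]
    leaves a radius of [r / 4], and its absolute sum at [r / 2] bounds all the recentred
    coefficients. *)
Lemma expands_near f z0 : analytic_on (@unit_disk R) f -> normc z0 < 1 ->
  exists d M : R, 0 < d /\ forall w, normc (w - z0) <= d -> expands f w d M.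
Proof.
move=> fa z01; have /fa[a [r [r0 ar]]] : unit_disk z0 by rewrite unit_diskE.
pose t := 3 / 4 * r.
have ht : normc t%:C%C = t by rewrite normc_real ger0_norm// /t; lra.
have as_ : asum a (r / 2).
  apply: (@psum_asum _ _ t%:C%C (f (z0 + t%:C%C))); last first.
    by rewrite ht /t; apply/andP; split; lra.
  have := ar (z0 + t%:C%C); rewrite addrAC subrr add0r; apply.
  by rewrite norm_normc ltcR ht /t; lra.
have d0 : 0 < r / 4 by lra.
exists (r / 4), (limn (series (fun n => normc (a n) * (r / 2) ^+ n))); split => //.
move=> w wd; have ks : normc (w - z0) + r / 4 <= r / 2 by lra.
have [a' [_ a'M a'f]] := recenter d0 ks as_.
exists a'; split => // h hd; apply: a'f; first exact: ltW.
have := ar (w + h); rewrite addrAC; apply.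
rewrite norm_normc ltcR.
by have := normcD (w - z0) h; lra.
Qed.

Lemma near_toC (x : R * R) (e : R) : 0 < e ->
  \forall y \near x, normc (toC y - toC x) < e.
Proof.
move=> e0; have e20 : 0 < e / 2 by rewrite divr_gt0.
have : nbhs x (ball x (e / 2)) by exact: nbhsx_ballx.
apply: filterS => -[y1 y2] [/=].
rewrite -!ball_normE /ball_/= => h1 h2.
apply: (le_lt_trans (normc_le_ReIm (toC (y1, y2) - toC x))); rewrite /= (splitr e).
by rewrite ltrD// distrC.
Qed.

(** Compactness of a square containing the disk, with [normc (toC x) <= rho] carried as a premise
    that fails on a neighbourhood of every point outside. One natural number [n] encodes both
    constants, as [1 / n.+1] and [n.+1], so that the covering argument along [\oo] delivers them
    together. *)
Lemma expands_uniform f (rho : R) : analytic_on (@unit_disk R) f -> rho < 1 ->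
  exists d M : R, 0 < d /\ forall w, normc w <= rho -> expands f w d M.
Proof.
move=> fa rho1.
have cK : compact (`[-1, 1]%classic `*` `[-1, 1]%classic : set (R * R)).
  by apply: compact_setX; exact: segment_compact.
pose P (n : nat) (x : R * R) :=
  normc (toC x) <= rho -> expands f (toC x) n.+1%:R^-1 n.+1%:R.
have /compact_near_coveringP/(_ _ \oo P _) := cK; case.
  move=> x _; have [xr|xr] := leP (normc (toC x)) rho; last first.
    have xr0 : 0 < normc (toC x) - rho by rewrite subr_gt0.
    exists ([set y | normc (toC y - toC x) < normc (toC x) - rho], setT) => /=.
      by split; [exact: near_toC|exact: filterT].
    move=> [y n] [hy _] yr; exfalso.
    have {}hy : normc (toC y - toC x) < normc (toC x) - rho := hy.
    have := normcD (toC x - toC y) (toC y); rewrite subrK (normcB (toC x)); lra.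
  have [d [M [d0 hd]]] := expands_near fa (le_lt_trans xr rho1).
  exists ([set y | normc (toC y - toC x) < d],
          [set n | d^-1 <= n%:R /\ M <= n%:R]) => /=.
    split; first exact: near_toC.
    apply: filterI; last exact: nbhs_infty_ger.
    exact: nbhs_infty_ger.
  move=> [y n] [hy [n1 n2]] yr.
  have {}hy : normc (toC y - toC x) < d := hy.
  apply: expands_le (hd _ (ltW hy)).
    rewrite invr_gt0 ltr0n/= -[leRHS]invrK lef_pV2 ?posrE ?invr_gt0 ?ltr0n//.
    by rewrite (le_trans n1)// ler_nat.
  by rewrite (le_trans n2)// ler_nat.
move=> n _ /(_ n (leqnn _)) hn; exists n.+1%:R^-1, n.+1%:R; split.
  by rewrite invr_gt0 ltr0n.
move=> w wr.
have -> : w = toC (complex.Re w, complex.Im w) by case: w {wr}.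
apply: hn; last by case: w wr.
have w1 : normc w <= 1 by rewrite ltW// (le_lt_trans wr).
by split => /=; rewrite in_itv/= -ler_norml (le_trans _ w1)// ?Re_le_normc ?Im_le_normc.
Qed.

End analytic_disk.

(** * Extension of the power series at 0 to the whole disk *)

Section global_power_series.
Context {R : realType}.
Implicit Types (h l w z k : R[i]) (a b c : nat -> R[i]) (f : R[i] -> R[i]).

(** The [n]-th recentred coefficient at [w] is itself a power series in [w]: the terms [m < n]
    vanish with their binomial coefficient. This lets the Cauchy estimate act on the variable
    [w]. *)
Lemma psum_shift (u : nat -> R[i]) n l w b :
  (forall m, u m = 'C(m, n)%:R * w ^+ (m - n) * b m) ->
  series (u : nat -> C R) m @[m --> \oo] --> (l : C R) ->
  psum (fun j => 'C(j + n, n)%:R * b (j + n)%N) w l.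
Proof.
move=> uE; rewrite -(cvg_shiftn n) /psum.
set F := (X in X @ _ --> _); set G := (X in _ -> X @ _ --> _).
suff -> : F = G by [].
apply/funext => N; rewrite /F /G /series/= addnC (big_cat_nat (n := n))//= ?leq_addr//.
rewrite big_nat_cond big1 ?add0r; last first.
  by move=> i /andP[/andP[_ ni] _]; rewrite uE bin_small// !mul0r.
rewrite -{1}(add0n n) big_addn addKn.
by apply: eq_bigr => j _; rewrite uE addnK; ring.
Qed.

(* If every expansion of [f] at a point of the disk of radius [rho] satisfies
   the Cauchy bound [M / d ^ n] with the same [d] and [M], then the estimates
   ['C(m, n) * |b_m| * rho ^ (m - n) <= M / d ^ n], summed over [n] with the
   weights [(d / 2) ^ n], bound [|b_m| * (rho + d / 2) ^ m]. *)
Lemma coef_bound f b (rho d M : R) : 0 < rho -> 0 < d ->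
  (forall z, normc z < rho -> psum b z (f z)) ->
  (forall w, normc w < rho -> expands f w d M) ->
  forall m, normc (b m) * (rho + d / 4) ^+ m <= 2 * M.
Proof.
move=> rho0 d0 bf fe.
have bs (s : R) : 0 <= s < rho -> asum b s.
  move=> /andP[s0 srho]; pose t := (s + rho) / 2.
  have ht : normc t%:C%C = t by rewrite normc_real ger0_norm// /t; lra.
  apply: (@psum_asum _ _ t%:C%C (f t%:C%C)).
    by apply: bf; rewrite ht /t; lra.
  by rewrite ht /t; apply/andP; split; lra.
have M0 : 0 <= M.
  have [|a [_ /(_ 0%N)]] := fe 0; first by rewrite normc0.
  by apply: le_trans; rewrite mulr_ge0 ?normc_ge0 ?exprn_ge0 ?ltW.
have term (s : R) n j : 0 <= s < rho ->
    'C(j + n, n)%:R * normc (b (j + n)%N) * s ^+ j <= M * d ^- n.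
  move=> /andP[s0 srho].
  pose c j := 'C(j + n, n)%:R * b (j + n)%N.
  (* Near [w] the recentred series of [b] and the expansion supplied by [fe] both represent [f], so
     they coincide and the coefficient inherits the bound [M / d ^ n]. *)
  have cw w : normc w < rho -> exists2 L, psum c w L & normc L <= M * d ^- n.
    move=> wrho; have w0 := normc_ge0 w.
    pose e := (rho - normc w) / 2; have e0 : 0 < e by rewrite /e; lra.
    have be : asum b (normc w + e) by apply: bs; rewrite /e; lra.
    have [b' [b'E _ b'f]] := recenter e0 (lexx _) be.
    have [a [af aM]] := fe w wrho.
    have ab : a = b'.
      apply: (@psum_inj _ a b' (fun h => f (w + h)) (Num.min d e)).
      - by rewrite lt_min d0.
      - by move=> h; rewrite lt_min => /andP[hd _]; exact: af.
      - move=> h; rewrite lt_min => /andP[_ he]; apply: b'f; first exact: ltW.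
        by apply: bf; have := normcD w h; rewrite /e in he; lra.
    exists (b' n); first exact: psum_shift (b'E n).
    by rewrite -ab ler_pdivlMr ?exprn_gt0.
  have cs : asum c s.
    pose t := (s + rho) / 2.
    have ht : normc t%:C%C = t by rewrite normc_real ger0_norm// /t; lra.
    have [|L cL _] := cw t%:C%C; first by rewrite ht /t; lra.
    by apply: (psum_asum cL); rewrite ht /t; lra.
  have -> : 'C(j + n, n)%:R * normc (b (j + n)%N) = normc (c j).
    by rewrite normcM normc_nat.
  apply: (cauchy_estimate s0 cs) => h l hs hl.
  have [|L cL LM] := cw h; first by rewrite hs.
  by rewrite (psum_unique hl cL).
(* The estimates hold only at radii [s] with [0 <= s < rho]. Giving up [d / 4] there and gaining
   [d / 2] from the binomial sum still leaves [rho + d / 4]; the weights [(d / 2) ^ n] against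
   [d ^ n] form a geometric series of sum at most 2. *)
move=> m; pose s := Num.max 0 (rho - d / 4).
have s_ge0 : 0 <= s by rewrite le_max lexx.
have srho : s < rho by rewrite gt_max rho0; lra.
have sd : rho + d / 4 <= s + d / 2.
  by have : rho - d / 4 <= s; [rewrite le_max lexx orbT|lra].
apply: (@le_trans _ _ (normc (b m) * (s + d / 2) ^+ m)).
  by rewrite ler_wpM2l ?normc_ge0// lerXn2r ?nnegrE//; lra.
rewrite exprDn mulr_sumr.
apply: (@le_trans _ _ (\sum_(n < m.+1) M * (1 / 2) ^+ n)).
  apply: ler_sum => -[n nm] _ /=.
  have := @term s n (m - n)%N; rewrite s_ge0 srho subnK// => /(_ isT) h.
  have -> : M * (1 / 2) ^+ n = M * d ^- n * (d / 2) ^+ n.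
    by rewrite -mulrA -exprVn -exprMn mulrA mulVf ?gt_eqF.
  rewrite -mulr_natl.
  have -> : normc (b m) * ('C(m, n)%:R * (s ^+ (m - n) * (d / 2) ^+ n)) =
     'C(m, n)%:R * normc (b m) * s ^+ (m - n) * (d / 2) ^+ n by ring.
  by rewrite ler_wpM2r// exprn_ge0//; lra.
rewrite -mulr_sumr mulrC ler_wpM2r//.
have := @subrX1 R (1 / 2) m.+1; have : 0 <= (1 / 2 : R) ^+ m.+1 by rewrite exprn_ge0//; lra.
move: (_ ^+ _) (\sum_(_ < _) _) => x y; lra.
Qed.

(** Let [rho] be the supremum of the radii up to 1 within which the series at 0 represents [f]. If
    [rho < 1], then [coef_bound] makes the series converge beyond [rho]. At a point [z] slightly
    outside, its sum equals [f z], because its recentring at a nearby [w] inside the circle has the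
    coefficients of the local expansion of [f] at [w]. *)
Lemma analytic_disk_psum f : analytic_on (@unit_disk R) f ->
  exists b, forall z, normc z < 1 -> psum b z (f z).
Proof.
move=> fa.
have [b [r0 [r0_gt0 bf0]]] : exists b, exists r : R, 0 < r /\
    forall z, normc z < r -> psum b z (f z).
  have /fa[b [r [r_gt0 br]]] : unit_disk (0 : R[i]) by rewrite unit_diskE normc0.
  by exists b, r; split => // z zr; have := br z; rewrite subr0 norm_normc ltcR => /(_ zr).
exists b.
pose S := [set r : R | r <= 1 /\ forall z, normc z < r -> psum b z (f z)].
have S0 : S (Num.min r0 1).
  split; first by rewrite ge_min lexx orbT.
  by move=> z; rewrite lt_min => /andP[zr _]; exact: bf0.
have supS : has_sup S.
  by split; [exists (Num.min r0 1)|exists 1 => r []].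
pose rho := sup S.
have rho_gt0 : 0 < rho.
  by apply: (lt_le_trans _ (ub_le_sup supS.2 S0)); rewrite lt_min r0_gt0 ltr01.
have bf z : normc z < rho -> psum b z (f z).
  move=> zr; have zr0 : 0 < rho - normc z by rewrite subr_gt0.
  have [r [_ hr] rz] := sup_adherent zr0 supS.
  by apply: hr; move: rz; rewrite -/rho; lra.
have rho1 : rho <= 1 by apply: ge_sup => [|r []//]; exists (Num.min r0 1).
move: rho1; rewrite le_eqVlt => /orP[/eqP rho1|rho1].
  by move=> z z1; apply: bf; rewrite rho1.
have [d [M [d0 fe]]] := expands_uniform fa rho1.
have bM := coef_bound rho_gt0 d0 bf (fun w wr => fe w (ltW wr)).
have bt : asum b (rho + d / 8).
  apply: (geometric_bound_cvg _ _ bM) => [|n]; last exact: normc_ge0.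
  by apply/andP; split; lra.
(* The centre is [w = (1 - q) * z]. The bound [d / 16] puts [z] within reach of both expansions at
   [w], [1 / 2] keeps [1 - q] positive, and [1 - rho] keeps the enlarged radius at most 1. Since
   [(1 - q) * (1 + q) <= 1], the centre lies inside the circle of radius [rho]. *)
pose q := Num.min (d / 16) (Num.min (1 / 2) (1 - rho)).
have q0 : 0 < q by rewrite !lt_min; apply/and3P; split; lra.
have [q1 q2 q3] : [/\ q <= d / 16, q <= 1 / 2 & q <= 1 - rho].
  by split; rewrite /q !ge_min lexx ?orbT.
have qrho : q * rho <= q by rewrite ler_piMr//; lra.
suff Sq : S (rho + q * rho).
  have := ub_le_sup supS.2 Sq; rewrite -/rho gerDl => h.
  by have := mulr_gt0 q0 rho_gt0; lra.
split; first lra.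
move=> z zq; have [zr|rz] := ltP (normc z) rho; first exact: bf.
pose w := (1 - q)%:C%C * z.
have wz : normc w = (1 - q) * normc z by rewrite normcM normc_real ger0_norm//; lra.
have hz : normc (z - w) = q * normc z.
  have -> : z - w = q%:C%C * z.
    by rewrite /w rmorphB/= mulrBl mul1r opprB addrC subrK.
  by rewrite normcM normc_real ger0_norm// ltW.
have wr : normc w < rho.
  rewrite wz; apply: (@lt_le_trans _ _ ((1 - q) * (rho + q * rho))).
    by rewrite ltr_pM2l//; lra.
  have -> : (1 - q) * (rho + q * rho) = rho - q ^+ 2 * rho by ring.
  by rewrite lerBlDr lerDl mulr_ge0 ?sqr_ge0// ltW.
have z1 : normc z < 1 by lra.
have hq : normc (z - w) <= q by rewrite hz ler_piMr// ltW.
have d16 : 0 < d / 16 by lra.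
have ks : normc w + d / 16 <= rho + d / 8 by lra.
have [b' [b'E _ b'f]] := recenter d16 ks bt.
have [a [af _]] := fe w (ltW wr).
have ab : a = b'.
  apply: (@psum_inj _ a b' (fun h => f (w + h)) (Num.min (d / 16) (rho - normc w))).
  - by rewrite lt_min d16 subr_gt0.
  - by move=> h; rewrite lt_min => /andP[hd _]; apply: af; lra.
  - move=> h; rewrite lt_min => /andP[hd hw]; apply: b'f; first exact: ltW.
    by apply: bf; have := normcD w h; lra.
have [|l bl] := asum_psum (h := z) _ bt; first by lra.
have : psum b' (z - w) l.
  by apply: b'f; [lra|rewrite addrC subrK].
have : psum a (z - w) (f z).
  by have := af (z - w); rewrite [w + _]addrC subrK; apply; lra.
by rewrite ab => h1 h2; rewrite (psum_unique h1 h2).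
Qed.

End global_power_series.

(** * Lebesgue measure of the plane *)

Section plane_measure.
Context {R : realType}.
Local Notation mu1 := (@lebesgue_measure R).
Local Notation mu2 := (@lebesgue_measure R \x @lebesgue_measure R)%E.

Lemma lebesgue_measure_shift (c : R) (A : set (measurableTypeR R)) : measurable A ->
  mu1 ((fun x => x + c) @^-1` A) = mu1 A.
Proof.
move=> mA.
have mf : measurable_fun [set: measurableTypeR R] (fun x : measurableTypeR R => (x + c : measurableTypeR R)).
  by apply: measurable_funD; [exact: measurable_id|exact: measurable_cst].
apply/esym.
rewrite -[RHS]/(pushforward mu1 (fun x : measurableTypeR R => (x + c : measurableTypeR R)) A).
apply: lebesgue_measure_unique => // _ [[a b] _ <-] /=.
rewrite /pushforward.
have -> : (fun x : R => x + c) @^-1` `]a, b]%classic = `]a - c, b - c]%classic.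
  by apply/seteqP; split => x /=; rewrite !in_itv/= ltrBlDr lerBrDr.
rewrite !lebesgue_measure_itv/= !lte_fin ltrD2r.
by case: ifP => // _; rewrite -!EFinD; congr (_%:E); ring.
Qed.

Definition mu2_preserving (F : R * R -> R * R) : Prop :=
  measurable_fun [set: measurableTypeR R * measurableTypeR R]
    (F : measurableTypeR R * measurableTypeR R -> measurableTypeR R * measurableTypeR R) /\
  forall A : set (measurableTypeR R * measurableTypeR R), measurable A -> mu2 (F @^-1` A) = mu2 A.

Lemma mu2_preserving_comp F G :
  mu2_preserving F -> mu2_preserving G -> mu2_preserving (F \o G).
Proof.
move=> [mF hF] [mG hG]; split; first exact: measurableT_comp.
move=> A mA; rewrite comp_preimage hG ?hF//.
by rewrite -[X in measurable X]setTI; exact: mF.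
Qed.

(** The vertical section of the preimage at [x] is the section of [A] translated by [- a * x], and
    the product measure integrates the lengths of vertical sections. *)
Lemma mu2_preserving_shearY (a : R) : mu2_preserving (fun p => (p.1, p.2 + a * p.1)).
Proof.
have mF : measurable_fun [set: measurableTypeR R * measurableTypeR R]
    ((fun p : measurableTypeR R * measurableTypeR R => (p.1, p.2 + a * p.1)) :
      measurableTypeR R * measurableTypeR R -> measurableTypeR R * measurableTypeR R).
  apply: measurable_fun_pair; first exact: measurable_fst.
  apply: measurable_funD; first exact: measurable_snd.
  by apply: measurable_funM; [exact: measurable_cst|exact: measurable_fst].
split => // A mA.
apply: eq_integral => x _ /=.
by rewrite -(lebesgue_measure_shift (a * x) (measurable_xsection x mA)) !xsectionE.
Qed.

Lemma mu2_sym (A : set (measurableTypeR R * measurableTypeR R)) : measurable A ->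
  mu2 A = (\int[mu1]_y mu1 (ysection A y))%E.
Proof.
move=> mA; rewrite (@product_measure_unique _ _ _ _ _ _ _ (mu1 \x^ mu1)%E)//.
by move=> X Y mX mY; exact: product_measure2E.
Qed.

Lemma mu2_preserving_shearX (a : R) : mu2_preserving (fun p => (p.1 + a * p.2, p.2)).
Proof.
have mF : measurable_fun [set: measurableTypeR R * measurableTypeR R]
    ((fun p : measurableTypeR R * measurableTypeR R => (p.1 + a * p.2, p.2)) :
      measurableTypeR R * measurableTypeR R -> measurableTypeR R * measurableTypeR R).
  apply: measurable_fun_pair; last exact: measurable_snd.
  apply: measurable_funD; first exact: measurable_fst.
  by apply: measurable_funM; [exact: measurable_cst|exact: measurable_snd].
split => // A mA; rewrite !mu2_sym//; last first.
  by rewrite -[X in measurable X]setTI; exact: mF.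
apply: eq_integral => y _ /=.
by rewrite -(lebesgue_measure_shift (a * y) (measurable_ysection y mA)) !ysectionE.
Qed.

Definition rot (w : R[i]) (p : R * R) : R * R :=
  (complex.Re w * p.1 - complex.Im w * p.2, complex.Re w * p.2 + complex.Im w * p.1).

Lemma toC_rot w p : toC (rot w p) = w * toC p.
Proof. by case: w. Qed.

Lemma mu2_preserving_rot w : normc w = 1 -> mu2_preserving (rot w).
Proof.
case: w => u v w1.
have uv : u ^+ 2 + v ^+ 2 = 1.
  by have := normcsqr (Complex u v); rewrite w1 expr1n.
have shears (x y : R) : x ^+ 2 + y ^+ 2 = 1 -> y != 0 -> mu2_preserving (rot (Complex x y)).
  move=> xy y0; pose a := (x - 1) / y.
  (* a rotation is a product of three shears *)
  have -> : rot (Complex x y) = (fun p => (p.1 + a * p.2, p.2)) \o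
      ((fun p => (p.1, p.2 + y * p.1)) \o (fun p => (p.1 + a * p.2, p.2))).
    apply/funext => -[p q]; rewrite /rot /=.
    have ya : y * a = x - 1 by rewrite mulrCA mulfV// mulr1.
    have ax : a * x = - y - a.
      apply: (mulfI y0); rewrite mulrBr mulrA ya mulrN -expr2.
      have -> : y ^+ 2 = 1 - x ^+ 2 by rewrite -xy; ring.
      by ring.
    congr (_, _).
      have -> : p + a * q + a * (q + y * (p + a * q)) =
         p + a * q + a * q + (y * a) * (p + a * q) by ring.
      rewrite ya.
      have -> : p + a * q + a * q + (x - 1) * (p + a * q) =
         a * q + x * p + (a * x) * q by ring.
      by rewrite ax; ring.
    have -> : q + y * (p + a * q) = q + y * p + (y * a) * q by ring.
    by rewrite ya; ring.
  apply: mu2_preserving_comp; first exact: mu2_preserving_shearX.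
  by apply: mu2_preserving_comp;
    [exact: mu2_preserving_shearY|exact: mu2_preserving_shearX].
(* The three shears divide by the imaginary part. The remaining rotations are the identity and the
   half turn, the square of a quarter turn. *)
have [v0|v0] := eqVneq v 0; last exact: shears.
have i0 : mu2_preserving (rot (Complex 0 1)).
  by apply: shears; rewrite ?oner_neq0// expr0n expr1n add0r.
move: uv; rewrite v0 expr0n addr0 => /eqP; rewrite sqrf_eq1 => /orP[|] /eqP ->.
  have -> : rot (Complex 1 0) = id.
    by apply/funext => -[p q]; rewrite /rot/=; congr (_, _); ring.
  by split => // ; exact: measurable_id.
have -> : rot (Complex (-1) 0) = rot (Complex 0 1) \o rot (Complex 0 1).
  by apply/funext => -[p q]; rewrite /rot/=; congr (_, _); ring.
exact: mu2_preserving_comp.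
Qed.

Lemma integral_rot w (G : R * R -> \bar R) : normc w = 1 ->
  measurable_fun (@toC R @^-1` @unit_disk R) G ->
  (forall p, (0 <= G p)%E) ->
  (\int[mu2]_(p in @toC R @^-1` @unit_disk R) G (rot w p) =
   \int[mu2]_(p in @toC R @^-1` @unit_disk R) G p)%E.
Proof.
move=> w1 mG G0.
have [mF hF] := mu2_preserving_rot w1.
have DD : rot w @^-1` (@toC R @^-1` @unit_disk R) = @toC R @^-1` @unit_disk R.
  apply/seteqP; split => p; rewrite /preimage/= toC_rot !unit_diskE normcM w1 mul1r//.
have := @ge0_integral_pushforward _ _ _ _ R _ mF mu2 _ G (@measurable_D2 R) mG.
rewrite DD => <-; last by move=> p _; exact: G0.
by apply: eq_measure_integral => A mA _; exact: hF.
Qed.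

End plane_measure.

(** * Integrals of radial functions *)

Section radial_integrals.
Context {R : realType}.
Local Notation mu1 := (@lebesgue_measure R).
Local Notation mu2 := (@lebesgue_measure R \x @lebesgue_measure R)%E.

Lemma derive_LRcontinuous (f F : R -> R) (a b : R) : a <= b ->
  (forall x : R, a <= x <= b -> is_derive x 1 F (f x)) -> derivable_oo_LRcontinuous F a b.
Proof.
move=> ab dF.
have cF (x : R) : a <= x <= b -> {for x, continuous F}.
  move=> xab; apply/differentiable_continuous/derivable1_diffP.
  by apply: ex_derive; exact: dF.
split; first by move=> x /[!in_itv]/= /andP[ax xb]; apply: ex_derive; apply: dF; rewrite !ltW.
- by apply: cvg_at_right_filter; apply: cF; rewrite lexx.
- by apply: cvg_at_left_filter; apply: cF; rewrite lexx andbT.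
Qed.

Lemma integral_derive (f F : R -> R) (a b : R) : a < b ->
  (forall x : R, a <= x <= b -> is_derive x 1 F (f x)) ->
  (forall x : R, a <= x <= b -> {for x, continuous f}) ->
  (\int[mu1]_(x in `[a, b]) (f x)%:E)%E = ((F b)%:E - (F a)%:E)%E.
Proof.
move=> ab dF cf; apply: continuous_FTC2 => //.
- by apply: continuous_in_subspaceT => x /[!inE]/= xab; apply: cf; rewrite in_itv in xab.
- by apply: derive_LRcontinuous dF; exact: ltW.
- move=> x /[!in_itv]/= /andP[ax xb]; rewrite derive1E.
  by apply: (@derive_val _ _ _ _ _ _ _ (dF x _)); rewrite !ltW.
Qed.

(** The substitution [x = sqrt b * sin t] turns the integral into that of [b * cos t ^ 2], which has
    the primitive [b / 2 * (t + sin t * cos t)]. *)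
Lemma integral_semicircle (b : R) : 0 < b ->
  (\int[mu1]_(x in `[(- Num.sqrt b)%R, (Num.sqrt b)%R]) (Num.sqrt (b - x ^+ 2))%:E =
  (b * pi / 2)%:E)%E.
Proof.
move=> b0; pose F (t : R) := Num.sqrt b * sin t.
have sb : Num.sqrt b ^+ 2 = b by rewrite sqr_sqrtr// ltW.
have sb0 : 0 < Num.sqrt b by rewrite sqrtr_gt0.
have dF (t : R) : is_derive t 1 F (Num.sqrt b * cos t).
  by rewrite -[Num.sqrt b * cos t]/(Num.sqrt b *: cos t); exact: is_deriveZ.
have F'E : F^`()%classic = fun t => Num.sqrt b * cos t.
  by apply/funext => t; rewrite derive1E derive_val.
have cF' : continuous F^`()%classic.
  by rewrite F'E => t; apply: cvgMr; exact: continuous_cos.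
have pi0 := pi_gt0 R.
have FE1 : F (- (pi / 2)) = - Num.sqrt b by rewrite /F sinN sin_pihalf mulrN1.
have FE2 : F (pi / 2) = Num.sqrt b by rewrite /F sin_pihalf mulr1.
rewrite -FE1 -FE2 integration_by_substitution_increasing//; first last.
- apply: continuous_subspaceT => x.
  apply: (@continuous_comp _ _ _ (fun x : R => b - x ^+ 2) (@Num.sqrt R)); last exact: sqrt_continuous.
  apply: cvgB; first exact: cvg_cst.
  exact: exprn_continuous.
- by apply: (@derive_LRcontinuous (fun t => Num.sqrt b * cos t)) => // ; lra.
- by apply/cvg_ex; eexists; apply: cvg_at_left_filter; exact: cF'.
- by apply/cvg_ex; eexists; apply: cvg_at_right_filter; exact: cF'.
- by move=> x y xI yI xy; rewrite /F ltr_pM2l// (ltr_sin xI yI).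
- by lra.
pose H (t : R) := b / 2 * (t + sin t * cos t).
have dH (t : R) : is_derive t 1 H (b * cos t ^+ 2).
  have -> : b * cos t ^+ 2 = b / 2 *: (1 + (sin t *: (- sin t) + cos t *: cos t)).
    rewrite /GRing.scale/=; have := cos2Dsin2 t => h.
    have -> : sin t * - sin t = cos t ^+ 2 - 1 by rewrite -h; ring.
    by field.
  exact: is_deriveZ.
transitivity (\int[mu1]_(x in `[(- (pi / 2))%R, (pi / 2)%R]) (b * cos x ^+ 2)%:E)%E.
  apply: eq_integral => t; rewrite inE/= in_itv/= => tI.
  rewrite !fctE F'E /F; congr (_%:E).
  have -> : b - (Num.sqrt b * sin t) ^+ 2 = (Num.sqrt b * cos t) ^+ 2.
    by rewrite !exprMn sb cos2sin2; ring.
  rewrite sqrtr_sqr ger0_norm; last first.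
    by rewrite mulr_ge0 ?cos_ge0_pihalf// ltW.
  by rewrite -expr2 exprMn sb.
rewrite (integral_derive (F := H)) /H//.
- by rewrite cosN cos_pihalf !mulr0 !addr0 -EFinB; congr (_%:E); field.
- by lra.
- move=> t _; apply: cvgMr; apply: (@continuous_comp _ _ _ (@cos R) (fun x => x ^+ 2)).
    exact: continuous_cos.
  exact: exprn_continuous.
Qed.

Lemma mu2_disk (b : R) : 0 <= b ->
  mu2 [set p | p.1 ^+ 2 + p.2 ^+ 2 < b] = (pi * b)%:E.
Proof.
rewrite le_eqVlt => /predU1P[<-|b0].
  rewrite mulr0 [X in mu2 X](_ : _ = set0) ?measure0// -subset0 => p /=.
  by rewrite ltNge addr_ge0// sqr_ge0.
have sb0 : 0 < Num.sqrt b by rewrite sqrtr_gt0.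
transitivity (\int[mu1]_x ((fun x => (2 * Num.sqrt (b - x ^+ 2))%:E) \_ `[(- Num.sqrt b)%R, (Num.sqrt b)%R]) x)%E.
  apply: eq_integral => x _ /=; rewrite patchE.
  have xb : (x \in (`[- Num.sqrt b, Num.sqrt b]%classic : set R)) = (x ^+ 2 <= b).
    rewrite mem_setE in_itv/= -ler_norml -(@ler_pXn2r _ 2) ?nnegrE ?sqrtr_ge0//.
    by rewrite real_normK ?num_real// sqr_sqrtr// ltW.
  rewrite xb; case: ifPn => [xle|]; last rewrite -ltNge => xgt; last first.
    rewrite [X in mu1 X](_ : _ = set0) ?measure0// -subset0 => y.
    rewrite xsectionE/= => /(le_lt_trans _) h.
    by have := h (x ^+ 2); rewrite lerDl sqr_ge0 ltNge (ltW xgt) => /(_ isT).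
  rewrite [X in mu1 X](_ : _ = `](- Num.sqrt (b - x ^+ 2)), (Num.sqrt (b - x ^+ 2))[%classic); last first.
    apply/seteqP; split => y; rewrite xsectionE/= in_itv/= -ltr_norml.
      rewrite -ltrBrDl => h; rewrite -(@ltr_pXn2r _ 2) ?nnegrE ?sqrtr_ge0//.
      by rewrite real_normK ?num_real// sqr_sqrtr// subr_ge0.
    rewrite -(@ltr_pXn2r _ 2) ?nnegrE ?sqrtr_ge0//.
    by rewrite real_normK ?num_real// sqr_sqrtr ?subr_ge0// ltrBrDl.
  rewrite lebesgue_measure_itv/= lte_fin; case: ifPn => [_|].
    by rewrite -EFinB; congr (_%:E); ring.
  have : 0 <= Num.sqrt (b - x ^+ 2) by exact: sqrtr_ge0.
  by rewrite -leNgt => s0 s1; congr (_%:E); lra.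
rewrite -integral_mkcond.
under eq_integral do rewrite EFinM.
rewrite ge0_integralZl//.
- by rewrite integral_semicircle// -EFinM; congr (_%:E); field.
- apply/measurable_EFinP; apply: measurable_funTS; apply: continuous_measurable_fun => x.
  apply: (@continuous_comp _ _ _ (fun x : R => b - x ^+ 2) (@Num.sqrt R)); last exact: sqrt_continuous.
  apply: cvgB; first exact: cvg_cst.
  exact: exprn_continuous.
Qed.

Let q (p : measurableTypeR R * measurableTypeR R) : measurableTypeR R := p.1 ^+ 2 + p.2 ^+ 2.

Let mq : measurable_fun [set: measurableTypeR R * measurableTypeR R] q.
Proof. exact: measurable_sqsum. Qed.

(** The image of the plane measure under [x^2 + y^2] and [pi] times Lebesgue measure on the
    half-line agree on every ray []-oo, x[], by the area of a disk. The rays are stable under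
    intersection and generate the Borel sets, so the measures coincide. This serves as polar
    coordinates in [s = r^2]. *)
Lemma mu2_sqsum (A : set (measurableTypeR R)) : measurable A -> A `<=` `[0, +oo[%classic ->
  mu2 (q @^-1` A) = (pi%:E * mu1 A)%E.
Proof.
move=> mA A0.
have mI : measurable (`[0, +oo[%classic : set (measurableTypeR R)) by exact: measurable_itv.
pose k : {nonneg R} := NngNum (pi_ge0 R).
have -> : (pi%:E * mu1 A)%E = mscale k (mrestr mu1 mI) A.
  by rewrite /mscale/= /mrestr setIidl.
rewrite -[LHS]/(pushforward mu2 q A).
have GE (x : R) : pushforward mu2 q `]-oo, x[%classic = mscale k (mrestr mu1 mI) `]-oo, x[%classic.
  rewrite /pushforward /mscale/= /mrestr.
  have -> : q @^-1` `]-oo, x[%classic = [set p | p.1 ^+ 2 + p.2 ^+ 2 < x].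
    by apply/seteqP; split => p /=; rewrite in_itv.
  have -> : `]-oo, x[%classic `&` `[0, +oo[%classic = (`[0, x[%classic : set R).
    by apply/seteqP; split => y /=; rewrite !in_itv/= andbT; [case=> -> ->|case/andP].
  rewrite lebesgue_measure_itv/= lte_fin; case: ifPn => x0.
    by rewrite mu2_disk ?ltW// -EFinB subr0.
  rewrite mule0 [X in mu2 X](_ : _ = set0) ?measure0// -subset0 => p /= h.
  by move: x0; rewrite (le_lt_trans _ h)// addr_ge0// sqr_ge0.
apply: (@measure_unique _ R (measurableTypeR R) (@RGenInftyO.G R)
  (fun n => `]-oo, n%:R[%classic) _ _ _ _ (pushforward mu2 q)
  (mscale k (mrestr mu1 mI))) => //.
- exact: RGenInftyO.measurableE.
- move=> _ _ [x ->] [y ->]; exists (Num.min x y).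
  by apply/seteqP; split => z /=; rewrite !in_itv/= lt_min; [case=> -> ->|case/andP].
- by move=> n; exists n%:R.
- rewrite -subTset => x _; exists (Num.trunc `|x|).+1 => //=; rewrite in_itv/=.
  by rewrite (le_lt_trans (ler_norm x))// truncnS_gt.
- by move=> _ [x ->]; exact: GE.
- move=> n; rewrite -[X in (X < _)%E]/(pushforward mu2 q `]-oo, n%:R[%classic).
  rewrite /pushforward.
  have -> : q @^-1` `]-oo, n%:R[%classic = [set p | p.1 ^+ 2 + p.2 ^+ 2 < n%:R].
    by apply/seteqP; split => p /=; rewrite in_itv.
  by rewrite mu2_disk// ltry.
Qed.

Lemma integral_radial (g : R -> \bar R) : measurable_fun [set: R] g ->
  (forall x, (0 <= g x)%E) ->
  (\int[mu2]_(p in @toC R @^-1` @unit_disk R) g (p.1 ^+ 2 + p.2 ^+ 2)%R =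
   pi%:E * \int[mu1]_(s in `[0%R, 1%R[) g s)%E.
Proof.
move=> mg g0; pose k : {nonneg R} := NngNum (pi_ge0 R).
have mI : measurable (`[0, 1[%classic : set (measurableTypeR R)) by exact: measurable_itv.
have mgI : measurable_fun (`[0, 1[%classic : set (measurableTypeR R)) g by exact: measurable_funTS.
rewrite -[pi]/(k%:num) -ge0_integral_mscale//.
have := @ge0_integral_pushforward _ _ _ _ R _ mq mu2 `[0, 1[%classic g mI mgI.
have -> : q @^-1` `[0, 1[%classic = @toC R @^-1` @unit_disk R.
  rewrite D2E; apply/seteqP; split => p /=; rewrite in_itv/= /q.
    by case/andP.
  by move=> ->; rewrite addr_ge0// sqr_ge0.
move=> <- //.
apply: eq_measure_integral => A mA AI.
rewrite -[LHS]/(mu2 (q @^-1` A)) mu2_sqsum// => x /AI/=.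
by rewrite !in_itv/= => /andP[->].
Qed.

End radial_integrals.

(** * The Gamma function and the moments of the weight *)

Section improper_integrals.
Context {R : realType}.
Local Notation mu1 := (@lebesgue_measure R).

(** On each compact interval this is the fundamental theorem for [F' = u - v]. Monotone convergence
    is then applied to [u] and [v] separately; as both are nonnegative, the identity makes sense in
    the extended reals before any integral is known to be finite. *)
Lemma integral_by_parts_improper (u v F : R -> R) (a b : nat -> R) (D : set R) (l : R) :
  (forall n, a n < b n) -> {homo a : m n / (m <= n)%N >-> n <= m} ->
  {homo b : m n / (m <= n)%N >-> m <= n} ->
  D = \bigcup_n `[a n, b n]%classic ->
  measurable_fun [set: R] u -> measurable_fun [set: R] v ->
  (forall x : R, D x -> 0 <= u x) -> (forall x : R, D x -> 0 <= v x) ->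
  (forall x : R, D x -> is_derive x 1 F (u x - v x)) ->
  (forall x : R, D x -> {for x, continuous u}) ->
  (forall x : R, D x -> {for x, continuous v}) ->
  F (b n) - F (a n) @[n --> \oo] --> l ->
  (\int[mu1]_(x in D) (u x)%:E = \int[mu1]_(x in D) (v x)%:E + l%:E)%E.
Proof.
move=> ab ha hb DE mu mv u0 v0 dF cu cv Fl.
have KD n : `[a n, b n]%classic `<=` D by rewrite DE => x xn; exists n.
have cvgI (f : R -> R) : measurable_fun [set: R] f -> (forall x, D x -> 0 <= f x) ->
    (\int[mu1]_(x in `[a n, b n]) (f x)%:E)%E @[n --> \oo] -->
    (\int[mu1]_(x in D) (f x)%:E)%E.
  move=> mf f0; rewrite DE.
  apply: (@ge0_nondecreasing_set_cvg_integral _ (measurableTypeR R) R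
    (fun n => `[a n, b n]%classic) (fun x => (f x)%:E) mu1).
  - move=> m n mn; apply/subsetPset => x /=; rewrite !in_itv/= => /andP[ax xb].
    by rewrite (le_trans (ha _ _ mn))// (le_trans xb)// hb.
  - by move=> i; exact: measurable_itv.
  - by move=> i; apply/measurable_EFinP; exact: measurable_funTS.
  - by move=> i x xi; rewrite lee_fin f0//; exact: KD xi.
have inK n (x : R) : a n <= x <= b n -> D x.
  by move=> xn; apply: (KD n); rewrite /= in_itv.
have iK (f : R -> R) n : (forall x, D x -> {for x, continuous f}) ->
    mu1.-integrable (`[a n, b n]%classic : set R) (EFin \o f).
  move=> cf; apply: continuous_compact_integrable; first exact: segment_compact.
  apply: continuous_in_subspaceT => x /[!inE]/=; rewrite in_itv/= => xn.
  by apply: cf; exact: inK xn.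
have E n : (\int[mu1]_(x in `[a n, b n]) (u x)%:E =
            \int[mu1]_(x in `[a n, b n]) (v x)%:E + (F (b n) - F (a n))%:E)%E.
  have cuv (x : R) : a n <= x <= b n -> {for x, continuous (fun x => u x - v x)}.
    by move=> /inK Dx; apply: cvgB; [exact: cu|exact: cv].
  have := integral_derive (ab n) (fun x h => dF x (inK n x h)) cuv.
  rewrite EFinB => <-.
  under [X in (_ + X)%E]eq_integral do rewrite EFinB.
  rewrite (integralB_EFin _ (iK u n cu) (iK v n cv))//.
  by rewrite addeC subeK// integrable_fin_num//; exact: iK.
have := cvgI u mu u0; rewrite (_ : (fun n => _) = (fun n => \int[mu1]_(x in `[a n, b n]) (v x)%:E + (F (b n) - F (a n))%:E)%E); last first.
  by apply/funext => n; exact: E.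
move=> cu'; apply: (cvg_unique _ cu') => //.
apply: cvgeD; [by rewrite fin_num_adde_defl|exact: cvgI|].
by apply/cvg_EFin => //; near=> n.
Unshelve. all: by end_near. Qed.

End improper_integrals.

Section gamma_function.
Context {R : realType}.
Local Notation mu1 := (@lebesgue_measure R).
Implicit Types (s t x : R).

(** Left in the extended reals, so that the recursion can be proved first and finiteness derived
    from it. *)
Definition gamma_integral s : \bar R :=
  (\int[mu1]_(t in `]0%R, +oo[) (t `^ (s - 1) * expR (- t))%:E)%E.

Lemma Gamma_gamma_integral s : Gamma s = fine (gamma_integral s).
Proof. by []. Qed.

Lemma cvg_inv_succ2 : (n.+2%:R^-1 : R) @[n --> \oo] --> 0.
Proof.
have := @cvg_harmonic R; by rewrite -cvg_shiftS.
Qed.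

Lemma powR_expRN_cvg0 s : (n.+2%:R `^ s * expR (- n.+2%:R) : R) @[n --> \oo] --> 0.
Proof.
pose m := Num.trunc `|s|.
have sm : s <= m.+1%:R by rewrite (le_trans (ler_norm s))// ltW// truncnS_gt.
(* With [s <= m.+1], the single term [x ^ m.+2 / m.+2!] of the exponential series already beats
   [x ^ s] by a factor [x], up to the factorial. *)
apply: (@squeeze_cvgr _ _ _ _ (fun=> 0) (fun n => m.+2`!%:R * n.+2%:R^-1)).
- near=> n; rewrite mulr_ge0 ?powR_ge0 ?expR_ge0//=.
  have n0 : 0 < n.+2%:R :> R by rewrite ltr0n.
  rewrite expRN ler_pdivrMr ?expR_gt0//.
  apply: (@le_trans _ _ (n.+2%:R ^+ m.+1)).
    by rewrite -powR_mulrn ?ler0n// ler_powR// ler1n.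
  rewrite mulrAC ler_pdivlMr// -exprSr.
  have := @expR_ge1Dxn R n.+2%:R m.+1 (ler0n _ _).
  have f0 : 0 < m.+2`!%:R :> R by rewrite ltr0n fact_gt0.
  move=> h; have : n.+2%:R ^+ m.+2 / m.+2`!%:R <= expR n.+2%:R :> R.
    by apply: le_trans h; rewrite lerDr.
  by rewrite ler_pdivrMr// mulrC.
- exact: cvg_cst.
- by rewrite -(mulr0 m.+2`!%:R); apply: cvgMr; exact: cvg_inv_succ2.
Unshelve. all: by end_near. Qed.

(** Starting at 2 makes every interval nondegenerate, as [integral_by_parts_improper] requires. *)
Lemma itv0y_bigcup : `]0, +oo[%classic = \bigcup_n `[n.+2%:R^-1, n.+2%:R]%classic :> set R.
Proof.
apply/seteqP; split => x /=; rewrite in_itv/= andbT; last first.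
  by move=> [n _]/=; rewrite in_itv/= => /andP[+ _]; apply: lt_le_trans; rewrite invr_gt0.
move=> x0; pose n := maxn (Num.trunc x) (Num.trunc x^-1).
exists n => //=; rewrite in_itv/=; apply/andP; split.
  rewrite -[leRHS]invrK lef_pV2 ?posrE ?invr_gt0//.
  rewrite (le_trans (ltW (truncnS_gt x^-1)))// ler_nat ltnW// ltnS ltnS.
  by rewrite leq_max leqnn orbT.
rewrite (le_trans (ltW (truncnS_gt x)))// ler_nat ltnW// ltnS ltnS.
by rewrite leq_max leqnn.
Qed.

Let is_derive_expRN x : is_derive x 1 (fun t => expR (- t)) (- expR (- x)).
Proof.
have dN : is_derive x 1 (fun t : R => - t) (- 1) by apply: is_deriveN.
rewrite -mulN1r -[X in is_derive _ _ _ X]mulrC; apply: (@is_derive1_comp R expR (fun t => - t)).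
Qed.

Let continuous_expRN : continuous (fun t : R => expR (- t)).
Proof.
move=> x; apply: (@continuous_comp _ _ _ (fun t : R => - t) (@expR R)).
  exact: opp_continuous.
exact: continuous_expR.
Qed.

Let continuous_powR s x : 0 < x -> {for x, continuous (fun t => t `^ s)}.
Proof.
move=> x0; apply/differentiable_continuous/derivable1_diffP.
by apply: derivable_powR; rewrite in_itv/= x0.
Qed.

Lemma measurable_gamma_integrand s :
  measurable_fun [set: R] (fun t => t `^ s * expR (- t)).
Proof.
apply: measurable_funM; first exact: measurable_powR.
by apply: (measurableT_comp (@measurable_expR R)); exact: oppr_measurable.
Qed.

(** The primitive is [- t ^ s * exp (- t)]. It vanishes at infinity by [powR_expRN_cvg0], and at 0
    because [t ^ s <= t] for [0 < t <= 1] and [s >= 1]. *)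
Lemma gamma_integral_rec s : 1 <= s -> gamma_integral (s + 1) = (s%:E * gamma_integral s)%E.
Proof.
move=> s1; have s0 : 0 < s by lra.
rewrite /gamma_integral addrK -ge0_integralZl//; first last.
- by rewrite lee_fin ltW.
- by move=> t _; rewrite lee_fin mulr_ge0 ?powR_ge0 ?expR_ge0.
- apply/measurable_EFinP; apply: measurable_funTS; exact: measurable_gamma_integrand.
under [RHS]eq_integral do rewrite -EFinM.
rewrite -[RHS]adde0.
apply: (@integral_by_parts_improper _ _ _ (fun t => - (t `^ s * expR (- t)))
  (fun n => n.+2%:R^-1) (fun n => n.+2%:R)).
- move=> n; apply: (@lt_le_trans _ _ 1); last by rewrite ler1n.
  by rewrite invf_lt1 ?ltr0n// ltr1n.
- by move=> m n mn; rewrite lef_pV2 ?posrE ?ltr0n// ler_nat.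
- by move=> m n mn; rewrite ler_nat.
- exact: itv0y_bigcup.
- exact: measurable_gamma_integrand.
- apply: measurable_funM; first exact: measurable_cst.
  exact: measurable_gamma_integrand.
- by move=> x _; rewrite mulr_ge0 ?powR_ge0 ?expR_ge0.
- by move=> x _; rewrite mulr_ge0 ?(ltW s0)// mulr_ge0 ?powR_ge0 ?expR_ge0.
- move=> x /=; rewrite in_itv/= andbT => x0.
  have -> : x `^ s * expR (- x) - s * (x `^ (s - 1) * expR (- x)) =
     - (x `^ s *: (- expR (- x)) + expR (- x) *: (s * x `^ (s - 1))).
    by rewrite /GRing.scale/=; ring.
  by apply: is_deriveN; exact: (is_deriveM (is_derive1_powR s x0) (is_derive_expRN x)).
- move=> x /=; rewrite in_itv/= andbT => x0.
  by apply: cvgM; [exact: continuous_powR|exact: continuous_expRN].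
- move=> x /=; rewrite in_itv/= andbT => x0; apply: cvgMr.
  by apply: cvgM; [exact: continuous_powR|exact: continuous_expRN].
have h1 : (- (n.+2%:R `^ s * expR (- n.+2%:R)) : R) @[n --> \oo] --> (- 0 : R).
  by apply: cvgN; exact: powR_expRN_cvg0.
have h2 : (n.+2%:R^-1 `^ s * expR (- n.+2%:R^-1) : R) @[n --> \oo] --> (0 : R).
  apply: (@squeeze_cvgr _ _ _ _ (fun=> 0) (fun n => n.+2%:R^-1)).
  - near=> n; rewrite mulr_ge0 ?powR_ge0 ?expR_ge0//=.
    have n0 : 0 < n.+2%:R^-1 :> R by rewrite invr_gt0.
    have e1 : expR (- n.+2%:R^-1) <= 1 :> R by rewrite -[leRHS](expR0 R) ler_expR oppr_le0 ltW.
    rewrite (le_trans (ler_piMr (powR_ge0 _ _) e1))//.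
    by apply: ge1r_powR => //; rewrite n0 invf_le1 ?ler1n.
  - exact: cvg_cst.
  - exact: cvg_inv_succ2.
have h : _ --> - 0 + 0 := cvgD h1 h2; rewrite oppr0 addr0 in h.
by under eq_fun do rewrite opprK; exact: h.
Unshelve. all: by end_near. Qed.

Lemma gamma_integral1 : gamma_integral 1 = 1%E.
Proof.
rewrite /gamma_integral subrr.
have -> : 1%E = (\int[mu1]_(t in `]0%R, +oo[) (0 : R)%:E + (1 : R)%:E)%E.
  by rewrite integral0_eq// add0e.
apply: (@integral_by_parts_improper _ _ _ (fun t => - (expR (- t)))
  (fun n => n.+2%:R^-1) (fun n => n.+2%:R)).
- move=> n; apply: (@lt_le_trans _ _ 1); last by rewrite ler1n.
  by rewrite invf_lt1 ?ltr0n// ltr1n.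
- by move=> m n mn; rewrite lef_pV2 ?posrE ?ltr0n// ler_nat.
- by move=> m n mn; rewrite ler_nat.
- exact: itv0y_bigcup.
- exact: measurable_gamma_integrand.
- exact: measurable_cst.
- by move=> x _; rewrite mulr_ge0 ?powR_ge0 ?expR_ge0.
- by [].
- move=> x /=; rewrite in_itv/= andbT => x0.
  by rewrite powRr0 mul1r subr0 -[X in is_derive _ _ _ X]opprK; apply: is_deriveN.
- move=> x /=; rewrite in_itv/= andbT => x0.
  by apply: cvgM; [exact: continuous_powR|exact: continuous_expRN].
- by move=> x _; exact: cvg_cst.
have h1 : (- expR (- n.+2%:R) : R) @[n --> \oo] --> (- 0 : R).
  apply: cvgN; apply: (cvg_trans _ (powR_expRN_cvg0 0)).
  by apply: near_eq_cvg; apply: nearW => n; rewrite powRr0 mul1r.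
have h2 : (expR (- n.+2%:R^-1) : R) @[n --> \oo] --> (1 : R).
  have h0 : (- n.+2%:R^-1 : R) @[n --> \oo] --> (- 0 : R).
    by apply: cvgN; exact: cvg_inv_succ2.
  have h3 : _ --> expR (- 0) := continuous_cvg _ (@continuous_expR R _) h0.
  by rewrite oppr0 expR0 in h3; exact: h3.
have h : _ --> (- 0 + 1 : R) := cvgD h1 h2; rewrite oppr0 add0r in h.
by under eq_fun do rewrite opprK; exact: h.
Unshelve. all: by end_near. Qed.

Lemma gamma_integral_nat n : gamma_integral n.+1%:R = (n`!%:R)%:E.
Proof.
elim: n => [|n IH]; first by rewrite gamma_integral1.
rewrite -[n.+2%:R]natr1 gamma_integral_rec ?ler1n//.
by rewrite IH -EFinM factS natrM.
Qed.

(** The integrand is dominated by the sum of those at 1 and at an integer above [s]: on [t <= 1] the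
    power is at most 1, and on [t > 1] it grows with the exponent. At integers the integral is a
    factorial. *)
Lemma gamma_integral_fin s : 1 <= s -> gamma_integral s \is a fin_num.
Proof.
move=> s1; rewrite ge0_fin_numE; last first.
  by apply: integral_ge0 => t _; rewrite lee_fin mulr_ge0 ?powR_ge0 ?expR_ge0.
pose n := Num.trunc s.
have sn : s <= n.+1%:R by rewrite ltW// truncnS_gt.
apply: (@le_lt_trans _ _ (gamma_integral 1 + gamma_integral n.+2%:R)%E); last first.
  by rewrite gamma_integral1 gamma_integral_nat ltry.
have mg (x : R) : measurable_fun (`]0%R, +oo[%classic : set R)
    (fun t => (t `^ x * expR (- t))%:E).
  by apply/measurable_EFinP; apply: measurable_funTS; exact: measurable_gamma_integrand.
rewrite /gamma_integral -ge0_integralD//; [|by move=> t _; rewrite lee_fin mulr_ge0 ?powR_ge0 ?expR_ge0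
  |exact: mg|by move=> t _; rewrite lee_fin mulr_ge0 ?powR_ge0 ?expR_ge0|exact: mg].
apply: ge0_le_integral => //.
- by move=> t _; rewrite lee_fin mulr_ge0 ?powR_ge0 ?expR_ge0.
- exact: mg.
- by apply: emeasurable_funD; exact: mg.
move=> t; rewrite /= in_itv/= andbT => t0.
rewrite -EFinD lee_fin -mulrDl ler_wpM2r ?expR_ge0// subrr powRr0.
have [t1|t1] := leP t 1.
  rewrite -[leLHS]addr0 lerD ?powR_ge0//.
  have s10 : 0 <= s - 1 by lra.
  have := @ge0_ler_powR R (s - 1) s10 t 1; rewrite !nnegrE (ltW t0) ler01.
  by move=> /(_ isT isT t1); rewrite powR1.
rewrite -[leLHS]add0r lerD// ler_powR ?(ltW t1)//.
by rewrite -natr1; lra.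
Qed.

Lemma Gamma_gt0 s : 1 <= s -> 0 < Gamma s.
Proof.
move=> s1; rewrite Gamma_gamma_integral -lte_fin fineK ?gamma_integral_fin//.
have mI : measurable (`[1, 2]%classic : set (measurableTypeR R)) by exact: measurable_itv.
apply: (@lt_le_trans _ _ (\int[mu1]_(t in `[1%R, 2%R]) (expR (- 2))%:E)%E).
  rewrite integral_cst//= lebesgue_measure_itv/= lte_fin ltr1n -EFinB -EFinM lte_fin.
  by rewrite mulr_gt0 ?expR_gt0//; lra.
apply: (@le_trans _ _ (\int[mu1]_(t in `[1%R, 2%R]) (t `^ (s - 1) * expR (- t))%:E)%E).
  apply: ge0_le_integral => //.
  - by apply/measurable_EFinP; apply: measurable_funTS; exact: measurable_gamma_integrand.
  move=> t; rewrite /= in_itv/= => /andP[t1 t2].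
  rewrite lee_fin -[leLHS]mul1r ler_pM ?expR_ge0// ?ler_expR ?lerN2//.
  by rewrite -[leLHS](powRr0 t) ler_powR//; lra.
apply: ge0_subset_integral => //.
- by apply/measurable_EFinP; apply: measurable_funTS; exact: measurable_gamma_integrand.
- by move=> t _; rewrite lee_fin mulr_ge0 ?powR_ge0 ?expR_ge0.
- by move=> t; rewrite /= !in_itv/= andbT => /andP[t1 _]; exact: lt_le_trans t1.
Qed.

Lemma Gamma_rec s : 1 <= s -> Gamma (s + 1) = s * Gamma s.
Proof.
move=> s1; rewrite !Gamma_gamma_integral gamma_integral_rec//.
by rewrite fineM// gamma_integral_fin.
Qed.

End gamma_function.

(** * Moments of the weight *)

Section moments.
Context {R : realType} (lambda : R) (hlambda : -1 < lambda).
Local Notation mu1 := (@lebesgue_measure R).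
Local Notation w s := ((1 - s) `^ lambda).

(** The closed form of the integral of [|z|^(2k)], established in [dmu_integral_normcX]; it is the
    inverse square of the normalising factor of [basis]. *)
Definition moment k : R := k`!%:R * Gamma (lambda + 2) / Gamma (k%:R + lambda + 2).

Let l1 : 0 < lambda + 1. Proof. by move: hlambda; lra. Qed.

Lemma Gamma_lambda_gt0 k : 0 < Gamma (k%:R + lambda + 2).
Proof. by apply: Gamma_gt0; have := ler0n R k; move: hlambda; lra. Qed.

Lemma moment0 : moment 0 = 1.
Proof.
have := Gamma_lambda_gt0 0; rewrite /moment add0r => g0.
by rewrite fact0 mul1r mulfV// gt_eqF.
Qed.

Lemma momentS k : moment k.+1 = k.+1%:R / (k%:R + lambda + 2) * moment k.
Proof.
have k0 : 0 < k%:R + lambda + 2 by have := ler0n R k; move: hlambda; lra.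
have -> : moment k.+1 = k.+1%:R * k`!%:R * Gamma (lambda + 2) / Gamma (k%:R + lambda + 2 + 1).
  rewrite /moment factS natrM -natr1; congr (_ / Gamma _); ring.
rewrite Gamma_rec; last by have := ler0n R k; move: hlambda; lra.
rewrite /moment; field.
by rewrite !gt_eqF// Gamma_lambda_gt0.
Qed.

Lemma moment_gt0 k : 0 < moment k.
Proof.
elim: k => [|k IH]; first by rewrite moment0.
rewrite momentS mulr_gt0// divr_gt0 ?ltr0n//.
by have := ler0n R k; move: hlambda; lra.
Qed.

Lemma is_derive_powR1B (a x : R) : x < 1 ->
  is_derive x 1 (fun s => (1 - s) `^ a) (- (a * (1 - x) `^ (a - 1))).
Proof.
move=> x1; have x0 : 0 < 1 - x by lra.
have d1 : is_derive x 1 (fun s : R => 1 - s) (- 1).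
  by rewrite -[X in is_derive _ _ _ X]add0r; apply: is_deriveB.
have := @is_derive1_comp R (fun t => t `^ a) (fun s => 1 - s) x _ _ (is_derive1_powR a x0) d1.
by rewrite mulrN1.
Qed.

Let continuous_w (x : R) : x < 1 -> {for x, continuous (fun s : R => w s)}.
Proof.
move=> x1; apply/differentiable_continuous/derivable1_diffP.
by apply: ex_derive; exact: is_derive_powR1B.
Qed.

Let measurable_w : measurable_fun [set: R] (fun s : R => w s).
Proof.
apply: (measurableT_comp (@measurable_powR R lambda)).
by apply: measurable_funB; [exact: measurable_cst|exact: measurable_id].
Qed.

Let itv01_bigcup : `[0, 1[%classic = \bigcup_n `[0, 1 - n.+2%:R^-1]%classic :> set R.
Proof.
apply/seteqP; split => x /=; rewrite in_itv/=; last first.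
  move=> [n _]/=; rewrite in_itv/= => /andP[-> h].
  by rewrite (le_lt_trans h)// ltrBlDr ltrDl invr_gt0.
move=> /andP[x0 x1]; have d0 : 0 < 1 - x by lra.
exists (Num.trunc (1 - x)^-1) => //=; rewrite in_itv/= x0/=.
rewrite lerBrDr addrC -lerBrDr -[leRHS]invrK lef_pV2 ?posrE ?invr_gt0//.
by rewrite (le_trans (ltW (truncnS_gt _)))// ler_nat.
Qed.

Let cvg_tail : ((1 - (1 - n.+2%:R^-1)) `^ (lambda + 1) : R) @[n --> \oo] --> 0.
Proof.
have /cvg_at_rightP/(_ (fun n => n.+2%:R^-1)) h := @powR_cvg0 R _ l1.
under eq_fun do rewrite opprB addrC subrK.
apply: h; split; first by move=> n; rewrite invr_gt0.
exact: cvg_inv_succ2.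
Qed.

Let ha : {homo (fun _ : nat => 0 : R) : m n / (m <= n)%N >-> n <= m}.
Proof. by []. Qed.

Let hb : {homo (fun n => 1 - n.+2%:R^-1 : R) : m n / (m <= n)%N >-> m <= n}.
Proof. by move=> m n mn; rewrite lerD2l lerN2 lef_pV2 ?posrE// ler_nat. Qed.

Let hab (n : nat) : 0 < 1 - n.+2%:R^-1 :> R.
Proof. by rewrite subr_gt0 invf_lt1 ?ltr0n// ltr1n. Qed.

Lemma beta_integral0 : (\int[mu1]_(s in `[0%R, 1%R[) ((lambda + 1) * w s)%:E = 1)%E.
Proof.
have -> : 1%E = (\int[mu1]_(t in `[0%R, 1%R[) (0 : R)%:E + (1 : R)%:E)%E.
  by rewrite integral0_eq// add0e.
apply: (@integral_by_parts_improper _ _ _ (fun t => - ((1 - t) `^ (lambda + 1)))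
  (fun n => 0) (fun n => 1 - n.+2%:R^-1) _ _ hab ha hb itv01_bigcup).
- by apply: measurable_funM; [exact: measurable_cst|exact: measurable_w].
- exact: measurable_cst.
- by move=> x _; rewrite mulr_ge0 ?powR_ge0// ltW.
- by [].
- move=> x /=; rewrite in_itv/= => /andP[_ x1].
  rewrite subr0 -[X in is_derive _ _ _ X]opprK; apply: is_deriveN.
  by have := is_derive_powR1B (lambda + 1) x1; rewrite addrK.
- move=> x /=; rewrite in_itv/= => /andP[_ x1].
  by apply: cvgMr; exact: continuous_w.
- by move=> x _; exact: cvg_cst.
rewrite subr0 powR1.
have h : _ --> (- 0 + 1 : R) := cvgD (cvgN cvg_tail) (cvg_cst (1 : R)).
by rewrite oppr0 add0r in h; under eq_fun do rewrite opprK; exact: h.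
Qed.

(** The primitive is [t ^ k.+1 * (1 - t) ^ (lambda + 1)]. Writing [(1 - t) ^ (lambda + 1)] as
    [(1 - t) * w t] in its derivative collects the coefficient [k + lambda + 2]. The boundary term
    at 1 vanishes because [lambda + 1 > 0]. *)
Lemma beta_integral_rec k :
  (\int[mu1]_(s in `[0%R, 1%R[) (k.+1%:R * (s ^+ k * w s))%:E =
   \int[mu1]_(s in `[0%R, 1%R[) ((k%:R + lambda + 2) * (s ^+ k.+1 * w s))%:E)%E.
Proof.
have k0 : 0 <= k%:R + lambda + 2 by have := ler0n R k; move: hlambda; lra.
have mXw j : measurable_fun [set: R] (fun s : R => s ^+ j * w s).
  by apply: measurable_funM; [exact: exprn_measurable|exact: measurable_w].
have cXw (j : nat) (x : R) : x < 1 -> {for x, continuous (fun s : R => s ^+ j * w s)}.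
  by move=> x1; apply: cvgM; [exact: exprn_continuous|exact: continuous_w].
rewrite -[RHS]adde0.
apply: (@integral_by_parts_improper _ _ _ (fun t => t ^+ k.+1 * (1 - t) `^ (lambda + 1))
  (fun n => 0) (fun n => 1 - n.+2%:R^-1) _ _ hab ha hb itv01_bigcup).
- by apply: measurable_funM; [exact: measurable_cst|exact: mXw].
- by apply: measurable_funM; [exact: measurable_cst|exact: mXw].
- move=> x /=; rewrite in_itv/= => /andP[x0 _].
  by rewrite !mulr_ge0 ?powR_ge0 ?exprn_ge0.
- move=> x /=; rewrite in_itv/= => /andP[x0 _].
  by rewrite !mulr_ge0 ?powR_ge0 ?exprn_ge0.
- move=> x /=; rewrite in_itv/= => /andP[_ x1].
  have dw := is_derive_powR1B (lambda + 1) x1; rewrite addrK in dw.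
  have dX : is_derive x 1 (fun t : R => t ^+ k.+1) (k.+1%:R * x ^+ k).
    by have := is_deriveX k.+1 (is_derive_id x 1); rewrite exprfctE /GRing.scale/= mulr1.
  have := is_deriveM dX dw; congr (is_derive _ _ _ _).
  rewrite /GRing.scale/=.
  have <- : (1 - x) * w x = (1 - x) `^ (lambda + 1).
    by rewrite -[in LHS](addrK 1 lambda) mulr_powRB1//; lra.
  by rewrite exprS -natr1; ring.
- move=> x /=; rewrite in_itv/= => /andP[_ x1].
  by apply: cvgMr; exact: cXw.
- move=> x /=; rewrite in_itv/= => /andP[_ x1].
  by apply: cvgMr; exact: cXw.
under eq_fun do rewrite expr0n/= mul0r subr0.
apply: (@squeeze_cvgr _ _ _ _ (fun=> 0) (fun n => (1 - (1 - n.+2%:R^-1)) `^ (lambda + 1))).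
- near=> n; rewrite mulr_ge0 ?powR_ge0 ?exprn_ge0 ?(ltW (hab n))//=.
  rewrite ler_piMl ?powR_ge0//; apply: exprn_ile1; first exact: ltW (hab n).
  by rewrite gerBl invr_ge0.
- exact: cvg_cst.
- exact: cvg_tail.
Unshelve. all: by end_near. Qed.

Lemma beta_integral k :
  (\int[mu1]_(s in `[0%R, 1%R[) ((lambda + 1) * (s ^+ k * w s))%:E = (moment k)%:E)%E.
Proof.
have mI : measurable (`[0, 1[%classic : set (measurableTypeR R)) by exact: measurable_itv.
have Z (c : R) j : 0 <= c -> (\int[mu1]_(s in `[0%R, 1%R[) (c * (s ^+ j * w s))%:E =
    c%:E * \int[mu1]_(s in `[0%R, 1%R[) (s ^+ j * w s)%:E)%E.
  move=> c0; under eq_integral do rewrite EFinM.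
  rewrite ge0_integralZl//.
  - apply/measurable_EFinP; apply: measurable_funTS.
    by apply: measurable_funM; [exact: exprn_measurable|exact: measurable_w].
  - move=> x /=; rewrite in_itv/= => /andP[x0 _].
    by rewrite lee_fin mulr_ge0 ?powR_ge0 ?exprn_ge0.
elim: k => [|k IH].
  by rewrite moment0 -beta_integral0; apply: eq_integral => s _; rewrite expr0 mul1r.
have k0 : 0 < k%:R + lambda + 2 by have := ler0n R k; move: hlambda; lra.
have := beta_integral_rec k; move: IH; rewrite !Z ?ltW ?ltr0n//.
move: (\int[_]_(_ in _) _)%E (\int[_]_(_ in _) _)%E => B A hA hB.
have {}hB : B = ((k%:R + lambda + 2)^-1%:E * (k.+1%:R%:E * A))%E.
  by rewrite hB muleA -EFinM mulVf ?gt_eqF// mul1e.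
rewrite hB !muleA -EFinM momentS.
rewrite [X in (X * A)%E](_ : _ = (k.+1%:R / (k%:R + lambda + 2))%:E * (lambda + 1)%:E)%E.
  by rewrite -muleA hA -EFinM.
by rewrite -!EFinM; congr (_%:E); ring.
Qed.

Lemma dmu_integral_normcX k :
  dmu_integral lambda (fun z => (normc z ^+ 2) ^+ k) = (moment k)%:E.
Proof.
have piN : pi != 0 :> R by rewrite gt_eqF// pi_gt0.
(* The absolute value makes [g] nonnegative on the whole line, as [integral_radial] asks; it changes
   nothing at [s = |z|^2]. *)
pose g (s : R) : \bar R := (`|s| ^+ k * ((lambda + 1) / pi * w s))%:E.
transitivity (\int[mu1 \x mu1]_(p in @toC R @^-1` @unit_disk R) g (p.1 ^+ 2 + p.2 ^+ 2)%R)%E.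
  apply: eq_integral => p _; rewrite /g /weight ger0_norm ?addr_ge0 ?sqr_ge0//.
  by rewrite normcsqr.
rewrite (integral_radial (g := g)).
- rewrite -beta_integral -ge0_integralZl//.
  + apply: eq_integral => s; rewrite inE/= in_itv/= => /andP[s0 _].
    rewrite /g ger0_norm// -EFinM; congr (_%:E).
    move: pi piN (w s) (s ^+ k) => p p0 W S.
    by have -> : (lambda + 1) * (S * W) = (p / p) * ((lambda + 1) * (S * W));
      [rewrite mulfV// mul1r|ring].
  + apply/measurable_EFinP; apply: measurable_funTS; apply: measurable_funM.
      by apply: measurable_funX; exact: normr_measurable.
    by apply: measurable_funM; [exact: measurable_cst|exact: measurable_w].
  + by move=> x _; rewrite lee_fin !mulr_ge0 ?powR_ge0 ?invr_ge0 ?pi_ge0 ?(ltW l1)// exprn_ge0.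
  + by rewrite lee_fin pi_ge0.
- apply/measurable_EFinP; apply: measurable_funM.
    by apply: measurable_funX; exact: normr_measurable.
  by apply: measurable_funM; [exact: measurable_cst|exact: measurable_w].
- by move=> x; rewrite lee_fin !mulr_ge0 ?powR_ge0 ?invr_ge0 ?pi_ge0 ?(ltW l1)// exprn_ge0.
Qed.

End moments.

(** * The norm in terms of the coefficients *)

Section weighted_integral.
Context {R : realType} (lambda : R) (hlambda : -1 < lambda).
Local Notation D2 := (@toC R @^-1` @unit_disk R).
Local Notation dmu := (dmu_integral lambda).
Implicit Types (F G : R[i] -> R).

Definition disk_measurable F : Prop := measurable_fun D2 (fun p => F (toC p)).

Let l1 : 0 <= lambda + 1. Proof. by move: hlambda; lra. Qed.

Let mFw F : disk_measurable F ->
  measurable_fun D2 (fun p => (F (toC p) * weight lambda (toC p))%:E).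
Proof.
move=> mF; apply/measurable_EFinP.
by apply: measurable_funM => //; exact: measurable_weight.
Qed.

Let Fw0 F : (forall z, 0 <= F z) -> forall p, (0 <= (F (toC p) * weight lambda (toC p))%:E)%E.
Proof. by move=> F0 p; rewrite lee_fin mulr_ge0// weight_ge0. Qed.

Lemma dmu_ge0 F : (forall z, 0 <= F z) -> (0 <= dmu F)%E.
Proof. by move=> F0; apply: integral_ge0 => p _; exact: Fw0. Qed.

Lemma dmu_le F G : disk_measurable F -> disk_measurable G ->
  (forall z, 0 <= F z) -> (forall z, unit_disk z -> F z <= G z) -> (dmu F <= dmu G)%E.
Proof.
move=> mF mG F0 FG; apply: ge0_le_integral => //.
- exact: measurable_D2.
- by move=> p _; exact: Fw0.
- exact: mFw.
- exact: mFw.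
- by move=> p Dp; rewrite lee_fin ler_wpM2r ?weight_ge0// FG.
Qed.

Lemma dmuZ (c : R) F : 0 <= c -> disk_measurable F -> (forall z, 0 <= F z) ->
  dmu (fun z => c * F z) = (c%:E * dmu F)%E.
Proof.
move=> c0 mF F0; rewrite /dmu_integral -ge0_integralZl//.
- by apply: eq_integral => p _; rewrite -EFinM -[in LHS]mulrA.
- exact: measurable_D2.
- exact: mFw.
- by move=> p _; exact: Fw0.
Qed.

Lemma dmu_sum n (F : nat -> R[i] -> R) : (forall i, disk_measurable (F i)) ->
  (forall i z, 0 <= F i z) ->
  dmu (fun z => \sum_(i < n) F i z) = (\sum_(i < n) dmu (F i))%E.
Proof.
move=> mF F0; rewrite -(big_mkord xpredT (fun i => dmu (F i))) -ge0_integral_sum//.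
- apply: eq_integral => p _; rewrite big_mkord mulr_suml.
  by rewrite -sumEFin.
- exact: measurable_D2.
- by move=> i; exact: mFw.
- by move=> i p _; exact: Fw0.
Qed.

(** Fatou's lemma, in the form used for both halves of the norm formula. *)
Lemma dmu_lim_le (F : nat -> R[i] -> R) G (B : \bar R) :
  (forall n, disk_measurable (F n)) -> (forall n z, 0 <= F n z) ->
  (forall z, unit_disk z -> F n z @[n --> \oo] --> G z) ->
  (forall n, dmu (F n) <= B)%E -> (dmu G <= B)%E.
Proof.
move=> mF F0 FG FB.
have := fatou (lebesgue_measure \x lebesgue_measure)%E (@measurable_D2 R)
  (fun n => mFw (mF n)) (fun n p _ => Fw0 (F0 n) p).
set L := (X in (X <= _)%E -> _); have -> : L = dmu G.
  apply: eq_integral => p; rewrite inE => Dp.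
  have h : (F n (toC p) * weight lambda (toC p))%:E @[n --> \oo] -->
      (G (toC p) * weight lambda (toC p))%:E.
    apply: cvg_EFin; first by near=> n.
    by apply: cvgMl; exact: FG.
  by have [-> _] := cvg_limn_einf_sup h.
move=> /le_trans; apply; rewrite limn_einf_lim; apply: lime_le; first exact: is_cvg_einfs.
near=> n; apply: le_trans (FB n); apply: ereal_inf_lbound; exists n => //=.
Unshelve. all: by end_near. Qed.

Lemma toC_rot_disk w p : normc w = 1 -> D2 p -> D2 (rot w p).
Proof. by move=> w1; rewrite /preimage/= toC_rot !unit_diskE normcM w1 mul1r. Qed.

Lemma disk_measurable_rot w F : normc w = 1 -> disk_measurable F ->
  disk_measurable (fun z => F (w * z)).
Proof.
move=> w1 mF; have [mr _] := mu2_preserving_rot w1.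
rewrite /disk_measurable [X in measurable_fun _ X](_ : _ = (fun p => F (toC p)) \o rot w); last first.
  by apply/funext => p /=; rewrite toC_rot.
apply: (measurable_comp (F := D2)) => //.
- exact: measurable_D2.
- by move=> _ [p Dp <-]; exact: toC_rot_disk.
- exact: measurable_funTS mr.
Qed.

Lemma dmu_rot w F : normc w = 1 -> disk_measurable F -> (forall z, 0 <= F z) ->
  dmu (fun z => F (w * z)) = dmu F.
Proof.
move=> w1 mF F0; rewrite /dmu_integral.
rewrite -(integral_rot (G := fun p => (F (toC p) * weight lambda (toC p))%:E) w1).
- by apply: eq_integral => p _; rewrite /weight toC_rot normcM w1 mul1r.
- exact: mFw.
- exact: Fw0.
Qed.

End weighted_integral.

Section complex_measurable.
Context {R : realType}.
Local Notation D2 := (@toC R @^-1` @unit_disk R).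
Implicit Types (f g : R[i] -> R[i]).

Definition disk_cmeasurable f : Prop :=
  disk_measurable (fun z => complex.Re (f z)) /\ disk_measurable (fun z => complex.Im (f z)).

Lemma disk_cmeasurableD f g : disk_cmeasurable f -> disk_cmeasurable g ->
  disk_cmeasurable (fun z => f z + g z).
Proof.
move=> [fR fI] [gR gI]; split; rewrite /disk_measurable.
- have -> : (fun p => complex.Re (f (toC p) + g (toC p))) =
    (fun p => complex.Re (f (toC p)) + complex.Re (g (toC p))).
    by apply/funext => p; case: (f _) (g _) => [? ?] [? ?].
  exact: measurable_funD.
- have -> : (fun p => complex.Im (f (toC p) + g (toC p))) =
    (fun p => complex.Im (f (toC p)) + complex.Im (g (toC p))).
    by apply/funext => p; case: (f _) (g _) => [? ?] [? ?].
  exact: measurable_funD.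
Qed.

Lemma disk_cmeasurableM f g : disk_cmeasurable f -> disk_cmeasurable g ->
  disk_cmeasurable (fun z => f z * g z).
Proof.
move=> [fR fI] [gR gI]; split; rewrite /disk_measurable.
- have -> : (fun p => complex.Re (f (toC p) * g (toC p))) =
    (fun p => complex.Re (f (toC p)) * complex.Re (g (toC p)) -
      complex.Im (f (toC p)) * complex.Im (g (toC p))).
    by apply/funext => p; case: (f _) (g _) => [? ?] [? ?].
  by apply: measurable_funB; apply: measurable_funM.
- have -> : (fun p => complex.Im (f (toC p) * g (toC p))) =
    (fun p => complex.Re (f (toC p)) * complex.Im (g (toC p)) +
      complex.Im (f (toC p)) * complex.Re (g (toC p))).
    by apply/funext => p; case: (f _) (g _) => [? ?] [? ?].
  by apply: measurable_funD; apply: measurable_funM.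
Qed.

Lemma disk_cmeasurable_cst c : disk_cmeasurable (fun=> c).
Proof. by split; exact: measurable_cst. Qed.

Lemma disk_cmeasurableX n : disk_cmeasurable (fun z => z ^+ n).
Proof.
elim: n => [|n IH]; first exact: disk_cmeasurable_cst.
under eq_fun do rewrite exprS.
apply: disk_cmeasurableM => //; split; apply: measurable_funTS.
  exact: measurable_fst.
exact: measurable_snd.
Qed.

Lemma disk_cmeasurable_sum n (f : nat -> R[i] -> R[i]) :
  (forall i, disk_cmeasurable (f i)) -> disk_cmeasurable (fun z => \sum_(0 <= i < n) f i z).
Proof.
move=> mf; elim: n => [|n IH].
  by under eq_fun do rewrite big_geq//; exact: disk_cmeasurable_cst.
under eq_fun do rewrite big_nat_recr//=.
exact: disk_cmeasurableD.
Qed.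

Lemma disk_measurable_sqr f : disk_cmeasurable f ->
  disk_measurable (fun z => normc (f z) ^+ 2).
Proof.
move=> [fR fI]; rewrite /disk_measurable; under eq_fun do rewrite normcsqr.
by apply: measurable_funD; apply: measurable_funX.
Qed.

Lemma Re_cvg (u : nat -> R[i]) (l : R[i]) : (u n : C R) @[n --> \oo] --> (l : C R) ->
  complex.Re (u n) @[n --> \oo] --> complex.Re l.
Proof.
move=> /cvgC_normc/cvgrPdist_le h; apply/cvgrPdist_le => e e0.
have := h e e0; apply: filterS => n; rewrite sub0r normrN ger0_norm ?normc_ge0//.
apply: le_trans; rewrite distrC; apply: le_trans (Re_le_normc _).
by case: (u n) (l) => [? ?] [? ?].
Qed.

Lemma Im_cvg (u : nat -> R[i]) (l : R[i]) : (u n : C R) @[n --> \oo] --> (l : C R) ->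
  complex.Im (u n) @[n --> \oo] --> complex.Im l.
Proof.
move=> /cvgC_normc/cvgrPdist_le h; apply/cvgrPdist_le => e e0.
have := h e e0; apply: filterS => n; rewrite sub0r normrN ger0_norm ?normc_ge0//.
apply: le_trans; rewrite distrC; apply: le_trans (Im_le_normc _).
by case: (u n) (l) => [? ?] [? ?].
Qed.

Lemma disk_cmeasurable_psum (b : nat -> R[i]) f :
  (forall z, normc z < 1 -> psum b z (f z)) -> disk_cmeasurable f.
Proof.
move=> bf; have mP n : disk_cmeasurable (fun z => \sum_(0 <= k < n) b k * z ^+ k).
  apply: (@disk_cmeasurable_sum n (fun k z => b k * z ^+ k)) => k.
  apply: disk_cmeasurableM; first exact: disk_cmeasurable_cst.
  exact: disk_cmeasurableX.
split.
- apply: (@measurable_fun_cvg _ _ _ _ (fun n p => complex.Re (\sum_(0 <= k < n) b k * toC p ^+ k))).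
    by move=> n; have [] := mP n.
  by move=> p /=; rewrite unit_diskE => /bf/Re_cvg.
- apply: (@measurable_fun_cvg _ _ _ _ (fun n p => complex.Im (\sum_(0 <= k < n) b k * toC p ^+ k))).
    by move=> n; have [] := mP n.
  by move=> p /=; rewrite unit_diskE => /bf/Im_cvg.
Qed.

End complex_measurable.

Lemma sume_const (R : realType) (x : \bar R) n : (0 <= x)%E ->
  (\sum_(i < n) x = n%:R%:E * x)%E.
Proof.
move=> x0; elim: n => [|n IH]; first by rewrite big_ord0 mul0e.
by rewrite big_ord_recr/= IH -natr1 EFinD ge0_muleDl ?lee_fin// mul1e.
Qed.

(** * The two inequalities of the norm formula *)

Section norm_formula.
Context {R : realType} (lambda : R) (hlambda : -1 < lambda).
Local Notation dmu := (dmu_integral lambda).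
Local Notation m := (moment lambda).
Implicit Types (b : nat -> R[i]) (f : R[i] -> R[i]) (B : R).

Lemma disk_measurable_sum n (F : nat -> R[i] -> R) :
  (forall i, disk_measurable (F i)) -> disk_measurable (fun z => \sum_(i < n) F i z).
Proof. by move=> mF; apply: measurable_sum => i; exact: mF. Qed.

Let monomial_ge0 b k z : 0 <= normc (b k) ^+ 2 * (normc z ^+ 2) ^+ k.
Proof. by rewrite mulr_ge0 ?sqr_ge0// exprn_ge0// sqr_ge0. Qed.

Let measurable_monomial b k :
  disk_measurable (fun z => normc (b k) ^+ 2 * (normc z ^+ 2) ^+ k).
Proof.
apply: measurable_funM; first exact: measurable_cst.
apply: measurable_funX; apply: (@disk_measurable_sqr _ id).
by have := @disk_cmeasurableX R 1.
Qed.

Lemma dmu_sum_monomials b n :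
  dmu (fun z => \sum_(k < n) normc (b k) ^+ 2 * (normc z ^+ 2) ^+ k) =
  (\sum_(k < n) normc (b k) ^+ 2 * m k)%:E.
Proof.
rewrite (dmu_sum hlambda n (measurable_monomial b) (monomial_ge0 b)).
rewrite -sumEFin; apply: eq_bigr => k _.
rewrite (dmuZ hlambda) ?sqr_ge0//.
- by rewrite dmu_integral_normcX.
- apply: measurable_funX; apply: (@disk_measurable_sqr _ id).
  by have := @disk_cmeasurableX R 1.
- by move=> z; rewrite exprn_ge0// sqr_ge0.
Qed.

Lemma dmu_rot_mean f N w : (0 < N)%N -> normc w = 1 -> disk_cmeasurable f ->
  dmu (fun z => N%:R^-1 * \sum_(i < N) normc (f (w ^+ i * z)) ^+ 2) =
  dmu (fun z => normc (f z) ^+ 2).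
Proof.
move=> N0 w1 mf; have wi i : normc (w ^+ i) = 1 by rewrite normcX w1 expr1n.
have mF i : disk_measurable (fun z => normc (f (w ^+ i * z)) ^+ 2).
  exact: (disk_measurable_rot (F := fun z => normc (f z) ^+ 2) (wi i) (disk_measurable_sqr mf)).
rewrite (dmuZ hlambda) ?invr_ge0//; first last.
- by move=> z; apply: sumr_ge0 => i _; rewrite sqr_ge0.
- exact: (@disk_measurable_sum N (fun i z => normc (f (w ^+ i * z)) ^+ 2) mF).
rewrite (dmu_sum hlambda N (F := fun i z => normc (f (w ^+ i * z)) ^+ 2) mF); last first.
  by move=> i z; rewrite sqr_ge0.
rewrite (eq_bigr (fun=> dmu (fun z => normc (f z) ^+ 2))); last first.
  move=> i _; apply: (dmu_rot hlambda (F := fun z => normc (f z) ^+ 2) (wi i)).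
    exact: disk_measurable_sqr.
  by move=> z; rewrite sqr_ge0.
rewrite sume_const; last by apply: dmu_ge0 => // z; rewrite sqr_ge0.
rewrite muleA -EFinM mulVf ?mul1e//.
by rewrite pnatr_eq0 -lt0n.
Qed.

(** Averaging over the roots of unity leaves the integral unchanged and makes the integrand radial.
    There are as many terms as the order of the root, so the cross terms disappear exactly. *)
Lemma dmu_partial_sum b p :
  dmu (fun z => normc (\sum_(0 <= k < 2 ^ p.+1) b k * z ^+ k) ^+ 2) =
  (\sum_(k < 2 ^ p.+1) normc (b k) ^+ 2 * m k)%:E.
Proof.
set N := (2 ^ p.+1)%N; have N0 : (0 < N)%N by rewrite expn_gt0.
have [w [w1 wN]] := @primitive_root_pow2 R p.
have mP : disk_cmeasurable (fun z => \sum_(0 <= k < N) b k * z ^+ k).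
  apply: (@disk_cmeasurable_sum _ N (fun k z => b k * z ^+ k)) => k.
  apply: disk_cmeasurableM; first exact: disk_cmeasurable_cst.
  exact: disk_cmeasurableX.
rewrite -(dmu_rot_mean N0 w1 mP) -dmu_sum_monomials; congr (dmu _).
apply/funext => z.
rewrite [X in _ * X](_ : _ = N%:R * \sum_(k < N) normc (b k) ^+ 2 * (normc z ^+ 2) ^+ k).
  by rewrite mulrA mulVf ?mul1r// pnatr_eq0 -lt0n.
transitivity (N%:R * \sum_(k < N) normc (b k * z ^+ k) ^+ 2).
  rewrite -(discrete_parseval (fun k => b k * z ^+ k) w1 wN).
  apply: eq_bigr => i _; rewrite big_mkord; congr (normc _ ^+ 2).
  by apply: eq_bigr => k _; rewrite exprMn; ring.
by congr (_ * _); apply: eq_bigr => k _; rewrite normcM normcX exprMn exprAC.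
Qed.

Lemma cvg_pow2 : (2 ^ p.+1)%N @[p --> \oo] --> \oo.
Proof.
move=> A [n _ nA]; exists n => // p np; apply: nA.
by rewrite /= (leq_trans np)// (leq_trans (leqnSn p))// ltnW// ltn_expl.
Qed.

Lemma dmu_sqr_le b f B : (forall z, normc z < 1 -> psum b z (f z)) ->
  (forall n, \sum_(k < n) normc (b k) ^+ 2 * m k <= B) ->
  (dmu (fun z => (normc (f z) ^+ 2)%R) <= B%:E)%E.
Proof.
move=> bf bB.
apply: (dmu_lim_le hlambda (F := fun p z => normc (\sum_(0 <= k < 2 ^ p.+1) b k * z ^+ k) ^+ 2)).
- move=> p; apply: disk_measurable_sqr.
  apply: (@disk_cmeasurable_sum _ _ (fun k z => b k * z ^+ k)) => k.
  apply: disk_cmeasurableM; first exact: disk_cmeasurable_cst.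
  exact: disk_cmeasurableX.
- by move=> p z; rewrite sqr_ge0.
- move=> z; rewrite unit_diskE => z1.
  have h : normc (series (fun k => b k * z ^+ k : C R) n) ^+ 2 @[n --> \oo] --> normc (f z) ^+ 2.
    by rewrite expr2; under eq_fun do rewrite expr2; apply: cvgM; apply: cvg_normc; exact: bf.
  exact: (cvg_comp _ _ cvg_pow2 h).
- by move=> p; rewrite dmu_partial_sum lee_fin.
Qed.

(* On each circle the mean of [|f|^2] over the [N]-th roots of unity tends to at
   least [\sum_(k < K) |b_k|^2 |z|^(2k)] as [N] grows, while by rotation
   invariance its integral is that of [|f|^2]. *)
Lemma dmu_sqr_ge b f K : (forall z, normc z < 1 -> psum b z (f z)) ->
  ((\sum_(k < K) normc (b k) ^+ 2 * m k)%R%:E <= dmu (fun z => (normc (f z) ^+ 2)%R))%E.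
Proof.
move=> bf; have mf := disk_cmeasurable_psum bf.
rewrite -dmu_sum_monomials.
set S := (fun z : R[i] => \sum_(k < K) normc (b k) ^+ 2 * (normc z ^+ 2) ^+ k).
have S0 z : 0 <= S z by apply: sumr_ge0 => k _; exact: monomial_ge0.
have mS : disk_measurable S.
  exact: (@disk_measurable_sum K _ (measurable_monomial b)).
pose N p := (2 ^ p.+1)%N; have N0 p : (0 < N p)%N by rewrite expn_gt0.
have /all_sig[w hw] := fun p => cid (@primitive_root_pow2 R p).
have w1 p : normc (w p) = 1 by have [] := hw p.
have wi p i : normc (w p ^+ i) = 1 by rewrite normcX w1 expr1n.
pose F p z := (N p)%:R^-1 * \sum_(i < N p) normc (f (w p ^+ i * z)) ^+ 2.
have mF p : disk_measurable (F p).
  apply: measurable_funM; first exact: measurable_cst.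
  apply: (@disk_measurable_sum (N p) (fun i z => normc (f (w p ^+ i * z)) ^+ 2)) => i.
  exact: (disk_measurable_rot (F := fun z => normc (f z) ^+ 2) (wi p i) (disk_measurable_sqr mf)).
have F0 p z : 0 <= F p z.
  by rewrite mulr_ge0 ?invr_ge0//; apply: sumr_ge0 => i _; rewrite sqr_ge0.
have mmin p : disk_measurable (fun z => Num.min (F p z) (S z)).
  by apply: (@measurable_minr _ _ _ _ (fun q => F p (toC q)) (fun q => S (toC q)));
    [exact: mF|exact: mS].
(* Only a lower bound for the means is proved. Capping them by [S] turns it into convergence to [S],
   and the capped means still integrate to at most the integral of [|f|^2]. *)
apply: (dmu_lim_le hlambda (F := fun p z => Num.min (F p z) (S z))) => //.
- by move=> p z; rewrite le_min F0 S0.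
- move=> z; rewrite unit_diskE => z1.
  have z0 := normc_ge0 z.
  have bz : asum b (normc z).
    pose t := (normc z + 1) / 2.
    have ht : normc t%:C%C = t by rewrite normc_real ger0_norm// /t; lra.
    apply: (@psum_asum _ _ t%:C%C (f t%:C%C)); first by apply: bf; rewrite ht /t; lra.
    by rewrite ht /t; apply/andP; split; lra.
  set s := series (fun n => normc (b n) * normc z ^+ n).
  have s0 n : 0 <= normc (b n) * normc z ^+ n by rewrite mulr_ge0 ?exprn_ge0 ?normc_ge0.
  pose B := limn s.
  have B0 : 0 <= B by apply: (le_trans _ (le_lim_series 0 s0 bz)); rewrite /series/= big_geq.
  (* At each rotated point the partial sum [P] and the value [f'] have moduli at most [B] and differ
     by at most the tail [B - s (N p)], so [|P|^2 - |f'|^2 <= 2 * B * (B - s (N p))]. The mean of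
     [|P|^2] is computed by [discrete_parseval]. *)
  have lower p : (K <= N p)%N -> S z - 2 * B * (B - s (N p)) <= F p z.
    move=> KN; have [_ wN] := hw p.
    have -> : S z - 2 * B * (B - s (N p)) = (N p)%:R^-1 * ((N p)%:R * (S z - 2 * B * (B - s (N p)))).
      by rewrite mulrA mulVf ?mul1r// pnatr_eq0 -lt0n.
    rewrite ler_wpM2l ?invr_ge0//.
    apply: (@le_trans _ _ (\sum_(i < N p) (normc (\sum_(k < N p) (b k * z ^+ k) * (w p ^+ i) ^+ k) ^+ 2
       - 2 * B * (B - s (N p))))).
      rewrite sumrB (discrete_parseval (fun k => b k * z ^+ k) (w1 p) wN).
      rewrite sumr_const card_ord -[X in _ <= _ - X]mulr_natl -mulrBr ler_wpM2l//.
      rewrite lerB// /S.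
      rewrite -(big_mkord xpredT (fun k => normc (b k) ^+ 2 * (normc z ^+ 2) ^+ k)).
      rewrite -(big_mkord xpredT (fun k => normc (b k * z ^+ k) ^+ 2)).
      rewrite [X in _ <= X](big_cat_nat (n := K))//= -[leLHS]addr0 lerD//.
        by apply: ler_sum => k _; rewrite normcM normcX [leRHS]exprMn exprAC.
      by apply: sumr_ge0 => k _; rewrite sqr_ge0.
    apply: ler_sum => i _.
    have hz : normc (w p ^+ i * z) = normc z by rewrite normcM wi mul1r.
    have hf : psum b (w p ^+ i * z) (f (w p ^+ i * z)) by apply: bf; rewrite hz.
    have hz' : normc (w p ^+ i * z) <= normc z by rewrite hz.
    have PE : \sum_(k < N p) (b k * z ^+ k) * (w p ^+ i) ^+ k =
        \sum_(0 <= k < N p) b k * (w p ^+ i * z) ^+ k.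
      by rewrite big_mkord; apply: eq_bigr => k _; rewrite exprMn; ring.
    rewrite PE.
    have tail := psum_tail (N p) hz' bz hf.
    have P_le : normc (\sum_(0 <= k < N p) b k * (w p ^+ i * z) ^+ k) <= B.
      apply: le_trans (le_lim_series (N p) s0 bz).
      apply: le_trans (normc_sum _ _ _) _; apply: ler_sum => k _.
      by rewrite normcM normcX hz.
    have f_le : normc (f (w p ^+ i * z)) <= B.
      have := psum_tail 0 hz' bz hf.
      by rewrite /series/= !big_geq// !subr0.
    move: tail P_le f_le.
    set P := (\sum_(0 <= k < N p) _); set f' := f _; rewrite -/s -/B => tail P_le f_le.
    have := ler_dist_normc f' P => /le_trans/(_ tail) => hd.
    have hd' : normc P - normc f' <= B - s (N p).
      by apply: le_trans hd; rewrite distrC ler_norm.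
    have f0 := normc_ge0 f'; have P0 := normc_ge0 P.
    have d0 : 0 <= B - s (N p) by apply: le_trans hd; rewrite normr_ge0.
    move: (normc P) (normc f') (B - s (N p)) P_le f_le hd' f0 P0 d0 => x y d xB yB xyd y0 x0 d0.
    nra.
  have SF : S z - 2 * B * (B - s (N p)) @[p --> \oo] --> S z.
    rewrite -[X in _ --> X]subr0; apply: cvgB; first exact: cvg_cst.
    rewrite -[X in _ --> X](mulr0 (2 * B)); apply: cvgMr.
    exact: (cvg_comp _ _ cvg_pow2 (asum_tail_cvg bz)).
  apply: (@squeeze_cvgr _ _ _ _ (fun p => S z - 2 * B * (B - s (N p))) (fun=> S z)) => //.
    near=> p; rewrite ge_min lexx orbT andbT le_min.
    apply/andP; split.
      apply: lower; near: p.
      have [M _ hM] := cvg_pow2 (nbhs_infty_ge K).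
      by exists M.
    rewrite gerBl mulr_ge0 ?mulr_ge0// subr_ge0.
    exact: le_lim_series.
  exact: cvg_cst.
- move=> p; rewrite -(dmu_rot_mean (N0 p) (w1 p) mf).
  apply: (dmu_le hlambda (mmin p) (mF p)) => z; first by rewrite le_min F0 S0.
  by move=> _; rewrite ge_min lexx.
Unshelve. all: by end_near. Qed.

End norm_formula.

(** * Coordinates in the Bergman space *)

Section bergman_coordinates.
Context {R : realType} (lambda : R) (hlambda : -1 < lambda).
Local Notation H := (bergman lambda).
Local Notation dmu := (dmu_integral lambda).
Local Notation m := (moment lambda).
Implicit Types (f g : H) (b a : nat -> R[i]).

Let m0 k : 0 < m k. Proof. exact: moment_gt0. Qed.

Lemma bergmanP f : [/\ analytic_on (@unit_disk R) f, in_L2 lambda f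
  & forall z, ~ unit_disk z -> f z = 0].
Proof. by case: f => f /=; rewrite inE. Qed.

Lemma mem_bergman b (F : R[i] -> R[i]) (B : R) :
  (forall z, normc z < 1 -> psum b z (F z)) -> (forall z, ~ unit_disk z -> F z = 0) ->
  (forall n, \sum_(k < n) normc (b k) ^+ 2 * m k <= B) -> F \in bergman_pred lambda.
Proof.
move=> bF F0 bB; rewrite inE; split => //; first exact: analytic_psum bF.
have [mR mI] := disk_cmeasurable_psum bF; split => //.
exact: le_lt_trans (dmu_sqr_le hlambda bF bB) (ltry _).
Qed.

Definition coef f : nat -> R[i] :=
  projT1 (cid (analytic_disk_psum (let: And3 h _ _ := bergmanP f in h))).

Lemma coefP f z : normc z < 1 -> psum (coef f) z (f z).
Proof. by rewrite /coef; case: cid => b /= h; exact: h. Qed.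

Lemma coef_unique b f : (forall z, normc z < 1 -> psum b z (f z)) -> coef f = b.
Proof. by move=> bf; apply: (psum_inj (f := f) ltr01) => // z; exact: coefP. Qed.

Lemma bergman_funZD (c : R[i]) f g z : (c *: f + g) z = c * f z + g z.
Proof. by []. Qed.

Lemma psumZD (c : R[i]) b b' z l l' : psum b z l -> psum b' z l' ->
  psum (fun k => c * b k + b' k) z (c * l + l').
Proof.
move=> bl bl'; rewrite /psum.
have -> : series (fun k => (c * b k + b' k) * z ^+ k : C R) =
   (fun n => (c : C R) * series (fun k => b k * z ^+ k : C R) n + series (fun k => b' k * z ^+ k : C R) n).
  apply/funext => n; rewrite /series/= mulr_sumr -big_split/=.
  by apply: eq_bigr => k _; rewrite mulrDl mulrA.
by apply: cvgD; [apply: cvgMr; exact: bl|exact: bl'].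
Qed.

Lemma coefZD (c : R[i]) f g : coef (c *: f + g) = fun k => c * coef f k + coef g k.
Proof.
apply: coef_unique => z z1; rewrite bergman_funZD.
by apply: psumZD; exact: coefP.
Qed.

Lemma coef_inj f g : coef f = coef g -> f = g.
Proof.
move=> fg; apply: val_inj; apply/funext => z; rewrite -[LHS]/(f z) -[RHS]/(g z).
have [z1|z1] := ltP (normc z) 1.
  have gz : psum (coef f) z (g z) by rewrite fg; exact: coefP.
  exact: psum_unique (coefP z1) gz.
have [_ _ f0] := bergmanP f; have [_ _ g0] := bergmanP g.
have nz : ~ unit_disk z by rewrite unit_diskE; apply/negP; rewrite -leNgt.
by rewrite (f0 z nz) (g0 z nz).
Qed.

(* The coordinates in the orthonormal basis, see [dot_basis]. *)
Definition coord f k : R[i] := coef f k * (Num.sqrt (m k))%:C%C.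

Lemma sqr_normc_coord f k : normc (coord f k) ^+ 2 = normc (coef f k) ^+ 2 * m k.
Proof.
rewrite normcM normc_real ger0_norm ?sqrtr_ge0// exprMn sqr_sqrtr// ltW//.
Qed.

Lemma coordZD (c : R[i]) f g k : coord (c *: f + g) k = c * coord f k + coord g k.
Proof. by rewrite /coord coefZD mulrDl mulrA. Qed.

Lemma sqrt_moment_neq0 k : (Num.sqrt (m k))%:C%C != 0 :> R[i].
Proof. by rewrite (inj_eq (@complexI R)) gt_eqF// sqrtr_gt0. Qed.

Lemma coord_inj f g : coord f = coord g -> f = g.
Proof.
move=> fg; apply: coef_inj; apply/funext => k.
by apply: (mulIf (sqrt_moment_neq0 k)); exact: (congr1 (fun h => h k) fg).
Qed.

Lemma dmu_sqr_fin f : dmu (fun z => normc (f z) ^+ 2) \is a fin_num.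
Proof.
have [_ [_ _ h] _] := bergmanP f.
by rewrite ge0_fin_numE// dmu_ge0// => z; rewrite sqr_ge0.
Qed.

Lemma bnorm_sqr f : bnorm f ^+ 2 = fine (dmu (fun z => normc (f z) ^+ 2)).
Proof.
have E : dmu (fun z => complex.Re (f z * conjc (f z))) = dmu (fun z => normc (f z) ^+ 2).
  by congr (dmu _); apply/funext => z; rewrite -sqr_normc.
rewrite /bnorm /dot /= E sqr_sqrtr// fine_ge0// dmu_ge0// => z.
by rewrite sqr_ge0.
Qed.

Lemma bnorm_ge0 f : 0 <= bnorm f.
Proof. exact: sqrtr_ge0. Qed.

Lemma bessel f n : \sum_(k < n) normc (coord f k) ^+ 2 <= bnorm f ^+ 2.
Proof.
rewrite bnorm_sqr -lee_fin fineK ?dmu_sqr_fin//.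
under eq_bigr do rewrite sqr_normc_coord.
by apply: dmu_sqr_ge => // z; exact: coefP.
Qed.

Lemma bnorm_sqr_le f (B : R) :
  (forall n, \sum_(k < n) normc (coord f k) ^+ 2 <= B) -> bnorm f ^+ 2 <= B.
Proof.
move=> fB; rewrite bnorm_sqr -lee_fin fineK ?dmu_sqr_fin//.
apply: (dmu_sqr_le hlambda (b := coef f)) => [z|n]; first exact: coefP.
by under eq_bigr do rewrite -sqr_normc_coord; exact: fB.
Qed.

Lemma parseval f :
  series (fun k => normc (coord f k) ^+ 2) n @[n --> \oo] --> bnorm f ^+ 2.
Proof.
set s := series _.
have ns : nondecreasing_seq s.
  by apply/nondecreasing_seqP => n; rewrite /s seriesSr lerDl sqr_ge0.
have sB n : s n <= bnorm f ^+ 2 by rewrite /s /series/= big_mkord; exact: bessel.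
have cs : cvgn s by apply: nondecreasing_is_cvgn => //; exists (bnorm f ^+ 2) => _ [n _ <-].
suff -> : bnorm f ^+ 2 = limn s by [].
apply/eqP; rewrite eq_le; apply/andP; split.
  apply: bnorm_sqr_le => n; rewrite -(big_mkord xpredT (fun k => normc (coord f k) ^+ 2)).
  exact: (nondecreasing_cvgn_le ns cs n).
by apply: limr_le => //; near=> n.
Unshelve. all: by end_near. Qed.

(** Polarisation under the integral sign; integrability of [|f + g|^2] and [|f - g|^2] allows the
    integral to be split. It carries [parseval] over to the inner product, the imaginary part being
    obtained by multiplying [f] by [-i]. *)
Lemma Re_dot f g : complex.Re (dot f g) = (bnorm (f + g) ^+ 2 - bnorm (f - g) ^+ 2) / 4.
Proof.
rewrite !bnorm_sqr /dot/=.
pose A h (p : measurableTypeR R * measurableTypeR R) : R :=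
  normc ((h : H) (toC p)) ^+ 2 * weight lambda (toC p).
have l10 : 0 <= lambda + 1 by move: hlambda; lra.
have A0 h p : 0 <= A h p by rewrite mulr_ge0 ?sqr_ge0// weight_ge0.
have iA h : (lebesgue_measure \x lebesgue_measure)%E.-integrable (@toC R @^-1` @unit_disk R) (EFin \o A h).
  apply/integrableP; split.
    apply/measurable_EFinP; apply: measurable_funM; last exact: measurable_weight.
    exact: (disk_measurable_sqr (disk_cmeasurable_psum (@coefP h))).
  under eq_integral do rewrite gee0_abs ?lee_fin//.
  by have := dmu_sqr_fin h; rewrite ge0_fin_numE// dmu_ge0// => z; rewrite sqr_ge0.
have E : dmu (fun z => complex.Re (f z * conjc (g z))) =
    ((4^-1)%R%:E * (dmu (fun z => normc ((f + g)%R z) ^+ 2)%R - dmu (fun z => normc ((f - g)%R z) ^+ 2)%R))%E.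
  have mD := @measurable_D2 R.
  transitivity (\int[lebesgue_measure \x lebesgue_measure]_(p in @toC R @^-1` @unit_disk R)
      ((4^-1)%R%:E * ((EFin \o A (f + g)%R) p - (EFin \o A (f - g)%R) p)))%E.
    apply: eq_integral => p _.
    rewrite -[(EFin \o A (f + g)) p]/((normc (f (toC p) + g (toC p)) ^+ 2 * weight lambda (toC p))%:E).
    rewrite -[(EFin \o A (f - g)) p]/((normc (f (toC p) - g (toC p)) ^+ 2 * weight lambda (toC p))%:E).
    rewrite -EFinB -EFinM; congr (_%:E); rewrite -mulrBl [RHS]mulrA; congr (_ * _).
    by rewrite !normcsqr; case: (f _) (g _) => [x y] [x' y'] /=; field.
  rewrite integralZl//; last exact: integrableB.
  by rewrite integralB.
have h1 := dmu_sqr_fin (f + g); have h2 := dmu_sqr_fin (f - g).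
by rewrite E -{1}(fineK h1) -{1}(fineK h2) -EFinB -EFinM [RHS]mulrC.
Qed.

Lemma Im_dot f g : complex.Im (dot f g) = complex.Re (dot ((- 'i%C) *: f) g).
Proof.
rewrite -[LHS]/(fine (dmu (fun z => complex.Im (f z * conjc (g z))))).
rewrite -[RHS]/(fine (dmu (fun z => complex.Re ((- 'i%C * f z) * conjc (g z))))).
congr (fine (dmu _)); apply/funext => z.
by case: (f z) (g z) => [x y] [x' y'] /=; ring.
Qed.

Lemma coordD f g k : coord (f + g) k = coord f k + coord g k.
Proof. by have := coordZD 1 f g k; rewrite scale1r mul1r. Qed.

Lemma coord0 k : coord 0 k = 0.
Proof. by apply: (addrI (coord 0 k)); rewrite -coordD !addr0. Qed.

Lemma coordZ (c : R[i]) f k : coord (c *: f) k = c * coord f k.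
Proof. by have := coordZD c f 0 k; rewrite addr0 coord0 addr0. Qed.

Lemma coordB f g k : coord (f - g) k = coord f k - coord g k.
Proof. by rewrite -scaleN1r coordD coordZ mulN1r. Qed.

Lemma Re_dot_series f g :
  series (fun k => complex.Re (coord f k * conjc (coord g k))) n @[n --> \oo] -->
  complex.Re (dot f g).
Proof.
rewrite Re_dot.
have h : (series (fun k => normc (coord (f + g) k) ^+ 2) n -
          series (fun k => normc (coord (f - g) k) ^+ 2) n) / 4 @[n --> \oo] -->
  (bnorm (f + g) ^+ 2 - bnorm (f - g) ^+ 2) / 4.
  by apply: cvgMl; apply: cvgB; exact: parseval.
apply: cvg_trans h; apply: near_eq_cvg; apply: nearW => n.
rewrite /series/= -sumrB mulr_suml; apply: eq_bigr => k _.
rewrite coordD coordB !normcsqr; case: (coord f k) (coord g k) => [x y] [x' y'] /=.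
by field.
Qed.

Lemma dot_series f g :
  series (fun k => coord f k * conjc (coord g k) : C R) n @[n --> \oo] --> (dot f g : C R).
Proof.
have hR := @Re_dot_series f g; have := @Re_dot_series ((- 'i%C) *: f) g; rewrite -Im_dot => hI.
apply: (@cvgC_ReIm _ (fun n => \sum_(0 <= k < n) coord f k * conjc (coord g k))).
- by under eq_fun do rewrite Re_sum; exact: hR.
- under eq_fun do rewrite Im_sum.
  apply: cvg_trans hI; apply: near_eq_cvg; apply: nearW => n.
  apply: eq_bigr => k _; rewrite coordZ.
  by case: (coord f k) (coord g k) => [x y] [x' y'] /=; ring.
Qed.

End bergman_coordinates.

(** * Square-summable coordinates, the basis and the rotations *)

Section bergman_basis.
Context {R : realType} (lambda : R) (hlambda : -1 < lambda).
Local Notation H := (bergman lambda).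
Local Notation m := (moment lambda).
Local Notation coord := (@coord R lambda).
Implicit Types (f g : H) (a b : nat -> R[i]).

(** The ratio of consecutive terms is [t * (k + lambda + 2) / (k + 1)], at most 1 once
    [k >= (lambda + 2) / (1 - t)]. Thus dividing coordinates by [sqrt (m k)] does not bring the
    radius of convergence below 1. *)
Lemma geometric_moment_bound (t : R) : 0 < t < 1 -> exists B, forall k, t ^+ k / m k <= B.
Proof.
move=> /andP[t0 t1]; pose x k := t ^+ k / m k.
have m0 k : 0 < m k by exact: moment_gt0.
have x0 k : 0 <= x k by rewrite divr_ge0 ?exprn_ge0 ?ltW.
pose K := Num.trunc ((lambda + 2) / (1 - t)).
have dec k : (K < k)%N -> x k.+1 <= x k.
  move=> Kk; have k0 : 0 < k.+1%:R :> R by [].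
  have kl0 : 0 < k%:R + lambda + 2 by have := ler0n R k; move: hlambda; lra.
  have -> : x k.+1 = t * (k%:R + lambda + 2) / k.+1%:R * x k.
    rewrite /x (momentS hlambda) exprS; have := m0 k; move: (m k) => M M0.
    by field; rewrite !gt_eqF.
  rewrite ler_piMl// ler_pdivrMr// mul1r -natr1.
  have : (lambda + 2) / (1 - t) <= k%:R.
    by rewrite (le_trans (ltW (truncnS_gt _)))// ler_nat.
  rewrite ler_pdivrMr ?subr_gt0//.
  move: (ler0n R k) hlambda => ? ?; nra.
(* From index [K.+1] on the terms decrease; the sum of the nonnegative terms up to there bounds each
   of them. *)
exists (\sum_(j < K.+2) x j) => k.
have small j : (j < K.+2)%N -> x j <= \sum_(j < K.+2) x j.
  by move=> jK; rewrite (bigD1 (Ordinal jK))//= lerDl sumr_ge0.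
have [kK|Kk] := ltnP k K.+2; first exact: small.
rewrite -(subnK Kk); elim: (k - K.+2)%N => [|i IH].
  by rewrite add0n; apply: (le_trans (dec K.+1 _)) => //; exact: small.
by rewrite addSn; apply: le_trans IH; apply: dec; rewrite ltn_addl.
Qed.

(** The surjectivity half of the identification with l^2 (Riesz-Fischer): the function is built from
    its power series, and the upper norm inequality places it in the space. *)
Lemma exists_coord a (B : R) : (forall n, \sum_(k < n) normc (a k) ^+ 2 <= B) ->
  exists f, forall k, coord f k = a k.
Proof.
move=> aB; have m0 k : 0 < m k by exact: moment_gt0.
pose b k := a k / (Num.sqrt (m k))%:C%C.
have b2 k : normc (b k) ^+ 2 = normc (a k) ^+ 2 / m k.
  rewrite normcM normcV normc_real exprMn exprVn real_normK ?num_real//.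
  by rewrite sqr_sqrtr// ltW.
have bs (s : R) : 0 <= s < 1 -> asum b s.
  move=> /andP[s0 s1]; pose t := (s + 1) / 2.
  have tt : 0 < t ^+ 2 < 1 by rewrite exprn_gt0 ?expr_lt1//; rewrite /t; lra.
  have [B' hB'] := geometric_moment_bound tt.
  (* The square of [x = normc (b n) * t ^+ n] is [|a n|^2 * (t^2)^n / m n], at most [B * B']; then
     [x <= 1 + x ^ 2]. *)
  apply: (@geometric_bound_cvg _ _ (1 + B * B') s t) => [|n|n].
  - by rewrite s0 /t; lra.
  - exact: normc_ge0.
  have aB1 : normc (a n) ^+ 2 <= B.
    apply: le_trans (aB n.+1); rewrite big_ord_recr/= lerDr.
    by apply: sumr_ge0 => k _; rewrite sqr_ge0.
  have h : (normc (b n) * t ^+ n) ^+ 2 <= B * B'.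
    rewrite exprMn b2 exprAC mulrAC -mulrA; apply: ler_pM => //; rewrite ?sqr_ge0//.
    by apply: divr_ge0; [apply: exprn_ge0; exact: sqr_ge0|exact: ltW].
  have := sqr_ge0 (normc (b n) * t ^+ n - 1).
  move: h; move: (normc (b n) * t ^+ n) (B * B') => x y; nra.
have : forall z : R[i], exists l, normc z < 1 -> psum b z l.
  move=> z; have [z1|z1] := ltP (normc z) 1; last first.
    by exists 0.
  have [|l bl] := asum_psum (lexx (normc z)) (bs (normc z) _).
    by rewrite normc_ge0.
  by exists l.
move=> /choice[F0 hF0].
pose F z := if normc z < 1 then F0 z else 0.
have bF z : normc z < 1 -> psum b z (F z) by move=> z1; rewrite /F z1; exact: hF0.
have Fm : F \in bergman_pred lambda.
  apply: (mem_bergman hlambda (b := b) (B := B)) => //.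
    by move=> z; rewrite unit_diskE /F => /negP/negbTE ->.
  by move=> n; under eq_bigr do rewrite b2 divfK ?gt_eqF//; exact: aB.
exists (Bergman Fm) => k; rewrite /coord (@coef_unique _ _ b)//.
by rewrite /b divfK// sqrt_moment_neq0.
Qed.

Lemma psum_monomial (c z : R[i]) k :
  psum (fun j => if j == k then c else 0) z (c * z ^+ k).
Proof.
apply: cvg_near_cst; near=> n.
have kn : (k < n)%N by near: n; exact: nbhs_infty_gt.
rewrite /series/= big_mkord (bigD1 (Ordinal kn))//= eqxx big1 ?addr0// => j jk.
by rewrite ifF ?mul0r//; apply: contraNF jk => /eqP h; apply/eqP/val_inj.
Unshelve. all: by end_near. Qed.

Lemma coord_basis k j : coord (Defs.basis lambda k) j = (j == k)%:R.
Proof.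
have m0 i : 0 < m i by exact: moment_gt0.
pose c : R[i] := ((Num.sqrt (m k))^-1)%:C%C.
pose F (z : R[i]) := if z \in @unit_disk R then c * z ^+ k else 0.
pose b i := if i == k then c else 0 : R[i].
have bF z : normc z < 1 -> psum b z (F z).
  move=> z1; rewrite /F ifT; first exact: psum_monomial.
  by rewrite inE unit_diskE.
have Fm : F \in bergman_pred lambda.
  apply: (mem_bergman hlambda bF (B := 1)) => [z|n].
    by move=> nz; rewrite /F ifF//; apply/negP; rewrite inE.
  apply: (@le_trans _ _ (\sum_(i < n) (if i == k :> nat then 1 else 0))).
    apply: ler_sum => i _; rewrite /b; case: eqP => [->|_]; last first.
      by rewrite normc0 expr0n mul0r.
    rewrite normc_real real_normK ?num_real// exprVn sqr_sqrtr ?(ltW (m0 k))//.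
    by rewrite mulVf// gt_eqF.
  have [kn|nk] := ltnP k n; last first.
    rewrite big1// => i _; rewrite ifF//; apply/negbTE/eqP => ik.
    by have := ltn_ord i; rewrite ik ltnNge nk.
  rewrite (bigD1 (Ordinal kn))//= eqxx big1 ?addr0// => i ik.
  by rewrite ifF//; apply: contraNF ik => /eqP h; apply/eqP/val_inj.
have FE : (fun z : R[i] => if z \in @unit_disk R then
    (Num.sqrt (Gamma (k%:R + lambda + 2) / (k`!%:R * Gamma (lambda + 2))))%:C%C * z ^+ k
  else 0) = F.
  apply/funext => z; rewrite /F /c -sqrtrV ?(ltW (m0 k))//.
  by rewrite /moment invf_div.
(* Membership of the monomial excludes the default value of [insubd]. *)
have -> : Defs.basis lambda k = Bergman Fm.
  by apply: val_inj; rewrite /Defs.basis FE val_insubd Fm.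
rewrite /coord (@coef_unique _ _ b)// /b; case: eqP => [->|_]; last by rewrite mul0r.
by rewrite /c -rmorphM/= mulVf// gt_eqF// sqrtr_gt0.
Qed.

Lemma coord_rotation t f k : normc t = 1 -> coord (rotation t f) k = t ^- k * coord f k.
Proof.
move=> t1; have tV z : normc (t^-1 * z) = normc z by rewrite normcM normcV t1 invr1 mul1r.
pose F z := f (t^-1 * z).
pose b j := t ^- j * coef f j.
have bF z : normc z < 1 -> psum b z (F z).
  move=> z1; have := @coefP _ _ f (t^-1 * z); rewrite tV => /(_ z1).
  rewrite /psum; have -> : (fun n => coef f n * (t^-1 * z) ^+ n : C R) = (fun n => b n * z ^+ n : C R).
    by apply/funext => n; rewrite /b exprMn exprVn mulrCA mulrA.
  by [].
have Fm : F \in bergman_pred lambda.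
  apply: (mem_bergman hlambda bF (B := bnorm f ^+ 2)) => [z|n].
    have [_ _ f0] := bergmanP f; move=> nz; apply: f0.
    by move: nz; rewrite !unit_diskE tV.
  apply: le_trans (bessel hlambda f n); apply: ler_sum => j _.
  by rewrite (sqr_normc_coord hlambda) /b normcM normcV normcX t1 expr1n invr1 mul1r.
have -> : rotation t f = Bergman Fm.
  by apply: val_inj; rewrite /rotation val_insubd Fm.
by rewrite /coord (@coef_unique _ _ b)// /b mulrA.
Qed.

Lemma dot_basis f k : dot f (Defs.basis lambda k) = coord f k.
Proof.
have h := @dot_series _ _ hlambda f (Defs.basis lambda k).
have h' : series (fun j => coord f j * conjc (coord (Defs.basis lambda k) j) : C R) n
    @[n --> \oo] --> (coord f k : C R).
  apply: cvg_near_cst; near=> n.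
  have kn : (k < n)%N by near: n; exact: nbhs_infty_gt.
  rewrite /series/= big_mkord (bigD1 (Ordinal kn))//= coord_basis eqxx big1 ?addr0.
    by rewrite rmorph1 mulr1.
  move=> j jk; rewrite coord_basis; have -> : (j == k :> nat) = false.
    by apply: contraNF jk => /eqP jk; apply/eqP/val_inj.
  by rewrite rmorph0 mulr0.
by rewrite -(cvg_lim _ h)// -(cvg_lim _ h').
Unshelve. all: by end_near. Qed.

Lemma coord_eproj k f j : coord (eproj k f) j = (j == k)%:R * coord f k.
Proof. by rewrite /eproj coordZ coord_basis dot_basis mulrC. Qed.

End bergman_basis.

(** * Measurability with respect to the spectral measure *)

Section stieltjes_of_point_masses.
Context {R : realType} (c : nat -> R) (F : R -> R).
Hypothesis c0 : forall k, 0 <= c k.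
Hypothesis F_mass : forall a b, a <= b ->
  ((F b - F a)%:E = \sum_(0 <= k <oo) (if (a <= k%:R < b)%R then c k else 0%R)%:E)%E.

Let interchange (a b : nat -> R) : (forall n, a n <= b n) ->
  (\sum_(0 <= n <oo) (F (b n) - F (a n))%:E =
   \sum_(0 <= k <oo) \sum_(0 <= n <oo) (if (a n <= k%:R < b n)%R then c k else 0%R)%:E)%E.
Proof.
move=> ab; rewrite nneseries_interchange; last by move=> k n; rewrite lee_fin; case: ifP.
by apply: eq_eseriesr => n _; exact: F_mass.
Qed.

(* Intervals that cover the set [A] and contain no natural number outside [A]:
   [[k, k + 1/2[] for [k] in [A], and countably many intervals free of natural
   numbers. *)
Let cover_itv (A : set R) (p : nat * nat) : R * R :=
  match p.2 with
  | 0%N => (p.1%:R, if p.1%:R \in A then p.1%:R + 1 / 2 else p.1%:R)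
  | 1%N => (- p.1.+1%:R, 0)
  | j.+2 => (p.1%:R + j.+1%:R^-1, p.1.+1%:R)
  end.

Let cover_itv_le A p : (cover_itv A p).1 <= (cover_itv A p).2.
Proof.
case: p => k [|[|j]] /=; rewrite /cover_itv/=.
- by case: ifP => // _; rewrite lerDl; lra.
- by rewrite oppr_le0.
- by rewrite -[k.+1%:R]natr1 lerD2l invf_le1 ?ltr0n// ler1n.
Qed.

Let cover_itv_nat A p (i : nat) :
  (cover_itv A p).1 <= i%:R < (cover_itv A p).2 -> p = (i, 0%N) /\ i%:R \in A.
Proof.
case: p => k [|[|j]] /=; rewrite /cover_itv/=.
- case: ifP => [kA /andP[ki ik]|_ /andP[ki /(le_lt_trans ki)]]; last by rewrite ltxx.
  suff <- : k = i by [].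
  apply/eqP; rewrite eqn_leq; move: (ki); rewrite ler_nat => ->/=.
  rewrite -ltnS -(ltr_nat R) -natr1; apply: (lt_trans ik); lra.
- by move=> /andP[_]; rewrite ltNge ler0n.
- move=> /andP[ki]; rewrite ltr_nat ltnS leqNgt -(ltr_nat R).
  by rewrite (lt_le_trans _ ki)// ltrDl invr_gt0 ltr0n.
Qed.

Let cover_itv_cover A : A `<=` \bigcup_p [set` `[(cover_itv A p).1, (cover_itv A p).2[].
Proof.
move=> x Ax; have [x0|x0] := ltP x 0.
  exists (Num.trunc `|x|, 1%N) => //=; rewrite in_itv/= x0 andbT.
  rewrite lerNl; apply: (le_trans _ (ltW (truncnS_gt `|x|))).
  by rewrite -normrN ler_norm.
pose k := Num.trunc x.
have [kx xk] : k%:R <= x /\ x < k.+1%:R.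
  by have /andP[] := truncn_itv x0.
have [kE|kx'] := eqVneq k%:R x.
  exists (k, 0%N) => //=; rewrite in_itv/= /cover_itv/= kE lexx/=.
  by rewrite (mem_set Ax); lra.
have d0 : 0 < x - k%:R by rewrite subr_gt0 lt_neqAle kx'.
exists (k, (Num.trunc (x - k%:R)^-1).+2) => //=; rewrite in_itv/= /cover_itv/= xk andbT.
rewrite -lerBrDl -[leRHS]invrK lef_pV2 ?posrE ?invr_gt0//.
exact: ltW (truncnS_gt _).
Qed.

(** After exchanging the two sums, a cover of [A] counts the mass at each natural number of [A] at
    least once, whereas the cover by [cover_itv] counts it at most once and counts no other mass. *)
Lemma stieltjes_outer_mass (A : set R) :
  stieltjes_outer F A = (\sum_(0 <= k <oo) (if k%:R%R \in A then c k else 0%R)%:E)%E.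
Proof.
apply/eqP; rewrite eq_le; apply/andP; split; last first.
  apply: le_ereal_inf_tmp => _ [a [b [ab Aab ->]]]; rewrite interchange//.
  apply: lee_nneseries => [k _ _|k _]; first by rewrite lee_fin; case: ifP.
  case: ifP => [|_]; last by apply: nneseries_ge0 => n _ _; rewrite lee_fin; case: ifP.
  rewrite inE => /Aab[n _]/=; rewrite in_itv/= => kn.
  apply: (@le_trans _ _ (\sum_(0 <= i < n.+1) (if (a i <= k%:R < b i)%R then c k else 0%R)%:E)%E).
    rewrite big_nat_recr//= kn leeDr//; apply: sume_ge0 => i _.
    by rewrite lee_fin; case: ifP.
  by apply: nneseries_lim_ge => i _ _; rewrite lee_fin; case: ifP.
(* The doubly indexed cover is enumerated by [pickle]; an index that codes no pair receives the
   empty interval [[0, 0[]. *)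
pose a n := if pickle_inv n is Some p then (cover_itv A p).1 else 0.
pose b n := if pickle_inv n is Some p then (cover_itv A p).2 else 0.
have ab n : a n <= b n.
  by rewrite /a /b; case: pickle_inv => [p|//]; exact: cover_itv_le.
apply: (@le_trans _ _ (\sum_(0 <= n <oo) (F (b n) - F (a n))%:E)%E).
  apply: ereal_inf_lbound; exists a, b; split => // x /cover_itv_cover[p _ xp].
  by exists (pickle p) => //; rewrite /a /b pickleK_inv.
rewrite interchange//; apply: lee_nneseries => [k _ _|k _].
  by apply: nneseries_ge0 => n _ _; rewrite lee_fin; case: ifP.
apply: lime_le; first by apply: is_cvg_nneseries => n _ _; rewrite lee_fin; case: ifP.
apply: nearW => N.
have term n : (if (a n <= k%:R < b n)%R then c k else 0) <=
    if n == pickle (k, 0%N) then (if k%:R \in A then c k else 0) else 0 :> R.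
  case: ifP => [|_]; last by case: ifP => // _; case: ifP.
  have := @pickle_invK _ n : oapp pickle n (@pickle_inv (nat * nat)%type n) = n.
  rewrite /a /b; case: pickle_inv => [p /= pn|_ /andP[h1 /(le_lt_trans h1)]]; last by rewrite ltxx.
  by move=> /cover_itv_nat[pE kA]; rewrite -pn pE eqxx kA.
apply: (@le_trans _ _ (\sum_(0 <= n < N) (if n == pickle (k, 0%N)
    then (if k%:R \in A then c k else 0)%R else 0%R)%:E)%E).
  by apply: lee_sum => n _; rewrite lee_fin.
rewrite sumEFin lee_fin big_mkord.
have ck0 : 0 <= (if k%:R \in A then c k else 0 : R) by case: ifP.
have [pN|Np] := ltnP (pickle (k, 0%N)) N; last first.
  by rewrite big1// => i _; rewrite ifF//; apply/negbTE/eqP => ip; have := ltn_ord i; rewrite ip ltnNge Np.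
rewrite (bigD1 (Ordinal pN))//= eqxx big1 ?addr0// => i ip.
by rewrite ifF//; apply: contraNF ip => /eqP h; apply/eqP/val_inj.
Qed.

(** A sum of point masses is additive on all sets, so every set splits every other one. *)
Lemma stieltjes_outer_caratheodory (A : set R) :
  caratheodory_measurable (stieltjes_outer F) A.
Proof.
move=> X; rewrite !stieltjes_outer_mass -nneseriesD.
- apply: eq_eseriesr => k _; rewrite -EFinD; congr (_%:E).
  rewrite !in_setI in_setC; case: (k%:R \in X) => /=; last by rewrite addr0.
  by case: (k%:R \in A) => /=; rewrite ?addr0 ?add0r.
- by move=> k _; rewrite lee_fin; case: ifP.
- by move=> k _; rewrite lee_fin; case: ifP.
Qed.

End stieltjes_of_point_masses.

(** * Radial operators *)

Section diagonal_operators.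
#[local] Opaque coord.
Context {R : realType} (lambda : R) (hlambda : -1 < lambda).
Local Notation H := (bergman lambda).
Local Notation coord := (@coord R lambda).
Local Notation e := (Defs.basis lambda).
Implicit Types (f g : H) (T U : H -> H) (d : nat -> R[i]) (phi : R -> R[i]).

Lemma coord_le f k : normc (coord f k) <= bnorm f.
Proof.
rewrite -(@ler_pXn2r _ 2) ?nnegrE ?normc_ge0 ?bnorm_ge0//.
apply: le_trans (bessel hlambda f k.+1); rewrite big_ord_recr/= lerDr.
by apply: sumr_ge0 => i _; rewrite sqr_ge0.
Qed.

Lemma bnorm_basis k : bnorm (e k) <= 1.
Proof.
rewrite -(@ler_pXn2r _ 2) ?nnegrE ?bnorm_ge0// expr1n.
apply: (bnorm_sqr_le hlambda) => n.
apply: (@le_trans _ _ (\sum_(i < n) (if i == k :> nat then 1 else 0))).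
  apply: ler_sum => i _; rewrite coord_basis// eq_sym; case: eqP => _.
    by rewrite normc1 expr1n.
  by rewrite normc0 expr0n.
have [kn|nk] := ltnP k n; last first.
  rewrite big1// => i _; rewrite ifF//; apply/negbTE/eqP => ik.
  by have := ltn_ord i; rewrite ik ltnNge nk.
rewrite (bigD1 (Ordinal kn))//= eqxx big1 ?addr0// => i ik.
by rewrite ifF//; apply: contraNF ik => /eqP h; apply/eqP/val_inj.
Qed.

Lemma coord_sum n (u : nat -> H) j : coord (\sum_(k < n) u k) j = \sum_(k < n) coord (u k) j.
Proof.
elim: n => [|n IH]; first by rewrite !big_ord0 coord0.
by rewrite !big_ord_recr/= coordD IH.
Qed.

Lemma sum_pick n j (u : nat -> R[i]) :
  \sum_(k < n) (j == k :> nat)%:R * u k = if (j < n)%N then u j else 0.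
Proof.
case: ifPn => [jn|]; last rewrite -leqNgt => nj.
  rewrite (bigD1 (Ordinal jn))//= eqxx mul1r big1 ?addr0// => i ij.
  rewrite (_ : (j == i :> nat) = false) ?mul0r//.
  by apply: contraNF ij => /eqP h; apply/eqP/val_inj.
rewrite big1// => i _; rewrite (_ : (j == i :> nat) = false) ?mul0r//.
by apply/negbTE/eqP => ji; have := ltn_ord i; rewrite -ji ltnNge nj.
Qed.

(** The difference has, up to sign, the coordinates of [g] from [n] on and 0 before, so its squared
    norm is bounded by the tail of the Parseval series of [g]. *)
Lemma truncation_cvg (u : nat -> H) g :
  (forall n j, coord (\sum_(k < n) u k) j = if (j < n)%N then coord g j else 0) ->
  bnorm (\sum_(k < n) u k - g) @[n --> \oo] --> (0 : R).
Proof.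
move=> ug; pose s := series (fun k => normc (coord g k) ^+ 2).
have s0 k : 0 <= normc (coord g k) ^+ 2 by rewrite sqr_ge0.
have le2 n : bnorm (\sum_(k < n) u k - g) ^+ 2 <= bnorm g ^+ 2 - s n.
  apply: (bnorm_sqr_le hlambda) => N; rewrite lerBrDr.
  have wE k : normc (coord (\sum_(k < n) u k - g) k) ^+ 2 =
      if (k < n)%N then 0 else normc (coord g k) ^+ 2.
    rewrite coordB ug; case: ifP => _; first by rewrite subrr normc0 expr0n.
    by rewrite sub0r normcN.
  rewrite (eq_bigr _ (fun (k : 'I_N) _ => wE k)).
  rewrite -(big_mkord xpredT (fun k => if (k < n)%N then 0 else normc (coord g k) ^+ 2)).
  apply: (@le_trans _ _ (\sum_(0 <= k < n + N) normc (coord g k) ^+ 2)); last first.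
    by rewrite big_mkord; exact: bessel.
  have -> : s n = \sum_(0 <= k < n + N) (if (k < n)%N then normc (coord g k) ^+ 2 else 0).
    rewrite [RHS](big_cat_nat (n := n))//= ?leq_addr// [X in _ + X]big_nat_cond.
    rewrite [X in _ + X]big1 ?addr0 => [|i /andP[/andP[ni _] _]]; last by rewrite ltnNge ni.
    by rewrite /s /series/= [LHS]big_nat_cond [RHS]big_nat_cond; apply: eq_bigr => i /andP[/andP[_ ->]].
  apply: (@le_trans _ _ (\sum_(0 <= k < n + N) (if (k < n)%N then 0 else normc (coord g k) ^+ 2) +
    \sum_(0 <= k < n + N) (if (k < n)%N then normc (coord g k) ^+ 2 else 0))).
    rewrite lerD2r [X in _ <= X](big_cat_nat (n := N))//= ?leq_addl// lerDl.
    by apply: sumr_ge0 => k _; case: ifP.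
  by rewrite -big_split/=; apply: ler_sum => k _; case: ifP => _; rewrite ?add0r ?addr0.
have h0 : bnorm g ^+ 2 - s n @[n --> \oo] --> (0 : R).
  by rewrite -(subrr (bnorm g ^+ 2)); apply: cvgB; [exact: cvg_cst|exact: parseval].
have h1 : bnorm (\sum_(k < n) u k - g) ^+ 2 @[n --> \oo] --> (0 : R).
  apply: (@squeeze_cvgr _ _ _ _ (fun=> 0) (fun n => bnorm g ^+ 2 - s n)) => //.
    by apply: nearW => n; rewrite sqr_ge0 le2.
  exact: cvg_cst.
have h2 : Num.sqrt (bnorm (\sum_(k < n) u k - g) ^+ 2) @[n --> \oo] --> Num.sqrt (0 : R).
  by apply: continuous_cvg; [exact: sqrt_continuous|exact: h1].
rewrite sqrtr0 in h2; apply: cvg_trans h2; apply: near_eq_cvg; apply: nearW => n.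
by rewrite sqrtr_sqr ger0_norm// bnorm_ge0.
Unshelve. all: by end_near. Qed.

(** Convergence in norm forces convergence of each coordinate. It makes the choice in [strong_sum]
    unambiguous. *)
Lemma bnorm_cvg_unique (u : nat -> H) g g' :
  bnorm (u n - g) @[n --> \oo] --> (0 : R) -> bnorm (u n - g') @[n --> \oo] --> (0 : R) ->
  g = g'.
Proof.
have cv h : bnorm (u n - h) @[n --> \oo] --> (0 : R) -> forall k,
    (coord (u n) k : C R) @[n --> \oo] --> (coord h k : C R).
  move=> uh k; apply/cvgC_normc.
  apply: (@squeeze_cvgr _ _ _ _ (fun=> 0) (fun n => bnorm (u n - h))) => //.
    by near=> n; rewrite normc_ge0/= -coordB coord_le.
  exact: cvg_cst.
move=> ug ug'; apply: (coord_inj hlambda); apply/funext => k.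
by rewrite -(cvg_lim _ (cv _ ug k))// -(cvg_lim _ (cv _ ug' k)).
Unshelve. all: by end_near. Qed.

Lemma strong_sumE (A : nat -> H -> H) f g :
  bnorm (\sum_(k < n) A k f - g) @[n --> \oo] --> (0 : R) -> strong_sum A f = g.
Proof.
move=> Ag; rewrite /strong_sum.
have := @xgetPex _ 0 [set g | bnorm (\sum_(k < n) A k f - g) @[n --> \oo] --> (0 : R)]
  (ex_intro _ g Ag).
by move=> h; exact: bnorm_cvg_unique h Ag.
Qed.

Lemma exists_diag d (M : R) f : (forall k, normc (d k) <= M) ->
  exists g, forall k, coord g k = d k * coord f k.
Proof.
move=> dM; apply: (exists_coord hlambda (B := M ^+ 2 * bnorm f ^+ 2)) => n.
have M0 : 0 <= M by rewrite (le_trans _ (dM 0%N))// normc_ge0.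
apply: (@le_trans _ _ (M ^+ 2 * \sum_(k < n) normc (coord f k) ^+ 2)).
  rewrite mulr_sumr; apply: ler_sum => k _; rewrite normcM exprMn.
  by rewrite ler_wpM2r ?sqr_ge0// lerXn2r ?nnegrE ?normc_ge0.
by rewrite ler_wpM2l ?sqr_ge0// bessel.
Qed.

Definition diagonal T d : Prop := forall f k, coord (T f) k = d k * coord f k.

(** Treats [phi_of_N] and [spectral_measure] at once. For bounded entries the series converges at
    every [f], so the default value in [strong_sum] never occurs. *)
Lemma diagonal_strong_sum d (M : R) (A : nat -> H -> H) : (forall k, normc (d k) <= M) ->
  (forall k f, A k f = d k *: eproj k f) ->
  strongly_sums_to A (strong_sum A) /\ diagonal (strong_sum A) d.
Proof.
move=> dM AE.
suff h f : bnorm (\sum_(k < n) A k f - strong_sum A f) @[n --> \oo] --> (0 : R) /\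
    forall k, coord (strong_sum A f) k = d k * coord f k.
  by split=> f; have [] := h f.
have [g gE] := exists_diag f dM.
have cv : bnorm (\sum_(k < n) A k f - g) @[n --> \oo] --> (0 : R).
  apply: (truncation_cvg (u := fun k => A k f)) => n j.
  rewrite (coord_sum n (fun k => A k f)).
  rewrite (eq_bigr (fun k : 'I_n => (j == k :> nat)%:R * (d k * coord f k))); last first.
    by move=> k _; rewrite AE coordZ coord_eproj// mulrCA.
  by rewrite (sum_pick n j (fun k => d k * coord f k)) gE.
by rewrite (strong_sumE cv).
Qed.

Lemma phi_of_N_diagonal phi : ell_infty phi ->
  strongly_sums_to (fun k f => phi k%:R *: eproj k f) (phi_of_N lambda phi) /\
  diagonal (phi_of_N lambda phi) (fun k => phi k%:R).
Proof. by move=> [M hM]; exact: diagonal_strong_sum hM _. Qed.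

Lemma diagonal_inj T U d : diagonal T d -> diagonal U d -> T = U.
Proof.
move=> Td Ud; apply/funext => f; apply: (coord_inj hlambda); apply/funext => k.
by rewrite Td Ud.
Qed.

Lemma diagonal_bounded_operator T d (M : R) : (forall k, normc (d k) <= M) ->
  diagonal T d -> bounded_operator T.
Proof.
move=> dM Td; split.
  move=> c f g; apply: (coord_inj hlambda); apply/funext => k.
  by rewrite Td !coordZD !Td mulrDr mulrCA.
have M0 : 0 <= M by rewrite (le_trans _ (dM 0%N))// normc_ge0.
exists M => f; rewrite -(@ler_pXn2r _ 2) ?nnegrE ?mulr_ge0 ?bnorm_ge0// exprMn.
apply: (bnorm_sqr_le hlambda) => n.
apply: (@le_trans _ _ (M ^+ 2 * \sum_(k < n) normc (coord f k) ^+ 2)).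
  rewrite mulr_sumr; apply: ler_sum => k _; rewrite Td normcM exprMn.
  by rewrite ler_wpM2r ?sqr_ge0// lerXn2r ?nnegrE ?normc_ge0.
by rewrite ler_wpM2l ?sqr_ge0// bessel.
Qed.

Lemma diagonal_radial T d : diagonal T d -> radial T.
Proof.
move=> Td t t1; apply/funext => f; apply: (coord_inj hlambda); apply/funext => k /=.
have {}t1 : normc t = 1 by move: t1; rewrite norm_normc => -[].
by rewrite Td !coord_rotation// Td mulrCA.
Qed.

Lemma bounded_operator_bound T : bounded_operator T ->
  exists2 M : R, 0 <= M & forall f, bnorm (T f) <= M * bnorm f.
Proof.
move=> [_ [M hM]]; exists `|M| => // f.
by rewrite (le_trans (hM f))// ler_wpM2r ?bnorm_ge0// ler_norm.
Qed.

Lemma diagonal_bound T d : bounded_operator T -> diagonal T d ->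
  exists M : R, forall k, normc (d k) <= M.
Proof.
move=> /bounded_operator_bound[M M0 hM] Td; exists M => k.
have -> : d k = coord (T (e k)) k by rewrite Td coord_basis// eqxx mulr1.
rewrite (le_trans (coord_le _ _))// (le_trans (hM _))//.
by rewrite -[leRHS]mulr1 ler_wpM2l// bnorm_basis.
Qed.

(** The [j]-th coordinate of [T] on the truncations [P n] of [f] has its final value as soon as
    [n > j]; boundedness of [T] transfers it to [f], the error being at most
    [M * bnorm (P n - f)]. *)
Lemma diagonal_of_basis T : bounded_operator T ->
  (forall k j, j != k -> coord (T (e k)) j = 0) ->
  diagonal T (fun k => coord (T (e k)) k).
Proof.
move=> bT Te f j; have [lT _] := bT.
have [M M0 hM] := bounded_operator_bound bT.
have T0 : T 0 = 0.
  by have := lT 1 0 0; rewrite !scale1r addr0 => h; apply: (addrI (T 0)); rewrite -h addr0.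
have TD f1 f2 : T (f1 + f2) = T f1 + T f2 by have := lT 1 f1 f2; rewrite !scale1r.
have TZ c f1 : T (c *: f1) = c *: T f1 by have := lT c f1 0; rewrite !addr0 T0 addr0.
have TB f1 f2 : T (f1 - f2) = T f1 - T f2 by rewrite TD -scaleN1r TZ scaleN1r.
have Tsum n (u : nat -> H) : T (\sum_(k < n) u k) = \sum_(k < n) T (u k).
  by elim: n => [|n IH]; rewrite ?big_ord0// !big_ord_recr/= TD IH.
pose P n := \sum_(k < n) coord f k *: e k.
have Pf : bnorm (P n - f) @[n --> \oo] --> (0 : R).
  apply: (truncation_cvg (u := fun k => coord f k *: e k)) => n i.
  rewrite (coord_sum n (fun k => coord f k *: e k)).
  rewrite (eq_bigr (fun k : 'I_n => (i == k :> nat)%:R * coord f k)) ?sum_pick//.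
  by move=> k _; rewrite coordZ coord_basis// mulrC.
have small n : (j < n)%N ->
    normc (coord (T f) j - coord (T (e j)) j * coord f j) <= M * bnorm (P n - f).
  move=> jn; apply: le_trans (hM _); apply: le_trans (coord_le _ j).
  rewrite TB coordB /P (Tsum n (fun k => coord f k *: e k)).
  rewrite (coord_sum n (fun k => T (coord f k *: e k))).
  rewrite (eq_bigr (fun k : 'I_n => (j == k :> nat)%:R * (coord (T (e j)) j * coord f j))).
    by rewrite (sum_pick n j (fun=> coord (T (e j)) j * coord f j)) jn normcB.
  move=> k _; rewrite TZ coordZ; case: eqVneq => [->|jk]; first by rewrite [RHS]mul1r [LHS]mulrC.
  by rewrite (Te k j jk) [LHS]mulr0 [RHS]mul0r.
have lim0 : normc (coord (T f) j - coord (T (e j)) j * coord f j) <= 0.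
  have h : M * bnorm (P n - f) @[n --> \oo] --> (0 : R).
    by rewrite -(mulr0 M); apply: cvgMr; exact: Pf.
  rewrite -(cvg_lim _ h)//; apply: limr_ge; first by apply/cvg_ex; exists 0; exact: h.
  by near=> n; apply: small; near: n; exact: nbhs_infty_gt.
apply/eqP; rewrite -subr_eq0; apply/eqP/eq0_normc/eqP.
by rewrite eq_le lim0 normc_ge0.
Unshelve. all: by end_near. Qed.

(** With [t] a [d]-th root of -1, the two powers are nonzero and opposite. The choice of [t] depends
    on the pair of indices, which is enough for separating them one pair at a time. *)
Lemma exists_unit_separating k (d : nat) : (0 < d)%N ->
  exists2 t : R[i], normc t = 1 & t ^+ (k + d) != t ^+ k.
Proof.
move=> d0; pose t : R[i] := d.-root (- 1).
have td : t ^+ d = - 1 by rewrite rootCK.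
have t1 : normc t = 1.
  apply/eqP; rewrite -(@pexpr_eq1 _ _ d) ?normc_ge0//.
  by rewrite -normcX td normcN normc1.
exists t => //; have t0 : t ^+ k != 0 by rewrite expf_neq0// -normc_gt0 t1.
rewrite exprD td mulrN1 -subr_eq0 -opprD oppr_eq0 -mulr2n mulrn_eq0//.
Qed.

Lemma radial_diagonal T : bounded_operator T -> radial T ->
  diagonal T (fun k => coord (T (e k)) k).
Proof.
move=> bT rT; apply: diagonal_of_basis => // k j jk.
have [lT _] := bT.
have T0 : T 0 = 0.
  by have := lT 1 0 0; rewrite !scale1r addr0 => h; apply: (addrI (T 0)); rewrite -h addr0.
have TZ c f1 : T (c *: f1) = c *: T f1 by have := lT c f1 0; rewrite !addr0 T0 addr0.
have [t t1 tjk] : exists2 t : R[i], normc t = 1 & t ^+ j != t ^+ k.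
  have [kj|kj|kj] := ltngtP k j.
  - by have [|t t1 h] := @exists_unit_separating k (j - k); rewrite ?subn_gt0//;
      exists t => //; rewrite -(subnKC (ltnW kj)).
  - have [|t t1 h] := @exists_unit_separating j (k - j); rewrite ?subn_gt0//.
    by exists t => //; rewrite -(subnKC (ltnW kj)) eq_sym.
  - by move: jk; rewrite kj eqxx.
have t0 : t != 0 by rewrite -normc_gt0 t1.
have nt : `|t| = 1 by rewrite norm_normc t1.
have rE : rotation t (e k) = t ^- k *: e k.
  apply: (coord_inj hlambda); apply/funext => i.
  rewrite coord_rotation// coordZ coord_basis//; case: eqVneq => [->|_] //.
  by rewrite !mulr0.
(* The [j]-th coordinate of [T (e k)] is multiplied by [t ^- k] on one side and by [t ^- j] on the
   other, so it vanishes. *)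
have := congr1 (fun F => coord (F (e k)) j) (rT t nt); rewrite /= rE TZ coordZ coord_rotation//.
move=> /eqP; rewrite -subr_eq0 -mulrBl mulf_eq0 subr_eq0 => /orP[|/eqP//].
by rewrite (inj_eq invr_inj) eq_sym (negbTE tjk).
Qed.

Lemma resolution_diagonal (S : set R) :
  diagonal (spectral_measure S) (fun k => (k%:R \in S)%:R).
Proof.
apply: (proj2 (diagonal_strong_sum (M := 1) _ _)) => [k|k f].
  by rewrite normc_nat lern1 leq_b1.
by case: ifP => _; rewrite ?scale1r ?scale0r.
Qed.

Lemma cvg_nneseries (u : nat -> R) (l : R) : (forall k, 0 <= u k) ->
  series u n @[n --> \oo] --> l -> (\sum_(0 <= k <oo) (u k)%:E = l%:E)%E.
Proof.
move=> u0 ul; apply/cvg_lim => //.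
have -> : (fun n => \sum_(0 <= k < n | xpredT k) (u k)%:E)%E = (fun n => (series u n)%:E).
  by apply/funext => n; rewrite sumEFin.
by apply: cvg_EFin => //; near=> n.
Unshelve. all: by end_near. Qed.

Lemma rho_series f eta : series (fun k => if k%:R < eta then normc (coord f k) ^+ 2 else 0) n
  @[n --> \oo] --> rho f eta.
Proof.
have := @Re_dot_series _ _ hlambda f (resolution eta f); apply: cvg_trans.
apply: near_eq_cvg; apply: nearW => n; apply: eq_bigr => k _.
rewrite resolution_diagonal rmorphM/= mulrCA -sqr_normc.
have -> : (k%:R \in (`]-oo, eta[%classic : set R)) = (k%:R < eta) by rewrite mem_setE in_itv.
by case: ifP => _; rewrite ?rmorph1 ?rmorph0 ?mul1r ?mul0r.
Qed.

Lemma E_measurable_all phi : E_measurable lambda phi.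
Proof.
move=> f B _; pose c k := normc (coord f k) ^+ 2.
have c0 k : 0 <= c k by rewrite sqr_ge0.
have mass (a b : R) : a <= b -> ((rho f b - rho f a)%:E =
    \sum_(0 <= k <oo) (if (a <= k%:R < b)%R then c k else 0%R)%:E)%E.
  move=> ab; apply/esym/cvg_nneseries; first by move=> k; case: ifP.
  have -> : series (fun k => if a <= k%:R < b then c k else 0) =
      (fun n => series (fun k => if k%:R < b then c k else 0) n -
        series (fun k => if k%:R < a then c k else 0) n).
    apply/funext => n; rewrite /series/= -sumrB; apply: eq_bigr => k _.
    have [ka|ak] := ltP k%:R a; first by rewrite (lt_le_trans ka ab) subrr.
    by rewrite subr0.
  by apply: cvgB; exact: rho_series.
by split; exact: stieltjes_outer_caratheodory mass _.
Qed.

End diagonal_operators.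

(** * The algebra of bounded radial operators *)

Section radial_algebra.
#[local] Opaque coord.
Context {R : realType} (lambda : R) (hlambda : -1 < lambda).
Local Notation H := (bergman lambda).
Local Notation coord := (@coord R lambda).
Local Notation e := (Defs.basis lambda).
Implicit Types (f g : H) (T U : H -> H) (d : nat -> R[i]) (phi : R -> R[i]).

Lemma bounded_radialP T : bounded_radial_operators lambda T <->
  exists2 d, diagonal T d & exists M : R, forall k, normc (d k) <= M.
Proof.
split=> [[bT rT]|[d Td [M dM]]].
  have Td := radial_diagonal hlambda bT rT.
  by exists (fun k => coord (T (e k)) k) => //; exact: diagonal_bound bT Td.
split; last exact: diagonal_radial Td.
exact: diagonal_bounded_operator dM Td.
Qed.

Lemma bounded_functions_radial :
  bounded_functions_of_N lambda = bounded_radial_operators lambda.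
Proof.
apply/seteqP; split => T.
  move=> [phi [_ bphi] <-]; apply/bounded_radialP.
  have [_ Td] := phi_of_N_diagonal hlambda bphi.
  by exists (fun k => phi k%:R).
move=> /bounded_radialP[d Td [M dM]].
(* A step function interpolating the diagonal entries at the natural numbers. *)
pose phi (x : R) := d (Num.trunc x).
have phiE k : phi k%:R = d k by rewrite /phi natrK.
have bphi : ell_infty phi by exists M => k; rewrite phiE.
exists phi; first by split; [exact: E_measurable_all|].
have [_ Td'] := phi_of_N_diagonal hlambda bphi.
by apply: (diagonal_inj hlambda _ Td) => f k; rewrite Td' phiE.
Qed.

(** A natural number [k] in a set of zero [E]-measure is impossible: the spectral projection of that
    set would fix the nonzero vector [e k]. *)
Lemma E_equivalent_nat phi psi : E_equivalent lambda phi psi ->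
  forall k : nat, phi k%:R = psi k%:R.
Proof.
move=> [B [_ SB B0]] k; apply: contrapT => /SB kB.
have := resolution_diagonal hlambda B (e k) k.
rewrite B0 coord0 coord_basis// eqxx mulr1 (mem_set kB) => /esym/eqP.
by rewrite oner_eq0.
Qed.

(** The adjoint has the conjugate diagonal entries; the two inner products agree term by term in
    [dot_series]. *)
Lemma radial_adjoint T : bounded_radial_operators lambda T ->
  exists2 U, bounded_radial_operators lambda U & forall f g, dot (T f) g = dot f (U g).
Proof.
move=> /bounded_radialP[d Td [M dM]].
pose phi (x : R) := conjc (d (Num.trunc x)).
have phiE k : phi k%:R = conjc (d k) by rewrite /phi natrK.
have bphi : ell_infty phi by exists M => k; rewrite phiE normc_conjc.
have [_ Ud] := phi_of_N_diagonal hlambda bphi.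
exists (phi_of_N lambda phi).
  by apply/bounded_radialP; exists (fun k => phi k%:R).
move=> f g.
have h1 := @dot_series _ _ hlambda (T f) g.
have h2 := @dot_series _ _ hlambda f (phi_of_N lambda phi g).
have E : (fun k => coord (T f) k * conjc (coord g k) : C R) =
    (fun k => coord f k * conjc (coord (phi_of_N lambda phi g) k) : C R).
  apply/funext => k; rewrite Td Ud phiE.
  case: (d k) (coord f k) (coord g k) => [x y] [x' y'] [x'' y''].
  by apply/eqP; rewrite eq_complex /=; apply/andP; split; apply/eqP; ring.
by rewrite E in h1; exact: (cvg_unique (@norm_hausdorff _ _) h1 h2).
Qed.

(** One pair [(e k, e j)] with [j != k] suffices as a test: the approximating operators are diagonal
    and have entry 0 there, so the entry of [T] is smaller than every [eps]. *)
Lemma radial_weakly_closed T : bounded_operator T ->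
  (forall (s : seq (H * H)) (eps : R), 0 < eps ->
    exists2 U, bounded_radial_operators lambda U &
      forall p, p \in s -> normc (dot (T p.1 - U p.1) p.2) < eps) ->
  bounded_radial_operators lambda T.
Proof.
move=> bT clT; split => //; apply: (@diagonal_radial _ _ hlambda _ (fun k => coord (T (e k)) k)).
apply: diagonal_of_basis => // k j jk.
apply/eq0_normc/eqP; rewrite eq_le normc_ge0 andbT; apply/ler_addgt0Pr => eps eps0.
have [U /bounded_radialP[d Ud _] hU] := clT [:: (e k, e j)] eps eps0.
have := hU (e k, e j); rewrite inE eqxx => /(_ isT) h.
have {h} : normc (dot (T (e k) - U (e k)) (e j)) < eps := h.
rewrite dot_basis// coordB Ud coord_basis// (negbTE jk) mulr0 subr0 => /ltW h.
by rewrite add0r.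
Qed.

End radial_algebra.

Theorem corollary3p3 (R : realType) (lambda : R) (hlambda : -1 < lambda) :
  [/\ (* the operator phi(N) is defined by a strongly convergent series, and
         depends only on the E-equivalence class of phi *)
      (forall phi : R -> R[i], E_measurable lambda phi -> ell_infty phi ->
         strongly_sums_to (fun k (f : bergman lambda) => phi k%:R *: eproj k f)
           (phi_of_N lambda phi)),
      (forall phi psi : R -> R[i], E_measurable lambda phi -> E_measurable lambda psi ->
         E_equivalent lambda phi psi -> ell_infty phi ->
         ell_infty psi /\ phi_of_N lambda phi = phi_of_N lambda psi),
      bounded_functions_of_N lambda = bounded_radial_operators lambda,
      (forall S T : bergman lambda -> bergman lambda,
         bounded_functions_of_N lambda S -> bounded_functions_of_N lambda T ->
         S \o T = T \o S)
    & von_neumann_algebra (bounded_radial_operators lambda)].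
Proof.
split.
- by move=> phi _ bphi; have [] := phi_of_N_diagonal hlambda bphi.
- move=> phi psi _ _ /(E_equivalent_nat hlambda) phipsi bphi.
  have bpsi : ell_infty psi by have [M hM] := bphi; exists M => k; rewrite -phipsi.
  split; first exact: bpsi.
  have [_ d1] := phi_of_N_diagonal hlambda bphi.
  have [_ d2] := phi_of_N_diagonal hlambda bpsi.
  by apply: (diagonal_inj hlambda d1) => f k; rewrite d2 phipsi.
- exact: bounded_functions_radial.
- move=> S T; rewrite (bounded_functions_radial hlambda).
  move=> /(bounded_radialP hlambda)[d Sd _] /(bounded_radialP hlambda)[d' Td _].
  apply: (diagonal_inj hlambda (d := fun k => d k * d' k)) => f k /=.
    by rewrite Sd Td mulrA.
  by rewrite Td Sd mulrCA mulrA.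
split.
- by move=> T [].
- apply/(bounded_radialP hlambda); exists (fun=> 1).
    by move=> f k; rewrite mul1r.
  by exists 1 => k; rewrite normc1.
- move=> c T U /(bounded_radialP hlambda)[d Td [M dM]] /(bounded_radialP hlambda)[d' Ud [M' dM']].
  have M0 : 0 <= M by rewrite (le_trans _ (dM 0%N))// normc_ge0.
  split; apply/(bounded_radialP hlambda).
    exists (fun k => c * d k + d' k).
      by move=> f k; rewrite coordZD Td Ud mulrDl mulrA.
    exists (normc c * M + M') => k.
    by rewrite (le_trans (normcD _ _))// lerD// normcM ler_wpM2l ?normc_ge0.
  exists (fun k => d k * d' k); first by move=> f k /=; rewrite Td Ud mulrA.
  by exists (M * M') => k; rewrite normcM ler_pM ?normc_ge0.
- by move=> T; exact: radial_adjoint.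
- by move=> T; exact: radial_weakly_closed.
Qed.
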